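(* Let $1<p<\infty$ and let $q$ be its conjugate exponent, $\frac1p+\frac1q=1$. Then the maximum of $\lambda_1(V)$ over the class $S_p$ is achieved by the function $$V_0=M\left\|u_0^2\right\|_{L^q(\Omega)}^{1-q}\,|u_0|^{2(q-1)},$$ where $u_0$ is a minimizer of $J$ over the nonzero elements of $U=\mathcal H_0^1(\Omega)\cap L^{2q}(\Omega)$ (and $U\subset H_0(\Omega)$). The function $u_0$ can also be characterized as the first eigenfunction of the eigenvalue problem $$-\left(y^{2\alpha_1}\partial_x^2u+x^{2\alpha_2}\partial_y^2u\right)+V_0u=\lambda_1(V_0)u \ \text{ in } \Omega,\qquad u=0 \ \text{ on } \partial\Omega,$$ and $\lambda_1(V_0)=J(u_0)=\sup_{V\in S_p}\lambda_1(V)$. Furthermore, $V_0$ is the unique maximizer of $\lambda_1$ in $S_p$.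
   Context: Let $\alpha_1,\alpha_2\in(0,\frac12)$, $\Omega=\{(x,y)\in\mathbb R^2: 0<x<1,\ 0<y<1\}$, $M>0$ a constant, and $S_p=\{V\in L^p(\Omega): V\ge 0 \text{ a.e.},\ \|V\|_{L^p(\Omega)}\le M\}$. All functions are real valued and identified a.e. $\mathcal H^1(\Omega)=\{u\in L^2(\Omega): y^{\alpha_1}\partial_xu\in L^2(\Omega),\ x^{\alpha_2}\partial_yu\in L^2(\Omega)\}$ (distributional derivatives), with norm $\left(\|u\|_{L^2}^2+\|y^{\alpha_1}\partial_xu\|_{L^2}^2+\|x^{\alpha_2}\partial_yu\|_{L^2}^2\right)^{1/2}$; $\mathcal H_0^1(\Omega)$ is the closure of $C_0^\infty(\Omega)$ in $\mathcal H^1(\Omega)$. For $V\in S_p$, $H_0(\Omega)=\{u\in\mathcal H_0^1(\Omega): \iint_\Omega Vu^2\,dxdy<\infty\}$. Set $a_1(u,v)=\iint_\Omega (y^{\alpha_1}\partial_xu)(y^{\alpha_1}\partial_xv)+(x^{\alpha_2}\partial_yu)(x^{\alpha_2}\partial_yv)\,dxdy$. The eigenvalue problem $-(y^{2\alpha_1}\partial_x^2u+x^{2\alpha_2}\partial_y^2u)+Vu=\lambda u$ in $\Omega$, $u=0$ on $\partial\Omega$, is understood weakly: $0\ne u\in H_0(\Omega)$ and $a_1(u,v)+\iint_\Omega Vuv\,dxdy=\lambda\iint_\Omega uv\,dxdy$ for all $v\in H_0(\Omega)$. Its first (smallest) eigenvalue is $$\lambda_1(V)=\inf_{0\ne u\in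 H_0(\Omega)}\frac{a_1(u,u)+\iint_\Omega Vu^2\,dxdy}{\iint_\Omega u^2\,dxdy},$$ and a first eigenfunction is an eigenfunction for $\lambda_1(V)$. For $0\neq u\in U$, $$J(u)=\frac{a_1(u,u)+M\|u\|_{L^{2q}(\Omega)}^2}{\iint_\Omega |u|^2\,dxdy}.$$ Note that $J$ and the formula defining $V_0$ are invariant under multiplying by a nonzero scalar. *)

(* Defs.v *)
From HB Require Import structures.
From mathcomp Require Import all_boot all_order all_algebra.
From mathcomp Require Import all_classical all_reals all_analysis.

Set Implicit Arguments.
Unset Strict Implicit.
Unset Printing Implicit Defensive.

Import Order.TTheory GRing.Theory Num.Theory.
Import numFieldNormedType.Exports.

Local Open Scope classical_set_scope.
Local Open Scope ring_scope.

Section Domain.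
Context (R : realType).
Implicit Types (z : R * R) (u f g : R * R -> R).

Definition Omega : set (R * R) :=
  [set z | [/\ 0 < z.1, z.1 < 1, 0 < z.2 & z.2 < 1]].

Lemma OmegaE : Omega = `]0, 1[%classic `*` `]0, 1[%classic.
Proof.
rewrite /Omega; apply/seteqP; split=> -[x y] /=; rewrite !in_itv /=.
  by case=> -> -> -> ->.
by case=> /andP[-> ->] /andP[-> ->].
Qed.

Lemma measurable_Omega :
  measurable (Omega : set (measurableTypeR R * measurableTypeR R)).
Proof. by rewrite OmegaE; apply: measurableX; exact: measurable_itv. Qed.

(* Planar Lebesgue measure restricted to Omega.  A function on Omega is
   represented by a measurable function on the plane, whose values outside
   Omega are irrelevant; L^p(Omega) is thus [Lfun muO p%:E] and equality of
   elements of L^p(Omega) is [u = v %[ae muO]]. *)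
Definition muO :
    {measure set (measurableTypeR R * measurableTypeR R) -> \bar R} :=
  mrestr (@lebesgue_measure R \x @lebesgue_measure R)%E measurable_Omega.

Definition normL (p : R) u : R := fine ('N[muO]_(p%:E)[EFin \o u])%E.

Definition ex : R * R := (1, 0).
Definition ey : R * R := (0, 1).

Fixpoint Cn (n : nat) f : Prop :=
  if n is m.+1 then
    [/\ forall z, derivable f z ex, forall z, derivable f z ey,
        Cn m ('D_ex f) & Cn m ('D_ey f)]
  else continuous f.

(* C_0^infty(Omega), each function being extended by 0 to the plane. *)
Definition test_function f : Prop :=
  [/\ forall n, Cn n f, compact (closure [set z | f z != 0]) &
      closure [set z | f z != 0] `<=` Omega].

Definition loc_integrable f : Prop :=
  measurable_fun (setT : set (measurableTypeR R * measurableTypeR R)) f /\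
  forall K : set (R * R), compact K -> K `<=` Omega ->
    muO.-integrable K (EFin \o f).

(* g is the distributional derivative of u in the direction v on Omega. *)
Definition is_wderiv (v : R * R) u g : Prop :=
  loc_integrable g /\
  forall phi, test_function phi ->
    \int[muO]_z (u z * 'D_v phi z) = - \int[muO]_z (g z * phi z).

(* A choice of representative, unique up to a.e. equality on Omega. *)
Definition wderiv (v : R * R) u : R * R -> R :=
  xget (fun=> 0) [set g | is_wderiv v u g].

End Domain.

Arguments Omega R : clear implicits.
Arguments muO R : clear implicits.
Arguments ex R : clear implicits.
Arguments ey R : clear implicits.

Section Problem.
Context (R : realType) (alpha1 alpha2 : R).
Implicit Types (u v V : R * R -> R).

Definition wx u : R * R -> R := fun z => z.2 `^ alpha1 * wderiv (ex R) u z.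
Definition wy u : R * R -> R := fun z => z.1 `^ alpha2 * wderiv (ey R) u z.

(* The distributional derivatives of u are locally integrable functions as
   soon as their products with the weights, which are smooth and positive in
   Omega, are square integrable. *)
Definition H1 u : Prop :=
  [/\ u \in Lfun (muO R) 2%:E,
      exists g, is_wderiv (ex R) u g,
      exists g, is_wderiv (ey R) u g,
      wx u \in Lfun (muO R) 2%:E &
      wy u \in Lfun (muO R) 2%:E].

Definition normH1 u : R :=
  Num.sqrt (normL 2 u ^+ 2 + normL 2 (wx u) ^+ 2 + normL 2 (wy u) ^+ 2).

Definition H10 u : Prop :=
  H1 u /\
  forall e : R, 0 < e ->
    exists2 phi, test_function phi & normH1 (u \- phi) < e.

Definition H0 V u : Prop :=
  H10 u /\ (\int[muO R]_z (V z * u z ^+ 2)%:E < +oo)%E.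

Definition nonzero u : Prop := ~ (u = cst 0 %[ae muO R]).

Definition aform u v : R :=
  \int[muO R]_z (wx u z * wx v z + wy u z * wy v z).

Definition lambda1 V : R :=
  inf [set (aform u u + \int[muO R]_z (V z * u z ^+ 2))
             / \int[muO R]_z (u z ^+ 2)
      | u in [set u | H0 V u /\ nonzero u]].

Definition eigenfunction V (lambda : R) u : Prop :=
  [/\ H0 V u, nonzero u &
      forall v, H0 V v ->
        aform u v + \int[muO R]_z (V z * u z * v z)
        = lambda * \int[muO R]_z (u z * v z)].

Definition first_eigenfunction V u : Prop := eigenfunction V (lambda1 V) u.

Definition Sp (p M : R) : set (R * R -> R) :=
  [set V | [/\ V \in Lfun (muO R) p%:E,
               {ae muO R, forall z, 0 <= V z} & normL p V <= M]].

Definition U (q : R) : set (R * R -> R) :=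
  [set u | H10 u /\ u \in Lfun (muO R) (2 * q)%:E].

Definition J (q M : R) u : R :=
  (aform u u + M * normL (2 * q) u ^+ 2) / \int[muO R]_z (`|u z| ^+ 2).

Definition J_minimizer (q M : R) u : Prop :=
  [/\ U q u, nonzero u &
      forall w, U q w -> nonzero w -> J q M u <= J q M w].

Definition V_of (q M : R) u : R * R -> R :=
  fun z => M * normL q (fun z => u z ^+ 2) `^ (1 - q)
             * `|u z| `^ (2 * (q - 1)).

End Problem.

(* Main.v *)
Require Import Defs.
From HB Require Import structures.
From mathcomp Require Import all_boot all_order all_algebra.
From mathcomp Require Import all_classical all_reals all_analysis.
From mathcomp Require Import measurable_realfun ring lra.

Set Implicit Arguments.
Unset Strict Implicit.
Unset Printing Implicit Defensive.

Import Order.TTheory GRing.Theory Num.Theory.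
Import numFieldNormedType.Exports.

Local Open Scope classical_set_scope.
Local Open Scope ring_scope.

(** The two variational problems are linked by duality. For V in the class, the
    inequality of Hoelder bounds the integral of V u^2 by M * Nq u, where Nq u is
    the L^q norm of u^2; hence every lambda1 V is at most the minimum of J, called
    ground below. Equality is reached by the potential V0 for which Hoelder is an
    equality at a minimizer u0, provided that u0 is also a first eigenfunction
    for V0, and strict convexity of x^p makes V0 the only such potential.

    The main device is hidden convexity. In the square variable u^2, that is under
    hypot u v = sqrt (u^2 + v^2), the gradient energy is subadditive (hypot_H10),
    Nq is a norm, and the L^2 norm squared is linear. It is used twice.

    Existence of a minimizer of J (exists_ground). Taking midpoints in the square
    variable preserves almost minimality. Among almost minimizers one therefore
    can minimise the integral of |u|^(2q), and the quantitative strict convexity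
    of x^q (defect_control) makes the moduli a Cauchy sequence in L^2. The limit
    has the right energy by weak_limit: a function that is approached in L^2 by
    test functions of bounded energy is also the limit of test functions with
    convergent gradients.

    Comparison of V0 with J (ground_V0). Along the path sqrt (u0^2 + t v^2), the
    minimality of u0 gives, as t tends to 0, the inequality
    ground * N2 v^2 <= aform v v + (integral of V0 v^2), first for v in L^(2q) and
    then by truncation for all v in H0 V0. So lambda1 V0 = ground, and the
    quadratic form of the eigenvalue problem at level ground is nonnegative; it
    vanishes at u0, which is a first eigenfunction by stationarity (form_null).

    For the simplicity of the eigenvalue, the null vectors of this form constitute
    a vector space stable under u |-> |u|. A nonnegative null vector w obeys a
    strong maximum principle (strong_maximum): testing its equation with
    chi^2 / (e + w) bounds the gradient of ln (e + w) on squares independently of e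
    (log_estimate), whereas if w vanished on a part of the square of positive
    measure and was positive on another one, the means of ln (e + w) over the two
    parts would move apart as e tends to 0 (logf_mean). So null vectors have a
    constant sign, and a combination of two of them with integral 0 vanishes.

    The analysis of H10 rests on its description as the closure of the graph of
    the weighted gradient over the test functions (H10_Wgraph, Wgraph_H10), which
    uses the uniqueness of weak derivatives (fundamental_lemma). *)

(** * Square-integrable functions *)

Lemma cvg_EFin_seq (R : realType) (u : nat -> R) l :
  u @ \oo --> l -> (fun n => (u n)%:E) @ \oo --> l%:E.
Proof.
by move=> ul; apply: (@cvg_EFin _ _ _ _ (fun n => (u n)%:E)); [exact: nearW|].
Qed.

Section SquareIntegrable.
Context d (T : measurableType d) (R : realType).
Variable mu : {measure set T -> \bar R}.
Implicit Types (f g h : T -> R).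

Definition intble f := mu.-integrable setT (EFin \o f).
Definition L2 f := measurable_fun setT f /\ intble (fun x => f x ^+ 2).
Definition N2 f : R := Num.sqrt (\int[mu]_x (f x ^+ 2)).

Lemma intble_measurable f : intble f -> measurable_fun setT f.
Proof. by move=> /integrableP[/measurable_EFinP]. Qed.

Lemma intble_le f g : measurable_fun setT f -> (forall x, `|f x| <= g x) ->
  intble g -> intble f.
Proof.
move=> mf fg ig; apply: le_integrable ig => //; first exact/measurable_EFinP.
by move=> x _ /=; rewrite lee_fin (le_trans (fg x))// ler_norm.
Qed.

Lemma intble_ext f g : f =1 g -> intble f -> intble g.
Proof. by move=> /funext ->. Qed.

Lemma intbleD f g : intble f -> intble g -> intble (fun x => f x + g x).
Proof. by move=> fi gi; exact: (integrableD measurableT fi gi). Qed.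

Lemma intbleB f g : intble f -> intble g -> intble (fun x => f x - g x).
Proof. by move=> fi gi; exact: (integrableB measurableT fi gi). Qed.

Lemma intbleZ c f : intble f -> intble (fun x => c * f x).
Proof. by move=> fi; exact: (integrableZl measurableT c fi). Qed.

Lemma intble_norm f : intble f -> intble (fun x => `|f x|).
Proof. by move=> fi; exact: integrable_norm. Qed.

Lemma intD f g : intble f -> intble g ->
  \int[mu]_x (f x + g x) = \int[mu]_x f x + \int[mu]_x g x.
Proof. by move=> *; exact: RintegralD. Qed.

Lemma intB f g : intble f -> intble g ->
  \int[mu]_x (f x - g x) = \int[mu]_x f x - \int[mu]_x g x.
Proof. by move=> *; exact: RintegralB. Qed.

Lemma intZ c f : intble f -> \int[mu]_x (c * f x) = c * \int[mu]_x f x.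
Proof. by move=> *; exact: RintegralZl. Qed.

Lemma int_le f g : intble f -> intble g -> (forall x, f x <= g x) ->
  \int[mu]_x f x <= \int[mu]_x g x.
Proof. by move=> fi gi fg; apply: le_Rintegral. Qed.

Lemma int_ge0 f : (forall x, 0 <= f x) -> 0 <= \int[mu]_x f x.
Proof. by move=> f0; apply: Rintegral_ge0. Qed.

Lemma int_EFin f : intble f -> (\int[mu]_x f x)%:E = (\int[mu]_x (f x)%:E)%E.
Proof. by move=> fi; rewrite /Rintegral fineK//; exact: integrable_fin_num. Qed.

Lemma int_ae f g : measurable_fun setT f -> measurable_fun setT g ->
  f = g %[ae mu] -> \int[mu]_x f x = \int[mu]_x g x.
Proof.
move=> mf mg fg; congr fine; apply: ae_eq_integral => //;
  try exact/measurable_EFinP.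
by apply: filterS fg => x /= + _ => ->.
Qed.

Lemma intble_ae f g : measurable_fun setT g ->
  f = g %[ae mu] -> intble f -> intble g.
Proof.
move=> mg fg fi; have mf := intble_measurable fi.
move: fi => /integrableP[_ fi]; apply/integrableP; split.
  exact/measurable_EFinP.
apply: le_lt_trans fi; rewrite le_eqVlt; apply/orP; left; apply/eqP.
apply: ae_eq_integral => //=; try by apply/measurable_EFinP/measurableT_comp.
by apply: filterS fg => x /= + _ => ->.
Qed.

Lemma int_le_ae f g : intble f -> intble g -> {ae mu, forall x, f x <= g x} ->
  \int[mu]_x f x <= \int[mu]_x g x.
Proof.
move=> fi gi fg; have mf := intble_measurable fi.
have mg := intble_measurable gi.
have mfg : measurable_fun setT (fun x => Num.min (f x) (g x)).
  exact: measurable_minr.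
have E : f = (fun x => Num.min (f x) (g x)) %[ae mu].
  by apply: filterS fg => x /= fg _; rewrite min_l.
rewrite (int_ae mf mfg E); apply: int_le => //.
  exact: intble_ae E fi.
by move=> x; rewrite ge_min lexx orbT.
Qed.

Lemma int_eq0_ae f : intble f -> {ae mu, forall x, 0 <= f x} ->
  \int[mu]_x f x <= 0 -> f = cst 0 %[ae mu].
Proof.
move=> fi f0 If; have mf := intble_measurable fi.
have mnf : measurable_fun setT (fun x => `|f x|) by exact: measurableT_comp.
have E : f = (fun x => `|f x|) %[ae mu].
  by apply: filterS f0 => x /= f0 _; rewrite ger0_norm.
have I0 : \int[mu]_x `|f x| = 0.
  apply/eqP; rewrite eq_le int_ge0 ?andbT// -(int_ae mf mnf E)//.
have : (\int[mu]_x (`|(EFin \o f) x|) = 0)%E.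
  by rewrite -[LHS]/(\int[mu]_x (`|f x|)%:E)%E -int_EFin ?I0//; exact: intble_norm.
have /measurable_EFinP mf' := mf.
move=> /(ae_eq_integral_abs mu measurableT mf') H.
by apply: filterS H => x /= /(_ Logic.I) [->].
Qed.

Lemma L2_0 : L2 (cst 0).
Proof.
split; first exact: measurable_cst.
apply: (@intble_ext (cst 0)) => [x|]; first by rewrite /= expr0n.
exact: integrable0.
Qed.

Lemma L2Z c f : L2 f -> L2 (fun x => c * f x).
Proof.
move=> [mf fi]; split; first exact: measurable_funM.
by apply: (@intble_ext (fun x => c ^+ 2 * f x ^+ 2)) => [x|];
  [rewrite exprMn|exact: intbleZ].
Qed.

Lemma L2_le f g : measurable_fun setT f -> (forall x, `|f x| <= `|g x|) ->
  L2 g -> L2 f.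
Proof.
move=> mf fg [mg gi]; split=> //; apply: intble_le gi.
  exact: measurable_funX.
by move=> x; rewrite normrX -(real_normK (num_real (g x))) lerXn2r ?nnegrE.
Qed.

Lemma L2_norm f : L2 f -> L2 (fun x => `|f x|).
Proof.
move=> Lf; apply: (L2_le _ _ Lf) => [|x]; last by rewrite normr_id.
by apply: measurableT_comp => //; case: Lf.
Qed.

Lemma L2M f g : L2 f -> L2 g -> intble (fun x => f x * g x).
Proof.
move=> [mf fi] [mg gi].
apply: (@intble_le _ (fun x => f x ^+ 2 + g x ^+ 2)).
- exact: measurable_funM.
- move=> x; rewrite normrM -(real_normK (num_real (g x))).
  rewrite -(real_normK (num_real (f x))).
  have := normr_ge0 (f x); have := normr_ge0 (g x).
  move: `|f x| `|g x| => a b; nra.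
- exact: intbleD.
Qed.

Lemma L2D f g : L2 f -> L2 g -> L2 (fun x => f x + g x).
Proof.
move=> Lf Lg; split; first by apply: measurable_funD; [case: Lf|case: Lg].
apply: (@intble_ext (fun x => f x ^+ 2 + 2 * (f x * g x) + g x ^+ 2)) => [x|].
  by ring.
by apply: intbleD; [apply: intbleD; [case: Lf|apply: intbleZ; exact: L2M]|case: Lg].
Qed.

Lemma L2B f g : L2 f -> L2 g -> L2 (fun x => f x - g x).
Proof.
move=> Lf Lg; have := L2D Lf (L2Z (-1) Lg).
by congr (L2 _); apply/funext => x; rewrite mulN1r.
Qed.

Lemma L2_ae f g : measurable_fun setT g -> f = g %[ae mu] -> L2 f -> L2 g.
Proof.
move=> mg fg [mf fi]; split=> //; apply: intble_ae fi.
  exact: measurable_funX.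
by apply: filterS fg => x /= fg xT; rewrite fg.
Qed.

Lemma N2_ge0 f : 0 <= N2 f. Proof. exact: sqrtr_ge0. Qed.

Lemma N2_sqr f : N2 f ^+ 2 = \int[mu]_x (f x ^+ 2).
Proof. by rewrite sqr_sqrtr// int_ge0// => x; exact: sqr_ge0. Qed.

Lemma N2_ext f g : f =1 g -> N2 f = N2 g.
Proof. by move=> /funext ->. Qed.

Lemma N2_ae f g : measurable_fun setT f -> measurable_fun setT g ->
  f = g %[ae mu] -> N2 f = N2 g.
Proof.
move=> mf mg fg; rewrite /N2; congr Num.sqrt; apply: int_ae.
- exact: measurable_funX.
- exact: measurable_funX.
- by apply: filterS fg => x /= fg xT; rewrite fg.
Qed.

Lemma N2_0 : N2 (cst 0) = 0.
Proof.
rewrite /N2 (_ : \int[mu]_x _ = 0) ?sqrtr0//.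
under eq_Rintegral do rewrite expr0n/=.
by rewrite /Rintegral integral0.
Qed.

Lemma N2Z c f : L2 f -> N2 (fun x => c * f x) = `|c| * N2 f.
Proof.
move=> [mf fi]; rewrite /N2; under eq_Rintegral do rewrite exprMn.
by rewrite intZ// sqrtrM ?sqr_ge0// sqrtr_sqr.
Qed.

Lemma N2_le f g : L2 f -> L2 g -> (forall x, `|f x| <= `|g x|) -> N2 f <= N2 g.
Proof.
move=> [mf fi] [mg gi] fg; rewrite ler_wsqrtr// int_le// => x.
by rewrite -(real_normK (num_real (f x))) -(real_normK (num_real (g x)))
  lerXn2r ?nnegrE.
Qed.

Lemma int_sqrD f g c : L2 f -> L2 g ->
  \int[mu]_x ((f x + c * g x) ^+ 2) =
  N2 f ^+ 2 + 2 * c * \int[mu]_x (f x * g x) + c ^+ 2 * N2 g ^+ 2.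
Proof.
move=> Lf Lg; rewrite !N2_sqr.
have -> : \int[mu]_x ((f x + c * g x) ^+ 2) =
   \int[mu]_x ((f x ^+ 2 + 2 * c * (f x * g x)) + c ^+ 2 * g x ^+ 2).
  by apply: eq_Rintegral => x _; ring.
have fi := Lf.2; have gi := Lg.2; have fgi := L2M Lf Lg.
rewrite intD; [|by apply: intbleD => //; exact: intbleZ|exact: intbleZ].
by rewrite intD//; [rewrite !intZ|exact: intbleZ].
Qed.

(** The quadratic polynomial c |-> N2 (f + c g)^2 is nonnegative. *)
Lemma cauchy_schwarz f g : L2 f -> L2 g ->
  `|\int[mu]_x (f x * g x)| <= N2 f * N2 g.
Proof.
move=> Lf Lg; set b := \int[mu]_x _.
have H c : 0 <= N2 f ^+ 2 + 2 * c * b + c ^+ 2 * N2 g ^+ 2.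
  by rewrite -int_sqrD// int_ge0// => x; exact: sqr_ge0.
rewrite -(@ler_pXn2r _ 2) ?nnegrE ?mulr_ge0 ?N2_ge0//.
rewrite real_normK ?num_real// exprMn.
have := N2_ge0 g; rewrite le_eqVlt => /orP[/eqP g0|g0].
  move: H; rewrite -g0 => H; rewrite expr0n/= mulr0.
  have [->|b0] := eqVneq b 0; first by rewrite expr0n.
  have := H (- (N2 f ^+ 2 + 1) / (2 * b)).
  rewrite expr0n/= mulr0 addr0.
  rewrite (_ : 2 * _ * b = - (N2 f ^+ 2 + 1)); first by lra.
  by field.
have := H (- b / N2 g ^+ 2).
rewrite (_ : _ + _ = N2 f ^+ 2 - b ^+ 2 / N2 g ^+ 2); last first.
  by field; rewrite gt_eqF.
by rewrite subr_ge0 ler_pdivrMr// exprn_gt0.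
Qed.

Lemma N2D f g : L2 f -> L2 g -> N2 (fun x => f x + g x) <= N2 f + N2 g.
Proof.
move=> Lf Lg; rewrite -(@ler_pXn2r _ 2) ?nnegrE ?addr_ge0 ?N2_ge0//.
have := int_sqrD 1 Lf Lg; under eq_Rintegral do rewrite mul1r.
rewrite (N2_sqr (fun x => f x + g x)) => ->; have := cauchy_schwarz Lf Lg.
by move=> /(le_trans (ler_norm _)); nra.
Qed.

Lemma N2N f : N2 (fun x => - f x) = N2 f.
Proof. by rewrite /N2; under eq_Rintegral do rewrite sqrrN. Qed.

Lemma N2_norm f : N2 (fun x => `|f x|) = N2 f.
Proof.
by rewrite /N2; under eq_Rintegral do rewrite real_normK ?num_real//.
Qed.

Lemma N2_sub_sym f g : N2 (fun x => f x - g x) = N2 (fun x => g x - f x).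
Proof. by rewrite -N2N; apply: N2_ext => x; rewrite opprB. Qed.

Lemma N2_triangle f g h : L2 f -> L2 g -> L2 h ->
  N2 (fun x => f x - h x) <= N2 (fun x => f x - g x) + N2 (fun x => g x - h x).
Proof.
move=> Lf Lg Lh; rewrite (@N2_ext _ (fun x => (f x - g x) + (g x - h x))).
  by apply: N2D; exact: L2B.
by move=> x; ring.
Qed.

Lemma N2_dist f g : L2 f -> L2 g -> N2 f <= N2 g + N2 (fun x => f x - g x).
Proof.
move=> Lf Lg; rewrite (@N2_ext f (fun x => g x + (f x - g x))).
  by apply: N2D => //; exact: L2B.
by move=> x; ring.
Qed.

Lemma int_sqr_eq0 f : L2 f -> N2 f = 0 -> f = cst 0 %[ae mu].
Proof.
move=> [mf fi] f0; have := N2_sqr f; rewrite f0 expr0n/= => /esym I0.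
have : (fun x => f x ^+ 2) = cst 0 %[ae mu].
  apply: int_eq0_ae => //; last by rewrite I0.
  by apply: aeW => x; exact: sqr_ge0.
by apply: filterS => x /= /[apply] /eqP; rewrite sqrf_eq0 => /eqP.
Qed.

Lemma N2_parallelogram f g : L2 f -> L2 g ->
  N2 (fun x => f x - g x) ^+ 2 = 2 * N2 f ^+ 2 + 2 * N2 g ^+ 2
    - 4 * N2 (fun x => (f x + g x) / 2) ^+ 2.
Proof.
move=> Lf Lg; have := int_sqrD (-1) Lf Lg; have := int_sqrD 1 Lf Lg.
rewrite (@N2_ext (fun x => (f x + g x) / 2) (fun x => 2^-1 * (f x + g x))).
  rewrite N2Z; last exact: L2D.
  rewrite exprMn (N2_sqr (fun x => f x + g x)) (N2_sqr (fun x => f x - g x)).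
  under eq_Rintegral do rewrite mul1r.
  move=> ->; under eq_Rintegral do rewrite mulN1r.
  move=> ->; rewrite ger0_norm//; lra.
by move=> x; rewrite mulrC.
Qed.

(** Lower semicontinuity of integrals: this is how bounds on the integrals
    along a sequence, and integrability itself, reach an almost everywhere limit. *)
Lemma fatou_le (f : nat -> T -> R) g B : (forall n, intble (f n)) ->
  measurable_fun setT g -> (forall n x, 0 <= f n x) ->
  {ae mu, forall x, f ^~ x @ \oo --> g x} ->
  (forall n, \int[mu]_x f n x <= B) ->
  intble g /\ \int[mu]_x g x <= B.
Proof.
move=> fi mg f0 fg fB.
have mf n : measurable_fun setT (EFin \o f n) by case/integrableP: (fi n).
have mgE : measurable_fun setT (EFin \o g) by exact/measurable_EFinP.
have lim_ae : {ae mu, forall x, limn_einf (fun n => (f n x)%:E) = (g x)%:E}.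
  apply: filterS fg => x fgx; by have/cvg_limn_einf_sup [] := cvg_EFin_seq fgx.
have g0 : {ae mu, forall x, 0 <= g x}.
  apply: filterS fg => x fgx; rewrite -(cvg_lim (@Rhausdorff R) fgx).
  by apply: limr_ge; [exact: cvgP fgx|apply: nearW => n; rewrite f0].
have B_ge : (\int[mu]_x `|(g x)%:E| <= B%:E)%E.
  have -> : (\int[mu]_x `|(g x)%:E| = \int[mu]_x limn_einf (fun n => (f n x)%:E))%E.
    apply: ae_eq_integral => //.
    - by apply/measurable_EFinP/measurableT_comp.
    - apply: measurableT_comp => //; apply: measurable_fun_limn_esup => n.
      exact: measurableT_comp (mf n).
    - apply: filterS2 lim_ae g0 => x /= -> gx _.
      by rewrite ger0_norm.
  apply: (le_trans (fatou _ _ _ _)) => //.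
    by move=> n x _; rewrite lee_fin.
  rewrite limn_einf_lim; apply: lime_le; first exact: is_cvg_einfs.
  apply: nearW => n; apply: (@le_trans _ _ (\int[mu]_x (f n x)%:E)%E).
    by apply: ereal_inf_lbound; exists n => /=.
  by rewrite -int_EFin// lee_fin.
have gi : intble g.
  by apply/integrableP; split=> //; exact: le_lt_trans B_ge (ltry _).
split=> //; rewrite -lee_fin int_EFin//; apply: le_trans B_ge.
apply: le_integral => //; first exact: integrable_abse.
by move=> x _; rewrite lee_fin/= ler_norm.
Qed.

Lemma dominated_le (f : nat -> T -> R) g h :
  (forall n, measurable_fun setT (f n)) -> measurable_fun setT g ->
  intble h -> (forall n x, `|f n x| <= h x) ->
  {ae mu, forall x, f ^~ x @ \oo --> g x} ->
  intble g /\ (fun n => \int[mu]_x f n x) @ \oo --> \int[mu]_x g x.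
Proof.
move=> mf mg hi fh fg.
have [] := @dominated_convergence _ _ _ mu setT measurableT
  (fun n => EFin \o f n) (EFin \o g) (EFin \o h).
- by move=> n; exact/measurable_EFinP.
- exact/measurable_EFinP.
- by apply: filterS fg => x fgx _; exact: cvg_EFin_seq fgx.
- exact: hi.
- by apply: aeW => x n _ /=; rewrite lee_fin.
move=> gi _ cv; split=> //; apply: fine_cvg; rewrite fineK //.
exact: integrable_fin_num.
Qed.

End SquareIntegrable.

(** * Almost everywhere convergence and completeness of L^2 *)

Section AlmostEverywhere.
Context d (T : measurableType d) (R : realType).
Variable mu : {measure set T -> \bar R}.

Lemma ae_imply (P Q : T -> Prop) : {ae mu, forall x, P x} ->
  (forall x, P x -> Q x) -> {ae mu, forall x, Q x}.
Proof. by move=> aP PQ; apply: filterS aP. Qed.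

Lemma ae_imply2 (P Q S : T -> Prop) : {ae mu, forall x, P x} ->
  {ae mu, forall x, Q x} -> (forall x, P x -> Q x -> S x) ->
  {ae mu, forall x, S x}.
Proof. by move=> aP aQ PQS; apply: filterS2 aP aQ. Qed.

End AlmostEverywhere.

Section Completeness.
Context d (T : measurableType d) (R : realType).
Variable mu : {measure set T -> \bar R}.
Implicit Types (f g h : T -> R).

(** By monotone convergence the sum of the h n has a finite integral, hence is
    finite almost everywhere. *)
Lemma summable_ae (h : nat -> T -> R) (C : R) :
  (forall n, intble mu (h n)) -> (forall n x, 0 <= h n x) ->
  (forall n, \int[mu]_x h n x <= C * 2^-1 ^+ n) ->
  {ae mu, forall x, cvgn (series (fun n => h n x))}.
Proof.
move=> hi h0 hC.
have C0 : 0 <= C.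
  by have := hC 0%N; rewrite expr0 mulr1; apply: le_trans; exact: int_ge0.
pose S x := (\sum_(n <oo) (h n x)%:E)%E.
have mh n : measurable_fun setT (EFin \o h n) by case/integrableP: (hi n).
have S0 x : (0 <= S x)%E by apply: nneseries_ge0 => n _ _; rewrite lee_fin.
have mS : measurable_fun setT S.
  by apply: ge0_emeasurable_sum => [n x _ _|n _]; [rewrite lee_fin|exact: mh].
have IS : (\int[mu]_x S x <= (C * 2)%:E)%E.
  rewrite integral_nneseries//; last by move=> n x _; rewrite lee_fin.
  apply: lime_le.
    apply: is_cvg_nneseries => n _ _; apply: integral_ge0 => x _.
    by rewrite lee_fin.
  apply: nearW => n.
  under eq_bigr do rewrite -int_EFin//.
  rewrite sumEFin lee_fin.
  apply: (@le_trans _ _ (series (geometric C 2^-1) n)).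
    by rewrite /series/=; apply: ler_sum => i _.
  have -> : C * 2 = C * (1 - 2^-1)^-1 by congr (_ * _); rewrite (_ : 1 - 2^-1 = 2^-1 :> R) ?invrK//; lra.
  by apply: geometric_le_lim => //; rewrite ger0_norm//; lra.
have Si : mu.-integrable setT S.
  apply/integrableP; split=> //.
  under eq_integral do rewrite gee0_abs//.
  exact: le_lt_trans IS (ltry _).
have := integrable_ae measurableT Si.
apply: filterS => x /(_ Logic.I) Sx.
apply: nondecreasing_is_cvgn.
  apply/nondecreasing_seqP => n; rewrite /series/= big_nat_recr//=.
  by rewrite lerDl.
exists (fine (S x)) => _ [n _ <-]; rewrite -lee_fin fineK//.
by rewrite /series/= -sumEFin; apply: nneseries_lim_ge => k _ _; rewrite lee_fin.
Qed.

(** At the rate 2^-n the squared errors form a summable series, so that the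
    whole sequence converges almost everywhere. *)
Lemma N2_fast_ae (f : nat -> T -> R) g : (forall n, L2 mu (f n)) -> L2 mu g ->
  (forall n, N2 mu (fun x => f n x - g x) <= 2^-1 ^+ n) ->
  {ae mu, forall x, f ^~ x @ \oo --> g x}.
Proof.
move=> Lf Lg fg; have Ld n := L2B (Lf n) Lg.
have H n : \int[mu]_x ((f n x - g x) ^+ 2) <= 1 * 2^-1 ^+ n.
  rewrite -N2_sqr mul1r; apply: (@le_trans _ _ ((2^-1 ^+ n) ^+ 2)).
    by rewrite lerXn2r ?nnegrE ?N2_ge0 ?exprn_ge0.
  rewrite expr2 ler_piMl ?exprn_ge0// exprn_ile1//; lra.
have := summable_ae (fun n => (Ld n).2) (fun n x => sqr_ge0 _) H.
apply: filterS => x /cvg_series_cvg_0 c0.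
apply/cvgrPdist_lt => e e0.
have /cvgrPdist_lt /(_ (e ^+ 2)) := c0.
rewrite exprn_gt0// => /(_ isT); apply: filterS => n /=.
rewrite sub0r normrN normrX ltr_pXn2r ?nnegrE ?normr_ge0 ?ltW//.
by rewrite distrC.
Qed.

Hypothesis mufin : (mu setT < +oo)%E.

Lemma finite_cst (c : R) : intble mu (cst c).
Proof.
apply/integrableP; split; first exact/measurable_EFinP.
have -> : (\int[mu]_x `|(EFin \o cst c) x| = \int[mu]_x (cst `|c|%:E x))%E by [].
by rewrite integral_cst// lte_mul_pinfty.
Qed.

Lemma L2_cst (c : R) : L2 mu (cst c).
Proof.
split; first exact: measurable_cst.
exact: (finite_cst (c ^+ 2)).
Qed.

Lemma L2_intble f : L2 mu f -> intble mu f.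
Proof.
move=> Lf; apply: intble_ext (L2M Lf (L2_cst 1)) => x.
by rewrite /= mulr1.
Qed.

Lemma int_norm_le f : L2 mu f -> \int[mu]_x `|f x| <= N2 mu f * N2 mu (cst 1).
Proof.
move=> Lf; have := cauchy_schwarz (L2_norm Lf) (L2_cst 1).
under eq_Rintegral do rewrite /= mulr1.
rewrite ger0_norm; last by apply: int_ge0.
by rewrite N2_norm.
Qed.

(** Riesz--Fischer: along a subsequence whose increments are bounded by 2^-k the
    functions converge almost everywhere, and Fatou bounds the distance to the
    limit by the Cauchy modulus. *)
Lemma L2_complete (f : nat -> T -> R) : (forall n, L2 mu (f n)) ->
  (forall e : R, 0 < e -> exists n0, forall n m, (n0 <= n)%N -> (n0 <= m)%N ->
     N2 mu (fun x => f n x - f m x) <= e) ->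
  exists2 g, L2 mu g & forall e : R, 0 < e -> exists n0, forall n, (n0 <= n)%N ->
     N2 mu (fun x => f n x - g x) <= e.
Proof.
move=> Lf Cf.
have half_gt0 k : 0 < (2^-1 : R) ^+ k by rewrite exprn_gt0.
have [phi Hphi] := choice (fun k => Cf _ (half_gt0 k)).
pose s k := (\sum_(j < k.+1) (phi j).+1)%N.
have phis k : (phi k <= s k)%N.
  by rewrite /s big_ord_recr/= (leq_trans (leqnSn _))// leq_addl.
have sk k : (k <= s k)%N.
  elim: k => // k IH; rewrite /s big_ord_recr/= -/(s k) -addn1.
  by rewrite leq_add.
have sS k : (s k <= s k.+1)%N by rewrite [leqRHS]big_ord_recr/= leq_addr.
have Ls k := Lf (s k).
have shom j k : (j <= k)%N -> (s j <= s k)%N.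
  by move: j k; exact: (homo_leq leqnn leq_trans sS).
have Ld k := L2B (Ls k.+1) (Ls k).
have mf k : measurable_fun setT (f k) by case: (Lf k).
have ae : {ae mu, forall x, cvgn (fun k => f (s k) x)}.
  have H n : \int[mu]_x `|f (s n.+1) x - f (s n) x| <=
      N2 mu (cst 1) * 2^-1 ^+ n.
    apply: (le_trans (int_norm_le (Ld n))).
    rewrite mulrC ler_wpM2l ?N2_ge0//; apply: Hphi => //.
    exact: leq_trans (sS n).
  have := summable_ae (fun n => intble_norm (L2_intble (Ld n)))
    (fun n x => normr_ge0 _) H.
  apply: filterS => x /normed_cvg cx.
  have -> : (fun k => f (s k) x) =
     (fun k => f (s 0%N) x + series (telescope (fun k => f (s k) x)) k).
    by apply/funext => k; rewrite -eq_sum_telescope.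
  by apply: is_cvgD => //; exact: is_cvg_cst.
pose g x := fine (limn_esup (fun k => (f (s k) x)%:E)).
have mg : measurable_fun setT g.
  apply: measurableT_comp => //; apply: measurable_fun_limn_esup => n.
  exact/measurable_EFinP.
have fg : {ae mu, forall x, (fun k => f (s k) x) @ \oo --> g x}.
  apply: filterS ae => x cx; rewrite /g.
  by have/cvg_limn_einf_sup [_ ->] := cvg_EFin_seq cx.
have F e : 0 < e -> exists n0, forall n, (n0 <= n)%N ->
    L2 mu (fun x => f n x - g x) /\ N2 mu (fun x => f n x - g x) <= e.
  move=> e0; have [n0 Hn0] := Cf e e0; exists n0 => n n0n.
  have mfg : measurable_fun setT (fun x => f n x - g x) by exact: measurable_funB.
  have [|||||fi fle] := @fatou_le _ _ _ mu
    (fun k x => (f n x - f (s (k + n0)%N) x) ^+ 2)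
    (fun x => (f n x - g x) ^+ 2) (e ^+ 2).
  - by move=> k; case: (L2B (Lf n) (Lf (s (k + n0)%N))).
  - exact: measurable_funX.
  - by move=> k x; exact: sqr_ge0.
  - apply: filterS fg => x fgx.
    rewrite [X in X @ _ --> _](_ : _ =
      (fun y => y ^+ 2) \o (fun k => f n x - f (s (k + n0)%N) x)) //.
    apply: continuous_cvg; first exact: exprn_continuous.
    apply: cvgB; first exact: cvg_cst.
    by rewrite (cvg_shiftn n0 (fun k => f (s k) x)).
  - move=> k; rewrite -N2_sqr lerXn2r ?nnegrE ?N2_ge0 ?(ltW e0)//.
    by apply: Hn0 => //; apply: leq_trans (sk _); exact: leq_addl.
  split; first by split.
  by rewrite -(@ler_pXn2r _ 2) ?nnegrE ?N2_ge0 ?(ltW e0)// N2_sqr.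
have Lg : L2 mu g.
  have [n0 /(_ n0 (leqnn _)) [Lfg _]] := F 1 ltr01.
  have := L2B (Lf n0) Lfg; congr (L2 _ _); apply/funext => x.
  by rewrite subKr.
exists g => // e e0; have [n0 Hn0] := F e e0.
by exists n0 => n /Hn0 [].
Qed.
End Completeness.

(** * Smooth functions of two variables *)

Section Smooth.
Context (R : realType).
Implicit Types (f g G : R * R -> R) (z v : R * R) (F : R -> R).

(** Brings directional derivatives in the plane back to functions of one
    variable, for which the chain rule is available. *)
Lemma is_derive_slice f z v df :
  is_derive z v f df <-> is_derive (0 : R) 1 (fun h : R => f (h *: v + z)) df.
Proof.
have E : derive (fun h : R => f (h *: v + z)) 0 1 = derive f z v.
  rewrite /derive; under eq_fun => h.
    rewrite /= scale0r add0r addr0 [h *: 1]mulr1; over.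
  by [].
split=> -[d1 d2]; split.
- exact: (derivable1P _ _ _).1.
- by rewrite E.
- exact: (derivable1P _ _ _).2.
- by rewrite -E.
Qed.

Lemma is_derive_chain F f z v df dF :
  is_derive (f z) 1 F dF -> is_derive z v f df ->
  is_derive z v (fun w => F (f w)) (dF * df).
Proof.
move=> HF /is_derive_slice Hf; apply/is_derive_slice.
apply: (@is_derive1_comp _ F (fun h : R => f (h *: v + z))).
by rewrite scale0r add0r.
Qed.

Lemma is_derive_add f g z v df dg : is_derive z v f df -> is_derive z v g dg ->
  is_derive z v (fun w => f w + g w) (df + dg).
Proof. by move=> Hf Hg; exact: (is_deriveD Hf Hg). Qed.

Lemma is_derive_mul f g z v df dg : is_derive z v f df -> is_derive z v g dg ->
  is_derive z v (fun w => f w * g w) (df * g z + f z * dg).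
Proof.
move=> Hf Hg; rewrite (_ : _ + _ = f z *: dg + g z *: df).
  exact: (is_deriveM Hf Hg).
by rewrite addrC [g z *: _]mulrC.
Qed.

Definition smooth f := forall n, Cn n f.

(** Iterated partial derivatives never leave a class that is stable under both
    partial derivatives. *)
Lemma smooth_coind (P : (R * R -> R) -> Prop) :
  (forall f, P f -> continuous f) ->
  (forall f, P f -> exists fx fy, [/\ P fx, P fy,
     forall z, is_derive z (ex R) f (fx z) &
     forall z, is_derive z (ey R) f (fy z)]) ->
  forall f, P f -> smooth f.
Proof.
move=> Pc Pd f Pf n; elim: n f Pf => [|n IH] f Pf; first exact: Pc.
have [fx [fy [Px Py Dx Dy]]] := Pd _ Pf.
split; [by move=> z; case: (Dx z)|by move=> z; case: (Dy z)| |].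
- rewrite (_ : 'D_(ex R) f = fx); first exact: IH.
  by apply/funext => z; case: (Dx z).
- rewrite (_ : 'D_(ey R) f = fy); first exact: IH.
  by apply/funext => z; case: (Dy z).
Qed.

Lemma smooth_continuous f : smooth f -> continuous f.
Proof. by move=> /(_ 0%N). Qed.

Lemma smooth_Dx f : smooth f -> smooth ('D_(ex R) f).
Proof. by move=> sf n; case: (sf n.+1). Qed.

Lemma smooth_Dy f : smooth f -> smooth ('D_(ey R) f).
Proof. by move=> sf n; case: (sf n.+1). Qed.

Lemma smooth_is_dx f z : smooth f -> is_derive z (ex R) f ('D_(ex R) f z).
Proof. by move=> /(_ 1%N) [dx _ _ _]; exact/derivableP. Qed.

Lemma smooth_is_dy f z : smooth f -> is_derive z (ey R) f ('D_(ey R) f z).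
Proof. by move=> /(_ 1%N) [_ dy _ _]; exact/derivableP. Qed.

Lemma smooth_cst (c : R) : smooth (cst c).
Proof.
apply: (@smooth_coind (fun f => exists c, f = cst c)); last by exists c.
  by move=> _ [a ->]; exact: cst_continuous.
move=> _ [a ->]; exists (cst 0), (cst 0); split; try by exists 0.
- by move=> z; exact: is_derive_cst.
- by move=> z; exact: is_derive_cst.
Qed.

(** The powers of 1/x in front of exp (- 1/x) make the family stable under
    differentiation, up to linear combinations, as smooth_coind requires. *)
Definition flat (k : nat) (x : R) : R :=
  if 0 < x then x^-1 ^+ k * expR (- x^-1) else 0.

Lemma flat_ge0 k x : 0 <= flat k x.
Proof.
rewrite /flat; case: ifPn => // x0.
by rewrite mulr_ge0 ?expR_ge0// exprn_ge0// invr_ge0 ltW.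
Qed.

(** From (y / m)^m <= exp y at y = 1/x; second order vanishing at 0 gives the
    derivative there. *)
Lemma flat_le k x : `|flat k x| <= k.+2%:R ^+ k.+2 * x ^+ 2.
Proof.
rewrite ger0_norm ?flat_ge0// /flat; case: ifPn => [x0|_]; last first.
  by rewrite mulr_ge0 ?sqr_ge0// exprn_ge0.
set m := k.+2.
have m0 : (0 : R) < m%:R by rewrite ltr0n.
have y0 : 0 < x^-1 / m%:R by rewrite divr_gt0// invr_gt0.
have H : (x^-1 / m%:R) ^+ m <= expR (x^-1).
  rewrite [X in expR X](_ : _ = m%:R * (x^-1 / m%:R)); last first.
    by rewrite mulrC divfK// gt_eqF.
  rewrite expRM_natl.
  rewrite lerXn2r ?nnegrE ?expR_ge0 ?ltW//.
  apply: lt_le_trans (expR_ge1Dx _); lra.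
rewrite expRN.
have H2 : (expR x^-1)^-1 <= ((x^-1 / m%:R) ^+ m)^-1.
  by rewrite lef_pV2// posrE ?expR_gt0 ?exprn_gt0.
have xk : 0 <= x^-1 ^+ k by rewrite exprn_ge0// invr_ge0 ltW.
apply: (le_trans (ler_wpM2l xk H2)).
have xk1 : x^-1 ^+ k * x ^+ k = 1 by rewrite -exprMn mulVf ?gt_eqF// expr1n.
rewrite -exprVn invf_div invrK exprMn (_ : x ^+ m = x ^+ k * x ^+ 2).
  rewrite [leLHS](_ : _ = m%:R ^+ m * x ^+ 2 * (x^-1 ^+ k * x ^+ k)).
    by rewrite xk1 mulr1.
  by move: (x^-1 ^+ k) (x ^+ k) (m%:R ^+ m) (x ^+ 2) => A B C D; ring.
by rewrite -exprD addn2.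
Qed.

Lemma is_derive_flat (k : nat) (x : R) :
  is_derive x 1 (flat k) (flat k.+2 x - k%:R * flat k.+1 x).
Proof.
have [x0|x0|<-] := ltgtP 0 x.
- have E : \near x, x^-1 ^+ k * expR (- x^-1) = flat k x.
    by near=> y; rewrite /flat ifT//; near: y; exact: lt_nbhsr.
  apply: near_eq_is_derive E _.
  have dV : is_derive x 1 (fun y : R => y^-1) (- x ^- 2).
    have x0' : (id x : R) != 0 by rewrite /= gt_eqF//; exact: x0.
    by have := is_deriveV x0' (is_derive_id x 1); rewrite [_ *: 1]mulr1.
  have dN : is_derive x 1 (fun y : R => - y^-1) (x ^- 2).
    by rewrite -[X in is_derive _ _ _ X]opprK; exact: is_deriveN dV.
  have dE : is_derive x 1 (fun y : R => expR (- y^-1)) (expR (- x^-1) * x ^- 2).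
    exact: (@is_derive1_comp _ expR _ x _ _ (is_derive_expR _) dN).
  have dX : is_derive x 1 (fun y : R => y^-1 ^+ k) (k%:R * x^-1 ^+ k.-1 * - x ^- 2).
    by have := is_deriveX k dV; rewrite exprfctE.
  rewrite (_ : _ - _ = x^-1 ^+ k *: (expR (- x^-1) * x ^- 2) +
    expR (- x^-1) *: (k%:R * x^-1 ^+ k.-1 * - x ^- 2)).
    exact: (is_deriveM dX dE).
  rewrite /flat !ifT//.
  rewrite ![_ *: _]mulrC -!exprVn !exprS.
  case: k {dX} => [|k]; first by rewrite expr0; ring.
  by rewrite /= exprS; ring.
- have E : \near x, 0 = flat k x.
    near=> y; rewrite /flat ifF//; apply/negbTE; rewrite -leNgt ltW//.
    by near: y; exact: lt_nbhsl.
  apply: near_eq_is_derive E _.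
  rewrite /flat !ifF ?mulr0 ?subr0; [exact: is_derive_cst| |];
    by apply/negbTE; rewrite -leNgt ltW.
- rewrite {2 3}/flat !ltxx mulr0 subr0.
  have cv : (fun h : R => h^-1 *: ((flat k \o shift 0) (h *: 1) - flat k 0))
      @ 0^' --> (0 : R).
    pose K : R := k.+2%:R ^+ k.+2.
    have K0 : 0 <= K by rewrite exprn_ge0.
    apply/cvgrPdist_lt => e e0; near=> h.
    have h0 : h != 0 by near: h; exact: nbhs_dnbhs_neq.
    rewrite /= {2}/flat ltxx subr0 addr0 [h *: 1]mulr1 [_ *: _]mulrC sub0r normrN.
    rewrite normrM normfV ltr_pdivrMr ?normr_gt0//.
    apply: le_lt_trans (flat_le k h) _; rewrite -/K.
    rewrite -(real_normK (num_real h)) expr2 mulrA ltr_pM2r ?normr_gt0//.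
    apply: (@le_lt_trans _ _ ((K + 1) * `|h|)); first by rewrite ler_wpM2r// lerDl.
    rewrite -ltr_pdivlMl ?ltr_wpDl// mulrC.
    near: h; apply: dnbhs0_lt; rewrite divr_gt0// ltr_wpDl//.
  split; first by apply/cvg_ex; exists 0.
  exact: (cvg_lim (@Rhausdorff R) cv).
Unshelve. all: by end_near. Qed.
End Smooth.

(** * Smooth expressions, test functions and bumps *)

Section SmoothAlgebra.
Context (R : realType).
Implicit Types (f g G : R * R -> R) (z v : R * R).

(** One coinduction for all the operations at once: the partial derivatives of
    such an expression are again of this form. Square roots and inverses are
    the real powers 1/2 and -1. *)
Inductive smooth_expr : (R * R -> R) -> Prop :=
| se_base f : smooth f -> smooth_expr f
| se_add f g : smooth_expr f -> smooth_expr g -> smooth_expr (fun z => f z + g z)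
| se_mul f g : smooth_expr f -> smooth_expr g -> smooth_expr (fun z => f z * g z)
| se_pow G s : smooth G -> (forall z, 0 < G z) -> smooth_expr (fun z => G z `^ s)
| se_flat1 k c d : smooth_expr (fun z => flat k (c * z.1 + d))
| se_flat2 k c d : smooth_expr (fun z => flat k (c * z.2 + d)).

Lemma is_derive_affine1 c d z v :
  is_derive z v (fun w : R * R => c * w.1 + d) (c * v.1).
Proof.
apply/is_derive_slice => /=.
have : is_derive (0 : R) 1 (fun h : R => c * (h * v.1 + z.1) + d) (c * v.1).
  have -> : (fun h : R => c * (h * v.1 + z.1) + d) =
     (fun h : R => (c * v.1) * h + (c * z.1 + d)) by apply/funext => h; ring.
  have := is_deriveD (is_deriveZ (c * v.1) (is_derive_id (0 : R) 1))
    (is_derive_cst (c * z.1 + d) (0 : R) (1 : R)).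
  by rewrite addr0 [_ *: 1]mulr1.
by [].
Qed.

Lemma is_derive_affine2 c d z v :
  is_derive z v (fun w : R * R => c * w.2 + d) (c * v.2).
Proof.
apply/is_derive_slice => /=.
have : is_derive (0 : R) 1 (fun h : R => c * (h * v.2 + z.2) + d) (c * v.2).
  have -> : (fun h : R => c * (h * v.2 + z.2) + d) =
     (fun h : R => (c * v.2) * h + (c * z.2 + d)) by apply/funext => h; ring.
  have := is_deriveD (is_deriveZ (c * v.2) (is_derive_id (0 : R) 1))
    (is_derive_cst (c * z.2 + d) (0 : R) (1 : R)).
  by rewrite addr0 [_ *: 1]mulr1.
by [].
Qed.

Lemma is_derive_continuous1 (F : R -> R) (x dF : R) :
  is_derive x 1 F dF -> {for x, continuous F}.
Proof. by case=> dx _; apply/differentiable_continuous/derivable1_diffP. Qed.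

Lemma flat_continuous k : continuous (@flat R k).
Proof. by move=> x; exact: is_derive_continuous1 (is_derive_flat k x). Qed.

Lemma smooth_expr_smooth f : smooth_expr f -> smooth f.
Proof.
apply: smooth_coind => {}f.
  elim=> {f} [f sf|f g _ cf _ cg|f g _ cf _ cg|G s sG G0|k c d|k c d].
  - exact: smooth_continuous.
  - by move=> z; apply: cvgD; [exact: cf|exact: cg].
  - by move=> z; apply: cvgM; [exact: cf|exact: cg].
  - move=> z; apply: (@continuous_comp _ _ _ G (fun y => y `^ s)).
      exact: smooth_continuous.
    exact: is_derive_continuous1 (is_derive1_powR s (G0 z)).
  - move=> z; apply: (@continuous_comp _ _ _ (fun w => c * w.1 + d) (flat k)).
      apply: cvgD; last exact: cvg_cst.
      by apply: cvgM; [exact: cvg_cst|exact: cvg_fst].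
    exact: flat_continuous.
  - move=> z; apply: (@continuous_comp _ _ _ (fun w => c * w.2 + d) (flat k)).
      apply: cvgD; last exact: cvg_cst.
      by apply: cvgM; [exact: cvg_cst|exact: cvg_snd].
    exact: flat_continuous.
have sc (a : R) : smooth_expr (cst a) by apply: se_base; exact: smooth_cst.
elim=> {f} [f sf|f g ef [fx [fy [Px Py dx dy]]] eg [gx [gy [Qx Qy ex ey]]]
  |f g ef [fx [fy [Px Py dx dy]]] eg [gx [gy [Qx Qy ex ey]]]|G s sG G0|k c d|k c d].
- exists ('D_(ex R) f), ('D_(ey R) f); split.
  + by apply: se_base; exact: smooth_Dx.
  + by apply: se_base; exact: smooth_Dy.
  + by move=> z; exact: smooth_is_dx.
  + by move=> z; exact: smooth_is_dy.
- exists (fun z => fx z + gx z), (fun z => fy z + gy z); split.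
  + exact: se_add.
  + exact: se_add.
  + by move=> z; exact: is_derive_add.
  + by move=> z; exact: is_derive_add.
- exists (fun z => fx z * g z + f z * gx z), (fun z => fy z * g z + f z * gy z); split.
  + by apply: se_add; exact: se_mul.
  + by apply: se_add; exact: se_mul.
  + by move=> z; exact: is_derive_mul.
  + by move=> z; exact: is_derive_mul.
- exists (fun z => s * G z `^ (s - 1) * 'D_(ex R) G z),
    (fun z => s * G z `^ (s - 1) * 'D_(ey R) G z); split.
  + apply: se_mul; last by apply: se_base; exact: smooth_Dx.
    by apply: se_mul; [exact: sc|exact: se_pow].
  + apply: se_mul; last by apply: se_base; exact: smooth_Dy.
    by apply: se_mul; [exact: sc|exact: se_pow].
  + move=> z; apply: (@is_derive_chain _ (fun y => y `^ s)).
      exact: is_derive1_powR.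
    exact: smooth_is_dx.
  + move=> z; apply: (@is_derive_chain _ (fun y => y `^ s)).
      exact: is_derive1_powR.
    exact: smooth_is_dy.
- pose h (z : R * R) := flat k.+2 (c * z.1 + d) + (- k%:R) * flat k.+1 (c * z.1 + d).
  have eh : smooth_expr h.
    apply: se_add; first exact: se_flat1.
    by apply: se_mul; [exact: sc|exact: se_flat1].
  have hE (z : R * R) : h z = flat k.+2 (c * z.1 + d) - k%:R * flat k.+1 (c * z.1 + d).
    by rewrite /h mulNr.
  exists (fun z => h z * (c * (ex R).1)), (fun z => h z * (c * (ey R).1)); split.
  + by apply: se_mul => //; exact: sc.
  + by apply: se_mul => //; exact: sc.
  + move=> z; rewrite hE; apply: (@is_derive_chain _ (flat k)).
      exact: is_derive_flat.
    exact: is_derive_affine1.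
  + move=> z; rewrite hE; apply: (@is_derive_chain _ (flat k)).
      exact: is_derive_flat.
    exact: is_derive_affine1.
- pose h (z : R * R) := flat k.+2 (c * z.2 + d) + (- k%:R) * flat k.+1 (c * z.2 + d).
  have eh : smooth_expr h.
    apply: se_add; first exact: se_flat2.
    by apply: se_mul; [exact: sc|exact: se_flat2].
  have hE (z : R * R) : h z = flat k.+2 (c * z.2 + d) - k%:R * flat k.+1 (c * z.2 + d).
    by rewrite /h mulNr.
  exists (fun z => h z * (c * (ex R).2)), (fun z => h z * (c * (ey R).2)); split.
  + by apply: se_mul => //; exact: sc.
  + by apply: se_mul => //; exact: sc.
  + move=> z; rewrite hE; apply: (@is_derive_chain _ (flat k)).
      exact: is_derive_flat.
    exact: is_derive_affine2.
  + move=> z; rewrite hE; apply: (@is_derive_chain _ (flat k)).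
      exact: is_derive_flat.
    exact: is_derive_affine2.
Qed.

Lemma smoothD f g : smooth f -> smooth g -> smooth (fun z => f z + g z).
Proof. by move=> sf sg; apply/smooth_expr_smooth/se_add; exact: se_base. Qed.

Lemma smoothM f g : smooth f -> smooth g -> smooth (fun z => f z * g z).
Proof. by move=> sf sg; apply/smooth_expr_smooth/se_mul; exact: se_base. Qed.

Lemma smoothZ c f : smooth f -> smooth (fun z => c * f z).
Proof. by move=> sf; apply: smoothM => //; exact: smooth_cst. Qed.

Lemma smoothB f g : smooth f -> smooth g -> smooth (fun z => f z - g z).
Proof.
move=> sf sg; have := smoothD sf (smoothZ (-1) sg).
by congr smooth; apply/funext => z; rewrite mulN1r.
Qed.

Lemma smooth_sqr f : smooth f -> smooth (fun z => f z ^+ 2).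
Proof. by move=> sf; exact: smoothM. Qed.

Lemma smooth_pow G s : smooth G -> (forall z, 0 < G z) ->
  smooth (fun z => G z `^ s).
Proof. by move=> sG G0; apply/smooth_expr_smooth/se_pow. Qed.

Lemma smooth_sqrt G : smooth G -> (forall z, 0 < G z) ->
  smooth (fun z => Num.sqrt (G z)).
Proof.
move=> sG G0; have := smooth_pow 2^-1 sG G0.
by congr smooth; apply/funext => z; rewrite powR12_sqrt// ltW.
Qed.

Lemma smooth_inv G : smooth G -> (forall z, 0 < G z) ->
  smooth (fun z => (G z)^-1).
Proof.
move=> sG G0; have := smooth_pow (-1) sG G0.
by congr smooth; apply/funext => z; rewrite powR_inv1// ltW.
Qed.

Local Notation clsupp f := (closure [set z | f z != 0]).

Lemma test_smooth f : test_function f -> smooth f.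
Proof. by case. Qed.

Lemma test_intro f (K : set (R * R)) : smooth f -> compact K -> K `<=` Omega R ->
  (forall z, ~ K z -> f z = 0) -> test_function f.
Proof.
move=> sf cK KO fK.
have sK : clsupp f `<=` K.
  have clK : closed K by apply: compact_closed => //; exact: norm_hausdorff.
  rewrite [X in _ `<=` X]((closure_id K).1 clK); apply: closureS => z /= /eqP fz.
  by apply: contrapT => /fK.
split=> //; last exact: subset_trans KO.
exact: subclosed_compact (@closed_closure _ _) cK sK.
Qed.

Lemma test_supp f z : test_function f -> ~ clsupp f z -> f z = 0.
Proof.
move=> _ Nz; apply: contrapT => /eqP fz; apply: Nz.
exact: subset_closure.
Qed.

Lemma test_out f z : test_function f -> ~ Omega R z -> f z = 0.
Proof. by move=> tf Nz; apply: test_supp => // /(let: And3 _ _ H := tf in H). Qed.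

(** The support of f lies in the union of those of g and h. *)
Lemma test_dominated f g h : test_function g -> test_function h -> smooth f ->
  (forall z, g z = 0 -> h z = 0 -> f z = 0) -> test_function f.
Proof.
move=> tg th sf fgh; apply: (@test_intro f (clsupp g `|` clsupp h)) => //.
- by apply: compactU; [case: tg|case: th].
- by move=> z [] /=; [case: tg => _ _|case: th => _ _]; apply.
- move=> z /= /not_orP [Ng Nh]; apply: fgh; exact: test_supp.
Qed.

Lemma test_dominated1 f g : test_function g -> smooth f ->
  (forall z, g z = 0 -> f z = 0) -> test_function f.
Proof. by move=> tg sf fg; apply: (test_dominated tg tg) => // z /fg. Qed.

Lemma testD f g : test_function f -> test_function g ->
  test_function (fun z => f z + g z).
Proof.
move=> tf tg; apply: (test_dominated tf tg).
  by apply: smoothD; exact: test_smooth.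
by move=> z -> ->; rewrite addr0.
Qed.

Lemma testMl f g : test_function f -> smooth g ->
  test_function (fun z => f z * g z).
Proof.
move=> tf sg; apply: (test_dominated1 tf).
  by apply: smoothM => //; exact: test_smooth.
by move=> z ->; rewrite mul0r.
Qed.

Lemma testZ c f : test_function f -> test_function (fun z => c * f z).
Proof.
move=> tf; apply: (test_dominated1 tf).
  by apply: smoothZ; exact: test_smooth.
by move=> z ->; rewrite mulr0.
Qed.

Lemma test0 : test_function (cst (0 : R) : R * R -> R).
Proof.
apply: (@test_intro _ set0) => //; [exact: smooth_cst|exact: compact0].
Qed.

Lemma near_support f z : ~ clsupp f z -> \near z, f z = 0.
Proof.
move=> Nz; have : open (~` clsupp f) by apply: closed_openC; exact: closed_closure.
rewrite openE => /(_ z Nz); apply: filterS => y /= Ny.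
apply: contrapT => /eqP fy; apply: Ny; exact: subset_closure.
Qed.

Lemma D_out f v z : ~ clsupp f z -> 'D_v f z = 0.
Proof.
move=> Nz; rewrite (@near_eq_derive _ _ _ _ (cst 0)) ?derive_cst//.
exact: near_support.
Qed.

Lemma testDx f : test_function f -> test_function ('D_(ex R) f).
Proof.
move=> [sf cf fO]; apply: (test_intro _ cf fO); first exact: smooth_Dx.
by move=> z; exact: D_out.
Qed.

Lemma testDy f : test_function f -> test_function ('D_(ey R) f).
Proof.
move=> [sf cf fO]; apply: (test_intro _ cf fO); first exact: smooth_Dy.
by move=> z; exact: D_out.
Qed.

Lemma test_bounded f : test_function f -> exists2 C, 0 <= C & forall z, `|f z| <= C.
Proof.
move=> tf; have [sf cf fO] := tf.
have := continuous_compact (continuous_subspaceT (smooth_continuous sf)) cf.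
move=> /compact_bounded [M [_ HM]].
have M1 : M < `|M| + 1 by rewrite ltr_pwDr// ler_norm.
exists (`|M| + 1); first by rewrite addr_ge0.
move=> z; have [fz|/eqP fz] := eqVneq (f z) 0; first by rewrite fz normr0 addr_ge0.
apply: (HM _ M1); exists z => //; exact/subset_closure/eqP.
Qed.

(** Positive exactly on the rectangle ]a, b[ x ]c, d[, on which it increases to
    1 with n. *)
Definition bump (n a b c d : R) (z : R * R) : R :=
  flat 0 (n * z.1 - n * a) * flat 0 (n * b - n * z.1) *
  (flat 0 (n * z.2 - n * c) * flat 0 (n * d - n * z.2)).

Lemma smooth_bump n a b c d : smooth (bump n a b c d).
Proof.
have : smooth (fun z : R * R =>
  flat 0 (n * z.1 + - (n * a)) * flat 0 (- n * z.1 + n * b) *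
  (flat 0 (n * z.2 + - (n * c)) * flat 0 (- n * z.2 + n * d))).
  apply: smooth_expr_smooth; apply: se_mul; apply: se_mul;
  (exact: se_flat1 || exact: se_flat2).
congr smooth; apply/funext => z; rewrite /bump.
by rewrite [_ + n * b]addrC [_ + n * d]addrC !mulNr.
Qed.

Lemma flat0_eq0 (x : R) : x <= 0 -> flat 0 x = 0.
Proof. by rewrite leNgt /flat => /negbTE ->. Qed.

Lemma flat0_gt0 (x : R) : 0 < x -> 0 < flat 0 x.
Proof. by move=> x0; rewrite /flat x0 expr0 mul1r expR_gt0. Qed.

Lemma flat0_le1 (x : R) : flat 0 x <= 1.
Proof.
rewrite /flat; case: ifPn => // x0.
by rewrite expr0 mul1r -expR0 ler_expR oppr_le0 invr_ge0 ltW.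
Qed.

Lemma flat0_nondecreasing (x y : R) : x <= y -> flat 0 x <= flat 0 y.
Proof.
move=> xy; have [x0|x0] := leP x 0; first by rewrite flat0_eq0// flat_ge0.
have y0 := lt_le_trans x0 xy.
by rewrite /flat x0 y0 !expr0 !mul1r ler_expR lerN2 lef_pV2.
Qed.

Lemma bump_ge0 n a b c d z : 0 <= bump n a b c d z.
Proof. by rewrite /bump !mulr_ge0// flat_ge0. Qed.

Lemma bump_le1 n a b c d z : bump n a b c d z <= 1.
Proof. by rewrite /bump !mulr_ile1 ?mulr_ge0 ?flat_ge0 ?flat0_le1. Qed.

Lemma bump_out n a b c d z : 0 < n ->
  ~ (`]a, b[%classic `*` `]c, d[%classic) z -> bump n a b c d z = 0.
Proof.
move=> n0 Nz; apply: contrapT => /eqP.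
have P x y : flat 0 (n * x - n * y) != 0 -> y < x.
  apply: contraNT; rewrite -leNgt => xy; apply/eqP/flat0_eq0.
  by rewrite subr_le0 ler_wpM2l// ltW.
rewrite /bump !mulf_eq0 !negb_or => /andP[/andP[/P az /P zb] /andP[/P cz /P zd]].
by apply: Nz; split; rewrite /= in_itv/= ?az ?zb ?cz ?zd.
Qed.

Lemma test_bump n a b c d : 0 < n -> 0 < a -> b < 1 -> 0 < c -> d < 1 ->
  test_function (bump n a b c d).
Proof.
move=> n0 a0 b1 c0 d1; apply: (@test_intro _ (`[a, b]%classic `*` `[c, d]%classic)).
- exact: smooth_bump.
- by apply: compact_setX; exact: segment_compact.
- move=> z [/=]; rewrite !in_itv/= => /andP[az zb] /andP[cz zd]; split.
  + exact: lt_le_trans az.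
  + exact: le_lt_trans b1.
  + exact: lt_le_trans cz.
  + exact: le_lt_trans d1.
- move=> z Nz; apply: bump_out => // -[/=]; rewrite !in_itv/= => zab zcd; apply: Nz.
  by move: zab zcd => /andP[? ?] /andP[? ?]; split; rewrite /= in_itv/= !ltW.
Qed.

Lemma flat0_scale_cvg (x : R) :
  (fun n : nat => flat 0 (n.+1%:R * x)) @ \oo --> (\1_[set y : R | 0 < y] x : R).
Proof.
have [x0|x0] := leP x 0.
  rewrite indicE memNset/=; last by apply/negP; rewrite -leNgt.
  rewrite (_ : (fun _ => _) = cst 0); first exact: cvg_cst.
  by apply/funext => n; rewrite flat0_eq0// mulr_ge0_le0.
rewrite indicE mem_set//= (_ : true%:R = expR (- 0) :> R); last first.
  by rewrite oppr0 expR0.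
have E n : flat 0 (n.+1%:R * x) = expR (- (x^-1 * n.+1%:R^-1)).
  by rewrite /flat mulr_gt0// expr0 mul1r invfM mulrC.
under eq_fun do rewrite E.
apply: continuous_cvg; first exact: continuous_expR.
apply: cvgN; rewrite -[X in _ --> X](mulr0 x^-1).
by apply: cvgM; [exact: cvg_cst|exact: cvg_harmonic].
Qed.

End SmoothAlgebra.

(** * The measure of the square and integration by parts *)

Section PlanarMeasure.
Context (R : realType).
Local Notation T := (measurableTypeR R * measurableTypeR R)%type.
Local Notation mf f := (measurable_fun [set: T] f).
Implicit Types (f g : R * R -> R).

Lemma open_measurable2 (O : set (R * R)) : open O -> measurable (O : set T).
Proof.
move=> oO.
pose box (q : (rat * rat) * (rat * rat)) : set T :=
  `]ratr q.1.1, ratr q.1.2[%classic `*` `]ratr q.2.1, ratr q.2.2[%classic.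
pose F q := if `[< box q `<=` O >] then box q else set0.
have -> : O = \bigcup_q F q.
  apply/seteqP; split=> [[x y] Oxy|z [q _]]; last first.
    by rewrite /F; case: ifPn => [/asboolP + qz|//]; exact.
  have := oO; rewrite openE => /(_ _ Oxy) /nbhs_ballP [e /= e0 eO].
  have H (a : R) : exists q : rat * rat,
      [/\ ratr q.1 < a, a < ratr q.2, a - e < ratr q.1 & ratr q.2 < a + e].
    have [|q1 +] := @rat_in_itvoo R (a - e) a; first by rewrite ltrBlDr ltrDl.
    rewrite in_itv/= => /andP[h1 h2].
    have [|q2 +] := @rat_in_itvoo R a (a + e); first by rewrite ltrDl.
    by rewrite in_itv/= => /andP[h3 h4]; exists (q1, q2).
  have [q1 [x1 x2 x3 x4]] := H x; have [q2 [y1 y2 y3 y4]] := H y.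
  exists (q1, q2) => //; rewrite /F ifT; last first.
    apply/asboolP => -[a b] [/=]; rewrite !in_itv/= => /andP[a1 a2] /andP[b1 b2].
    apply: eO; split; rewrite /ball/= ltr_norml; apply/andP; split; lra.
  by split; rewrite /= in_itv/=; apply/andP; split.
apply: countable_bigcupT_measurable => [|q]; first exact: countableP.
rewrite /F; case: ifPn => // _.
by apply: measurableX; exact: measurable_itv.
Qed.

Lemma continuous_measurable2 f : continuous f -> mf f.
Proof.
move=> cf mD; apply: (measurability _ (RGenOInfty.measurableE R)) => //.
move=> /= _ [_ [x ->] <-]; rewrite setTI; apply: open_measurable2.
have oI : open (`]x, +oo[%classic : set R) by exact: interval_open.
by move/continuousP : cf => /(_ _ oI).
Qed.

(** The measure of the square is the product of this one with itself, so that
    Fubini and Tonelli apply to integrals over the square. *)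
Definition mu01 : set (measurableTypeR R) -> \bar R :=
  mrestr (@lebesgue_measure R) (measurable_itv `]0, 1[ : measurable `]0%R, (1 : R)[%classic).

HB.instance Definition _ := Measure.on mu01.

Lemma mu01E A : mu01 A = lebesgue_measure (A `&` `]0, 1[%classic).
Proof. by []. Qed.

Lemma mu01T : mu01 setT = 1%E.
Proof.
rewrite mu01E setTI; have := @lebesgue_measure_itv R `]0, 1[.
by rewrite /= lte_fin ltr01 oppr0 adde0.
Qed.

Lemma mu01_fin : fin_num_fun mu01.
Proof.
move=> A mA; rewrite ge0_fin_numE//; apply: (@le_lt_trans _ _ (mu01 setT)).
  by apply: le_measure => //; rewrite inE.
by rewrite mu01T ltry.
Qed.

HB.instance Definition _ := @Measure_isFinite.Build _ _ _ mu01 mu01_fin.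

Lemma muOE (A : set T) : measurable A -> muO R A = (mu01 \x mu01)%E A.
Proof.
move=> mA; apply/esym/product_measure_unique => // B C mB mC.
rewrite /muO /= /mrestr OmegaE -setXI product_measure1E//;
  exact: measurableI.
Qed.

Lemma muOT : muO R setT = 1%E.
Proof.
rewrite muOE// -setXTT; transitivity (mu01 setT * mu01 setT)%E.
  exact: product_measure1E.
by rewrite mu01T mule1.
Qed.

Lemma muO_fin : (muO R setT < +oo)%E.
Proof. by rewrite muOT ltry. Qed.

Lemma integral_muO (f : T -> \bar R) :
  (\int[muO R]_z f z = \int[mu01 \x mu01]_z f z)%E.
Proof. by apply: eq_measure_integral => A mA _; exact: muOE. Qed.

Lemma integral_mu01 (f : measurableTypeR R -> \bar R) : measurable_fun setT f ->
  (\int[mu01]_x f x = \int[@lebesgue_measure R]_(x in `]0%R, 1%R[) f x)%E.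
Proof.
move=> mfn; transitivity (\int[mu01]_(x in `]0%R, 1%R[) f x)%E; last first.
  apply: eq_measure_integral => A mA A01.
  by have := mu01E A; rewrite (setIidl A01).
have mI : measurable (`]0, 1[%classic : set (measurableTypeR R)).
  exact: measurable_itv.
rewrite [RHS]integral_mkcond; apply: ae_eq_integral => //.
  by apply/(measurable_restrictT _ _).1 => //; exact: measurable_funTS.
exists (~` `]0, 1[%classic); split; first exact: measurableC.
  by have := mu01E (~` `]0, 1[%classic); rewrite setICl measure0.
move=> x /= H I; apply: H => _.
by rewrite patchE mem_set.
Qed.

Lemma muO_ae_Omega : {ae muO R, forall z, Omega R z}.
Proof.
exists (~` Omega R); split => //; first by apply: measurableC; exact: measurable_Omega.
by rewrite /muO/= /mrestr setICl measure0.
Qed.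

Lemma FTC_segment (F f : R -> R) (a b : R) : a < b -> continuous f ->
  (forall s : R, is_derive s 1 F (f s)) ->
  (\int[@lebesgue_measure R]_(x in `[a, b]) (f x)%:E = (F b - F a)%:E)%E.
Proof.
move=> ab cf dF; have cF : continuous F.
  by move=> s; exact: is_derive_continuous1 (dF s).
rewrite (@continuous_FTC2 _ _ F)//.
- exact: continuous_subspaceT.
- split.
  + by move=> s _; case: (dF s).
  + by apply: cvg_at_right_filter; exact: cF.
  + by apply: cvg_at_left_filter; exact: cF.
- by move=> s _; rewrite derive1E; case: (dF s).
Qed.

Lemma slice1_derive f (s y : R) : smooth f ->
  is_derive s 1 (fun t => f (t, y)) ('D_(ex R) f (s, y)).
Proof.
move=> sf; have [d1 d2] := smooth_is_dx (s, y) sf.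
have E : (fun h : R => h^-1 *: ((f \o shift (s, y)) (h *: ex R) - f (s, y))) =
  (fun h : R => h^-1 *: (((fun t => f (t, y)) \o shift s) (h *: 1) - f (s, y))).
  apply/funext => h /=; congr (_ *: (f _ - _)).
  by congr (_, _); rewrite /= [_ *: 0]mulr0 add0r.
split.
- by move: d1; rewrite /derivable E.
- by move: d2; rewrite /derive E.
Qed.

Lemma slice2_derive f (x s : R) : smooth f ->
  is_derive s 1 (fun t => f (x, t)) ('D_(ey R) f (x, s)).
Proof.
move=> sf; have [d1 d2] := smooth_is_dy (x, s) sf.
have E : (fun h : R => h^-1 *: ((f \o shift (x, s)) (h *: ey R) - f (x, s))) =
  (fun h : R => h^-1 *: (((fun t => f (x, t)) \o shift s) (h *: 1) - f (x, s))).
  apply/funext => h /=; congr (_ *: (f _ - _)).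
  by congr (_, _); rewrite /= [_ *: 0]mulr0 add0r.
split.
- by move: d1; rewrite /derivable E.
- by move: d2; rewrite /derive E.
Qed.

Lemma slice1_continuous f y : continuous f -> continuous (fun t : R => f (t, y)).
Proof.
move=> cf t; apply: (@continuous_comp _ _ _ (fun t : R => (t, y)) f).
  exact: (cvg_pair cvg_id (cvg_cst y)).
exact: cf.
Qed.

Lemma slice2_continuous f x : continuous f -> continuous (fun t : R => f (x, t)).
Proof.
move=> cf t; apply: (@continuous_comp _ _ _ (fun t : R => (x, t)) f).
  exact: (cvg_pair (cvg_cst x) cvg_id).
exact: cf.
Qed.

Lemma smooth_measurable f : smooth f -> mf f.
Proof. by move=> /smooth_continuous; exact: continuous_measurable2. Qed.

Lemma bounded_intble f C : mf f -> (forall z, `|f z| <= C) -> intble (muO R) f.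
Proof. by move=> mfn fC; apply: intble_le (finite_cst muO_fin C). Qed.

Lemma bounded_L2 f C : mf f -> (forall z, `|f z| <= C) -> L2 (muO R) f.
Proof.
move=> mfn fC; apply: (L2_le mfn _ (L2_cst muO_fin C)) => z /=.
by rewrite (le_trans (fC z))// ler_norm.
Qed.

Lemma test_L2 f : test_function f -> L2 (muO R) f.
Proof.
move=> tf; have [C _ fC] := test_bounded tf.
by apply: (@bounded_L2 _ C) => //; apply: smooth_measurable; exact: test_smooth.
Qed.

Lemma test_intble f : test_function f -> intble (muO R) f.
Proof. by move=> tf; exact: (L2_intble muO_fin (test_L2 tf)). Qed.

(** On every horizontal line the integral is the difference of the values of f
    at two boundary points. *)
Lemma int_test_Dx f : test_function f -> \int[muO R]_z 'D_(ex R) f z = 0.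
Proof.
move=> tf; have sf := test_smooth tf.
have fi := test_intble (testDx tf).
have mD : mf ('D_(ex R) f) by exact: intble_measurable fi.
rewrite /Rintegral integral_muO -integral21_prod_meas1; last first.
  have [m1 i1] := integrableP _ _ _ fi; apply/integrableP; split; first exact: m1.
  by rewrite -integral_muO; exact: i1.
rewrite integral0_eq// => y _.
have cD : continuous (fun s : R => 'D_(ex R) f (s, y)).
  by apply: (@slice1_continuous ('D_(ex R) f) y); apply: smooth_continuous;
    exact: smooth_Dx.
apply: (etrans (integral_mu01 (f := fun x => ('D_(ex R) f (x, y))%:E) _)).
  by have /measurable_EFinP := continuous_measurable_fun cD.
rewrite -(@integral_itv_bndoo R 0 1 _ true false); last first.
  apply: measurable_funTS.
  by have /measurable_EFinP := continuous_measurable_fun cD.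
rewrite (FTC_segment ltr01 cD (fun s => slice1_derive s y sf)).
by rewrite !test_out ?subrr// => -[/=]; rewrite ltxx.
Qed.

Lemma int_test_Dy f : test_function f -> \int[muO R]_z 'D_(ey R) f z = 0.
Proof.
move=> tf; have sf := test_smooth tf.
have fi := test_intble (testDy tf).
have mD : mf ('D_(ey R) f) by exact: intble_measurable fi.
rewrite /Rintegral integral_muO -integral12_prod_meas1; last first.
  have [m1 i1] := integrableP _ _ _ fi; apply/integrableP; split; first exact: m1.
  by rewrite -integral_muO; exact: i1.
rewrite integral0_eq// => x _.
have cD : continuous (fun s : R => 'D_(ey R) f (x, s)).
  by apply: (@slice2_continuous ('D_(ey R) f) x); apply: smooth_continuous;
    exact: smooth_Dy.
apply: (etrans (integral_mu01 (f := fun s => ('D_(ey R) f (x, s))%:E) _)).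
  by have /measurable_EFinP := continuous_measurable_fun cD.
rewrite -(@integral_itv_bndoo R 0 1 _ true false); last first.
  apply: measurable_funTS.
  by have /measurable_EFinP := continuous_measurable_fun cD.
rewrite (FTC_segment ltr01 cD (fun s => slice2_derive x s sf)).
by rewrite !test_out ?subrr// => -[/=]; rewrite ltxx.
Qed.

Lemma DxM f g z : smooth f -> smooth g ->
  'D_(ex R) (fun w => f w * g w) z = 'D_(ex R) f z * g z + f z * 'D_(ex R) g z.
Proof.
by move=> sf sg; case: (is_derive_mul (smooth_is_dx z sf) (smooth_is_dx z sg)).
Qed.

Lemma DyM f g z : smooth f -> smooth g ->
  'D_(ey R) (fun w => f w * g w) z = 'D_(ey R) f z * g z + f z * 'D_(ey R) g z.
Proof.
by move=> sf sg; case: (is_derive_mul (smooth_is_dy z sf) (smooth_is_dy z sg)).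
Qed.

Lemma test_ibp_x f g : test_function f -> test_function g ->
  \int[muO R]_z (f z * 'D_(ex R) g z) = - \int[muO R]_z ('D_(ex R) f z * g z).
Proof.
move=> tf tg; have sf := test_smooth tf; have sg := test_smooth tg.
have := int_test_Dx (testMl tf sg).
rewrite (_ : 'D_(ex R) _ = fun z => 'D_(ex R) f z * g z + f z * 'D_(ex R) g z);
  last by apply/funext => z; rewrite DxM.
rewrite intD; first by move/eqP; rewrite addrC addr_eq0 => /eqP.
- by apply: L2M; [exact/test_L2/testDx|exact: test_L2].
- by apply: L2M; [exact: test_L2|exact/test_L2/testDx].
Qed.

Lemma test_ibp_y f g : test_function f -> test_function g ->
  \int[muO R]_z (f z * 'D_(ey R) g z) = - \int[muO R]_z ('D_(ey R) f z * g z).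
Proof.
move=> tf tg; have sf := test_smooth tf; have sg := test_smooth tg.
have := int_test_Dy (testMl tf sg).
rewrite (_ : 'D_(ey R) _ = fun z => 'D_(ey R) f z * g z + f z * 'D_(ey R) g z);
  last by apply/funext => z; rewrite DyM.
rewrite intD; first by move/eqP; rewrite addrC addr_eq0 => /eqP.
- by apply: L2M; [exact/test_L2/testDy|exact: test_L2].
- by apply: L2M; [exact: test_L2|exact/test_L2/testDy].
Qed.

End PlanarMeasure.

(** * The fundamental lemma of the calculus of variations *)

Section FundamentalLemma.
Context (R : realType).
Local Notation T := (measurableTypeR R * measurableTypeR R)%type.
Local Notation mf f := (measurable_fun [set: T] f).
Implicit Types (f g : R * R -> R).

Definition rect (a b c d : R) : set (R * R) := `]a, b[%classic `*` `]c, d[%classic.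

Lemma measurable_rect a b c d : measurable (rect a b c d : set T).
Proof. by apply: measurableX; exact: measurable_itv. Qed.

Lemma rectP a b c d (z : R * R) :
  rect a b c d z <-> [/\ a < z.1, z.1 < b, c < z.2 & z.2 < d].
Proof.
rewrite /rect/= !in_itv/=; split; first by move=> [/andP[-> ->] /andP[-> ->]].
by move=> [-> -> -> ->].
Qed.

Lemma bump_cvg a b c d (z : R * R) :
  (fun n : nat => bump n.+1%:R a b c d z) @ \oo --> (\1_(rect a b c d) z : R).
Proof.
have -> : (\1_(rect a b c d) z : R) =
  \1_[set y : R | 0 < y] (z.1 - a) * \1_[set y : R | 0 < y] (b - z.1) *
  (\1_[set y : R | 0 < y] (z.2 - c) * \1_[set y : R | 0 < y] (d - z.2)).
  rewrite !indicE; have [|] := pselect (rect a b c d z).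
    move=> H; rewrite mem_set//; move/rectP : H => [? ? ? ?].
    by rewrite !mem_set/= ?subr_gt0// !mulr1.
  move=> H; rewrite memNset//.
  have P (x : R) : x <= 0 -> (x \in [set y : R | 0 < y]) = false.
    by move=> x0; apply: memNset => /=; rewrite ltNge x0.
  case: (leP (z.1 - a) 0) => h1; first by rewrite (P _ h1) ?mul0r.
  case: (leP (b - z.1) 0) => h2; first by rewrite (P _ h2) ?mulr0 ?mul0r.
  case: (leP (z.2 - c) 0) => h3; first by rewrite (P _ h3) ?mul0r ?mulr0.
  case: (leP (d - z.2) 0) => h4; first by rewrite (P _ h4) !mulr0.
  by exfalso; apply: H; apply/rectP; split; rewrite -subr_gt0.
rewrite /bump; under eq_fun do rewrite -!mulrBr.
by apply: cvgM; apply: cvgM; exact: flat0_scale_cvg.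
Qed.

Lemma loc_integrable_rect g a b c d : loc_integrable g ->
  0 < a -> b < 1 -> 0 < c -> d < 1 ->
  intble (muO R) (fun z => g z * \1_(rect a b c d) z).
Proof.
move=> [mg gi] a0 b1 c0 d1.
pose K : set (R * R) := `[a, b]%classic `*` `[c, d]%classic.
have mK : measurable (K : set T) by apply: measurableX; exact: measurable_itv.
have Ki : (muO R).-integrable setT (EFin \o (fun z => g z * \1_K z)).
  have -> : EFin \o (fun z => g z * \1_K z) = (EFin \o g) \_ K.
    apply/funext => z; rewrite patchE /= indicE.
    by case: (z \in K); rewrite ?mulr1 ?mulr0.
  rewrite -(integrable_mkcond _ mK); apply: gi.
    by apply: compact_setX; exact: segment_compact.
  move=> z [/=]; rewrite !in_itv/= => /andP[? ?] /andP[? ?]; split.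
  - exact: lt_le_trans a0 _.
  - exact: le_lt_trans b1.
  - exact: lt_le_trans c0 _.
  - exact: le_lt_trans d1.
apply: intble_le (intble_norm Ki).
  apply: measurable_funM => //.
  by apply: measurable_indic; exact: measurable_rect.
move=> z; rewrite !normrM ler_wpM2l// !indicE.
have [H|H] := pselect (rect a b c d z); last by rewrite memNset// normr0.
have Kz : K z by move/rectP : (H) => [? ? ? ?]; split; rewrite /= in_itv/= !ltW.
by rewrite !mem_set.
Qed.

(** The indicator of the rectangle is a dominated limit of bumps. *)
Lemma int_rect0 g a b c d : loc_integrable g ->
  (forall phi, test_function phi -> \int[muO R]_z (g z * phi z) = 0) ->
  0 < a -> b < 1 -> 0 < c -> d < 1 ->
  \int[muO R]_z (g z * \1_(rect a b c d) z) = 0.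
Proof.
move=> lg H a0 b1 c0 d1; have [mg gi] := lg.
have ri := loc_integrable_rect lg a0 b1 c0 d1.
have n0 n : (0 : R) < n.+1%:R by rewrite ltr0n.
have [] := @dominated_le _ _ _ (muO R)
  (fun n z => g z * bump n.+1%:R a b c d z)
  (fun z => g z * \1_(rect a b c d) z)
  (fun z => `|g z * \1_(rect a b c d) z|).
- move=> n; apply: measurable_funM => //.
  by apply: smooth_measurable; exact: smooth_bump.
- exact: intble_measurable ri.
- exact: intble_norm.
- move=> n z; rewrite normrM [leRHS]normrM ler_wpM2l//.
  have [h|h] := pselect (rect a b c d z).
    rewrite indicE mem_set//= normr1 ger0_norm; first exact: bump_le1.
    exact: bump_ge0.
  by rewrite bump_out// normr0.
- by apply: aeW => z; apply: cvgM; [exact: cvg_cst|exact: bump_cvg].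
move=> _; rewrite (_ : (fun n => _) = cst 0).
  by move=> /(cvg_lim (@Rhausdorff R)) <-; rewrite lim_cst.
by apply/funext => n; rewrite H//; exact: test_bump.
Qed.

(** Quadrants are stable under intersection and generate the Borel sets of the
    plane, as the monotone class argument of int_rays_eq0 requires. *)
Definition rays : set (set T) :=
  [set X | exists x y : R, X = `]x, +oo[%classic `*` `]y, +oo[%classic].

Lemma measurable_rays : forall X : set T, measurable X -> <<s rays >> X.
Proof.
have bigray (y : R) : exists2 k : nat, True & - k%:R < y.
  exists (Num.truncn `|y|).+1 => //; rewrite ltrNl.
  by apply: le_lt_trans (ler_norm _) _; rewrite normrN truncnS_gt.
have m1 : measurable_fun [set: g_sigma_algebraType rays]
    (fst : g_sigma_algebraType rays -> measurableTypeR R).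
  move=> _; apply: (measurability _ (RGenOInfty.measurableE R)) => //.
  move=> _ [_ [x ->] <-]; rewrite setTI.
  rewrite (_ : _ @^-1` _ = \bigcup_k
     (`]x, +oo[%classic `*` `]- (k%:R : R), +oo[%classic)).
    apply: bigcupT_measurable => k; apply: sub_sigma_algebra.
    by exists x, (- k%:R).
  apply/seteqP; split=> [[a b] /= xa|[a b] [k _ [/=]] ->//].
  have [k _ kb] := bigray b.
  by exists k => //; split => //=; rewrite in_itv/= andbT.
have m2 : measurable_fun [set: g_sigma_algebraType rays]
    (snd : g_sigma_algebraType rays -> measurableTypeR R).
  move=> _; apply: (measurability _ (RGenOInfty.measurableE R)) => //.
  move=> _ [_ [x ->] <-]; rewrite setTI.
  rewrite (_ : _ @^-1` _ = \bigcup_k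
     (`]- (k%:R : R), +oo[%classic `*` `]x, +oo[%classic)).
    apply: bigcupT_measurable => k; apply: sub_sigma_algebra.
    by exists (- k%:R), x.
  apply/seteqP; split=> [[a b] /= xa|[a b] [k _ [/=]] _ ->//].
  have [k _ kb] := bigray a.
  by exists k => //; split => //=; rewrite in_itv/= andbT.
move=> X mX; have /(_ measurableT X mX) := measurable_fun_pair m1 m2.
rewrite setTI (_ : _ @^-1` X = X)//.
by apply/seteqP; split=> -[].
Qed.

(** The sets over which h integrates to 0 form a Dynkin system. *)
Lemma int_rays_eq0 (h : T -> R) : intble (muO R) h ->
  (forall x y : R, \int[muO R]_z (h z * \1_(`]x, +oo[ `*` `]y, +oo[)%classic z) = 0) ->
  \int[muO R]_z h z = 0 ->
  forall X : set T, measurable X -> \int[muO R]_z (h z * \1_X z) = 0.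
Proof.
move=> hi H0 HT.
have mh := intble_measurable hi.
have hXi (X : set T) : measurable X -> intble (muO R) (fun z => h z * \1_X z).
  move=> mX; apply: intble_le (intble_norm hi).
    by apply: measurable_funM => //; exact: measurable_indic.
  by move=> z; rewrite normrM ler_piMr// indicE; case: (z \in X); rewrite ?normr1 ?normr0.
pose H := [set X : set T | measurable X /\ \int[muO R]_z (h z * \1_X z) = 0].
suff : <<s rays >> `<=` H by move=> sub X /measurable_rays/sub [].
apply: (@lambda_system_subset T rays _ setT H _ _ _) => //.
- move=> _ _ [x [y ->]] [x' [y' ->]]; exists (Num.max x x'), (Num.max y y').
  apply/seteqP; split=> -[a b] /=; rewrite !in_itv/= !andbT !gt_max.
    by move=> [[-> ->] [-> ->]].
  by move=> [/andP[-> ->] /andP[-> ->]].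
- split=> //.
  + split=> //; under eq_Rintegral do rewrite indicT mulr1.
    exact: HT.
  + move=> A B BA [mA HA] [mB HB]; split; first exact: measurableD.
    rewrite (eq_Rintegral _ (g := fun z => h z * \1_A z - h z * \1_B z)).
      by rewrite intB ?HA ?HB ?subr0//; exact: hXi.
    move=> z _; rewrite -mulrBr; congr (_ * _).
    rewrite !indicE in_setD; case: (boolP (z \in B)) => zB /=.
      by rewrite andbF (_ : z \in A) ?subrr//; apply/mem_set/BA/set_mem.
    by rewrite andbT subr0.
  + move=> F ndF HF; have mF n : measurable (F n) by case: (HF n).
    split; first exact: bigcupT_measurable.
    have [|||||_] := @dominated_le _ _ _ (muO R) (fun n z => h z * \1_(F n) z)
      (fun z => h z * \1_(\bigcup_n F n) z) (fun z => `|h z|).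
    * by move=> n; exact: intble_measurable (hXi _ (mF n)).
    * by apply: intble_measurable (hXi _ _); exact: bigcupT_measurable.
    * exact: intble_norm.
    * move=> n z; rewrite normrM ler_piMr// indicE.
      by case: (z \in F n); rewrite ?normr1 ?normr0.
    * apply: aeW => z; apply: cvgM; first exact: cvg_cst.
      have [[k _ Fkz]|NF] := pselect ((\bigcup_n F n) z).
        rewrite [in X in _ --> X]indicE mem_set//; last by exists k.
        apply: cvg_near_cst; exists k => // n /= kn; rewrite indicE mem_set//.
        by move/subsetPset : (ndF _ _ kn); apply.
      rewrite [in X in _ --> X]indicE memNset//.
      apply: cvg_near_cst; apply: nearW => n; rewrite indicE memNset// => Fn.
      by apply: NF; exists n.
    rewrite (_ : (fun n => _) = cst 0).
      by move=> /(cvg_lim (@Rhausdorff R)) <-; rewrite lim_cst.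
    by apply/funext => n; case: (HF n).
- move=> _ [x [y ->]]; split; last exact: H0.
  by apply: measurableX; exact: measurable_itv.
Qed.

(** On each smaller square the function integrates to 0 over all rectangles, by
    int_rect0, hence over all Borel sets; these squares exhaust the domain. *)
Lemma fundamental_lemma g : loc_integrable g ->
  (forall phi, test_function phi -> \int[muO R]_z (g z * phi z) = 0) ->
  g = cst 0 %[ae muO R].
Proof.
move=> lg H; have [mg _] := lg.
pose e n : R := n.+2%:R^-1.
have e0 n : 0 < e n by rewrite invr_gt0 ltr0n.
have hm n : {ae muO R, forall z, g z * \1_(rect (e n) (1 - e n) (e n) (1 - e n)) z = 0}.
  have e1 : 1 - e n < 1 by rewrite ltrBlDr ltrDl.
  have hi : intble (muO R) (fun z => g z * \1_(rect (e n) (1 - e n) (e n) (1 - e n)) z).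
    exact: loc_integrable_rect.
  have hX := @int_rays_eq0 _ hi.
  have {hX} hX X : measurable X -> \int[muO R]_z
      (g z * \1_(rect (e n) (1 - e n) (e n) (1 - e n)) z * \1_X z) = 0.
    apply: hX => //; last exact: int_rect0.
    move=> x y; rewrite (eq_Rintegral _ (g := fun z : T => g z *
      \1_(rect (Num.max (e n) x) (1 - e n) (Num.max (e n) y) (1 - e n)) z)).
      by apply: int_rect0 => //; rewrite lt_max e0.
    move=> z _; rewrite -mulrA; congr (_ * _).
    rewrite -[LHS]/((\1__ \* \1__) z) -indicI; congr (\1_ _ z).
    apply/seteqP; split=> w.
      move=> [/rectP[h1 h2 h3 h4] [/=]]; rewrite !in_itv/= !andbT => h5 h6.
      by apply/rectP; rewrite !gt_max h1 h2 h3 h4 h5 h6.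
    move=> /rectP; rewrite !gt_max => -[/andP[h1 h5] h2 /andP[h3 h6] h4].
    by split; [apply/rectP|split; rewrite /= in_itv/= andbT].
  have K : ae_eq (muO R) setT (EFin \o (fun z => g z *
      \1_(rect (e n) (1 - e n) (e n) (1 - e n)) z)) (cst 0%E).
    apply: integral_ae_eq => // E _ mE; rewrite integral_cst// mul0e integral_mkcond.
    rewrite (_ : _ \_ E = EFin \o (fun z => g z *
      \1_(rect (e n) (1 - e n) (e n) (1 - e n)) z * \1_E z)); last first.
      apply/funext => z; rewrite patchE /= [\1_E z]indicE.
      by case: (z \in E); rewrite ?mulr1 ?mulr0.
    rewrite -int_EFin ?hX//.
    apply: intble_le (intble_norm hi).
      apply: measurable_funM; [exact: intble_measurable hi|exact: measurable_indic].
    move=> z; rewrite normrM ler_piMr// indicE.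
    by case: (z \in E); rewrite ?normr1 ?normr0.
  by apply: filterS K => z /= /(_ Logic.I) [].
have aO := muO_ae_Omega R.
have ag := ae_foralln hm.
apply: (ae_imply2 aO ag) => z [z1 z2 z3 z4] /= gz _.
pose m := Num.min (Num.min z.1 (1 - z.1)) (Num.min z.2 (1 - z.2)).
have m0 : 0 < m by rewrite !lt_min z1 z3 !subr_gt0 z2 z4.
pose n := Num.truncn m^-1.
have en : e n < m.
  rewrite /e -[m]invrK ltf_pV2 ?posrE ?invr_gt0// ?ltr0n//.
  by apply: lt_trans (truncnS_gt _) _; rewrite ltr_nat.
move: en; rewrite !lt_min => /andP[/andP[h1 h2] /andP[h3 h4]].
have := gz n; rewrite indicE mem_set ?mulr1//.
by apply/rectP; split=> //; lra.
Qed.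

End FundamentalLemma.

(** * Lebesgue norms and weak derivatives *)

Section LfunL2.
Context d (T : measurableType d) (R : realType).
Variable mu : {measure set T -> \bar R}.

Lemma integral_powR_lty (r : R) (f : T -> R) : measurable_fun setT f -> 0 < r ->
  (f \in Lfun mu r%:E) <-> intble mu (fun x => `|f x| `^ r).
Proof.
move=> mf r0; have mpow : measurable_fun setT (fun x => `|f x| `^ r).
  apply: (measurableT_comp (measurable_powR r)).
  exact: measurableT_comp.
have I0 : (0 <= \int[mu]_x (`|f x| `^ r)%:E)%E.
  by apply: integral_ge0 => x _; rewrite lee_fin powR_ge0.
split.
  rewrite inE => /andP[_]; rewrite inE/= /finite_norm unlock /Lnorm.
  under eq_integral do rewrite /= -poweR_EFin.
  move=> fin; apply/integrableP; split; first exact/measurable_EFinP.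
  under eq_integral do rewrite /= ger0_norm ?powR_ge0//.
  by apply: lty_poweRy fin; rewrite invr_neq0// gt_eqF.
move=> /integrableP[_ fin]; rewrite inE; apply/andP; split; first by rewrite inE.
rewrite inE/= /finite_norm unlock /Lnorm; apply: poweR_lty.
move: fin; under eq_integral do rewrite /= ger0_norm ?powR_ge0//.
by [].
Qed.

Lemma LnormE (r : R) (f : T -> R) : intble mu (fun x => `|f x| `^ r) ->
  fine ('N[mu]_(r%:E)[EFin \o f])%E = (\int[mu]_x (`|f x| `^ r)) `^ r^-1.
Proof.
move=> fi; rewrite unlock /Lnorm.
rewrite (_ : (\int[mu]_x (`|(EFin \o f) x| `^ r))%E = (\int[mu]_x (`|f x| `^ r))%:E).
  by rewrite poweR_EFin.
by rewrite int_EFin.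
Qed.

Lemma L2P (f : T -> R) : f \in Lfun mu 2%:E <-> L2 mu f.
Proof.
have E : (fun x => `|f x| `^ 2) = (fun x => f x ^+ 2).
  by apply/funext => x; rewrite powR_mulrn// real_normK ?num_real.
split=> [Hf|[mf fi]].
  have mf : measurable_fun setT f by move: Hf; rewrite inE => /andP[]; rewrite inE.
  by split=> //; rewrite -E; apply/(integral_powR_lty mf (ltr0n _ 2)).1.
by apply/(integral_powR_lty mf (ltr0n _ 2)).2; rewrite E.
Qed.

Lemma L2_normE (f : T -> R) : L2 mu f ->
  fine ('N[mu]_(2%:E)[EFin \o f])%E = N2 mu f.
Proof.
move=> [mf fi].
have E : (fun x => `|f x| `^ 2) = (fun x => f x ^+ 2).
  by apply/funext => x; rewrite powR_mulrn// real_normK ?num_real.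
rewrite LnormE ?E// powR12_sqrt//.
by apply: int_ge0 => x; exact: sqr_ge0.
Qed.

End LfunL2.

Section WeakDerivative.
Context (R : realType).
Local Notation T := (measurableTypeR R * measurableTypeR R)%type.
Local Notation mf f := (measurable_fun [set: T] f).
Local Notation mu := (muO R).
Implicit Types (f g u phi psi : R * R -> R).

(** The axis is a boolean parameter, so that each fact on the two weighted
    derivatives has a single statement. *)
Definition dir (b : bool) : R * R := if b then ex R else ey R.

Lemma testD_dir b phi : test_function phi -> test_function ('D_(dir b) phi).
Proof. by case: b; [exact: testDx|exact: testDy]. Qed.

Lemma test_ibp b phi psi : test_function phi -> test_function psi ->
  \int[mu]_z (phi z * 'D_(dir b) psi z) = - \int[mu]_z ('D_(dir b) phi z * psi z).
Proof. by case: b; [exact: test_ibp_x|exact: test_ibp_y]. Qed.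

Lemma smooth_is_dir b phi z : smooth phi ->
  is_derive z (dir b) phi ('D_(dir b) phi z).
Proof. by case: b; [exact: smooth_is_dx|exact: smooth_is_dy]. Qed.

Lemma D_lin b phi psi (c d : R) z : smooth phi -> smooth psi ->
  'D_(dir b) (fun w => c * phi w + d * psi w) z =
  c * 'D_(dir b) phi z + d * 'D_(dir b) psi z.
Proof.
move=> sf sg.
have H (k : R) f : smooth f ->
    is_derive z (dir b) (fun w => k * f w) (k * 'D_(dir b) f z).
  move=> s; have := is_derive_mul (is_derive_cst k z (dir b)) (smooth_is_dir b z s).
  by rewrite mul0r add0r.
by have [_] := is_derive_add (H c _ sf) (H d _ sg).
Qed.

Lemma loc_integrable_test g phi : loc_integrable g -> test_function phi ->
  intble mu (fun z => g z * phi z).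
Proof.
move=> [mg gi] tphi; have [sf cf fO] := tphi.
have [C C0 fC] := test_bounded tphi.
set K := closure [set z | phi z != 0] in cf fO.
have mK : measurable (K : set T).
  rewrite -[K]setCK; apply: measurableC; apply: open_measurable2.
  by apply: closed_openC; exact: closed_closure.
have Ki : mu.-integrable setT (EFin \o (fun z => C * (g z * \1_K z))).
  apply: intbleZ; have -> : (fun z => g z * \1_K z) = g \_ K.
    apply/funext => z; rewrite patchE /= indicE.
    by case: (z \in K); rewrite ?mulr1 ?mulr0.
  rewrite /intble -restrict_EFin -(integrable_mkcond _ mK); exact: gi.
apply: intble_le (intble_norm Ki).
  by apply: measurable_funM => //; apply: smooth_measurable.
move=> z; have [fz|/eqP fz] := eqVneq (phi z) 0; first by rewrite fz mulr0 normr0.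
rewrite indicE mem_set ?mulr1; last by apply: subset_closure; exact/eqP.
by rewrite !normrM mulrC ler_wpM2r// (ger0_norm C0).
Qed.

Lemma loc_integrableB f g : loc_integrable f -> loc_integrable g ->
  loc_integrable (fun z => f z - g z).
Proof.
move=> [mf1 fi] [mg gi]; split; first exact: measurable_funB.
move=> K cK KO; have mK : measurable (K : set T).
  rewrite -[K]setCK; apply: measurableC; apply: open_measurable2.
  by apply: closed_openC; apply: compact_closed => //; exact: norm_hausdorff.
exact: (integrableB mK (fi K cK KO) (gi K cK KO)).
Qed.

Lemma L2_loc_integrable g : L2 mu g -> loc_integrable g.
Proof.
move=> Lg; split; first by case: Lg.
move=> K cK KO; have mK : measurable (K : set T).
  rewrite -[K]setCK; apply: measurableC; apply: open_measurable2.
  by apply: closed_openC; apply: compact_closed => //; exact: norm_hausdorff.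
exact: integrableS (L2_intble (muO_fin R) Lg).
Qed.

(** The difference of the two derivatives is orthogonal to all test functions. *)
Lemma wderiv_unique v u g g' : is_wderiv v u g -> is_wderiv v u g' ->
  g = g' %[ae mu].
Proof.
move=> [lg Hg] [lg' Hg'].
have : (fun z => g z - g' z) = cst 0 %[ae mu].
  apply: fundamental_lemma; first exact: loc_integrableB.
  move=> phi tphi; have := Hg' _ tphi; rewrite (Hg _ tphi) => /oppr_inj E.
  transitivity (\int[mu]_z (g z * phi z - g' z * phi z)).
    by congr Rintegral; apply/funext => z; rewrite mulrBl.
  by rewrite intB ?E ?subrr//; exact: loc_integrable_test.
move=> H; apply: (ae_imply H) => z + zT => /(_ zT) /eqP.
by rewrite subr_eq0 => /eqP.
Qed.

Lemma is_wderiv_test b phi : test_function phi ->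
  is_wderiv (dir b) phi ('D_(dir b) phi).
Proof.
move=> tphi; split; first by apply: L2_loc_integrable; exact/test_L2/testD_dir.
by move=> psi tpsi; exact: test_ibp.
Qed.

Lemma is_wderivB b u u' g g' : L2 mu u -> L2 mu u' ->
  is_wderiv (dir b) u g -> is_wderiv (dir b) u' g' ->
  is_wderiv (dir b) (fun z => u z - u' z) (fun z => g z - g' z).
Proof.
move=> Lu Lu' [lg Hg] [lg' Hg']; split; first exact: loc_integrableB.
move=> phi tphi.
have LD := test_L2 (testD_dir b tphi).
transitivity (\int[mu]_z (u z * 'D_(dir b) phi z - u' z * 'D_(dir b) phi z)).
  by congr Rintegral; apply/funext => z; rewrite mulrBl.
rewrite intB; [|exact: L2M|exact: L2M]; rewrite Hg// Hg'// -opprD; congr (- _).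
transitivity (\int[mu]_z (g z * phi z - g' z * phi z)); last first.
  by congr Rintegral; apply/funext => z; rewrite mulrBl.
by rewrite intB//; exact: loc_integrable_test.
Qed.

Lemma wderivP v u g : is_wderiv v u g -> is_wderiv v u (wderiv v u).
Proof. move=> H; rewrite /wderiv.
by apply: (@xgetPex _ _ [set g | is_wderiv v u g]); exists g. Qed.

Lemma wderiv_ae v u g : is_wderiv v u g -> wderiv v u = g %[ae mu].
Proof. by move=> H; exact: wderiv_unique (wderivP H) H. Qed.

End WeakDerivative.

(** * Weighted gradients and the closure of the test functions *)

Section GraphClosure.
Context (R : realType) (alpha1 alpha2 : R).
Hypotheses (alpha1_gt0 : 0 < alpha1) (alpha2_gt0 : 0 < alpha2).
Local Notation T := (measurableTypeR R * measurableTypeR R)%type.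
Local Notation mf f := (measurable_fun [set: T] f).
Local Notation mu := (muO R).
Implicit Types (f g u phi psi : R * R -> R) (G : bool -> R * R -> R).

Definition wt (b : bool) (z : R * R) : R :=
  if b then z.2 `^ alpha1 else z.1 `^ alpha2.
Definition grad (b : bool) phi z : R := wt b z * 'D_(dir R b) phi z.
(** The two components are wx u and wy u; grad is their counterpart for a smooth
    function, with the classical derivative. *)
Definition grd u (b : bool) z : R := wt b z * wderiv (dir R b) u z.

Lemma gradE b phi z : grad b phi z = wt b z * 'D_(dir R b) phi z.
Proof. by []. Qed.

Lemma grdE u b z : grd u b z = wt b z * wderiv (dir R b) u z.
Proof. by []. Qed.

Lemma measurable_wt b : mf (wt b).
Proof.
case: b.
- exact: (measurableT_comp (measurable_powR alpha1) (@measurable_snd _ _ _ _)).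
- exact: (measurableT_comp (measurable_powR alpha2) (@measurable_fst _ _ _ _)).
Qed.

Lemma wt_gt0 b z : Omega R z -> 0 < wt b z.
Proof. by move=> [? ? ? ?]; case: b; exact: powR_gt0. Qed.

Lemma wt_le1 b z : Omega R z -> wt b z <= 1.
Proof.
move=> [x0 x1 y0 y1]; rewrite -(powRr0 (if b then z.2 else z.1)).
by case: b; rewrite /wt ger_powR ?ltW// ?x0 ?y0/= ?ltW.
Qed.

Lemma wt_continuous b z : Omega R z -> {for z, continuous (wt b)}.
Proof.
move=> [x0 _ y0 _]; case: b.
- apply: (@continuous_comp _ _ _ (fun z : R * R => z.2) (fun y => y `^ alpha1)).
    exact: cvg_snd.
  exact: is_derive_continuous1 (is_derive1_powR alpha1 y0).
- apply: (@continuous_comp _ _ _ (fun z : R * R => z.1) (fun y => y `^ alpha2)).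
    exact: cvg_fst.
  exact: is_derive_continuous1 (is_derive1_powR alpha2 x0).
Qed.

(** The weights degenerate only on the axes, away from K. *)
Lemma wtV_bounded b (K : set (R * R)) : compact K -> K `<=` Omega R ->
  exists2 C, 0 <= C & forall z, K z -> (wt b z)^-1 <= C.
Proof.
move=> cK KO.
have cont : {within K, continuous (fun z => (wt b z)^-1)}.
  apply: continuous_in_subspaceT => z /set_mem /KO Oz.
  by apply: cvgV; [rewrite gt_eqF// wt_gt0|exact: wt_continuous].
have /compact_bounded [M [_ HM]] := continuous_compact cont cK.
have M1 : M < `|M| + 1 by rewrite ltr_pwDr// ler_norm.
exists (`|M| + 1); first by rewrite addr_ge0.
by move=> z Kz; apply: le_trans (ler_norm _) _; apply: (HM _ M1); exists z.
Qed.

Lemma test_wtV_bounded b psi : test_function psi ->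
  exists C, forall z, `|psi z / wt b z| <= C.
Proof.
move=> tpsi; have [_ cK KO] := tpsi; have [C C0 wC] := wtV_bounded b cK KO.
have [D D0 pD] := test_bounded tpsi.
exists (D * C) => z; have [->|fz] := eqVneq (psi z) 0.
  by rewrite mul0r normr0 mulr_ge0.
have Kz : closure [set z | psi z != 0] z by apply: subset_closure.
rewrite normrM ler_pM// gtr0_norm ?wC// invr_gt0; exact/wt_gt0/KO.
Qed.

Lemma measurable_wtV b : mf (fun z => (wt b z)^-1).
Proof.
case: b; rewrite /wt; under eq_fun do rewrite -powRN.
- exact: (measurableT_comp (measurable_powR (- alpha1)) (@measurable_snd _ _ _ _)).
- exact: (measurableT_comp (measurable_powR (- alpha2)) (@measurable_fst _ _ _ _)).
Qed.
 
Lemma test_wtV_L2 b psi : test_function psi -> L2 mu (fun z => psi z / wt b z).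
Proof.
move=> tpsi; have [C HC] := test_wtV_bounded b tpsi.
apply: (@bounded_L2 _ _ C) => //; apply: measurable_funM; last exact: measurable_wtV.
by apply: smooth_measurable; exact: test_smooth.
Qed.

Lemma grad_L2 b phi : test_function phi -> L2 mu (grad b phi).
Proof.
move=> tphi; have tD := testD_dir b tphi; have LD := test_L2 tD.
apply: (L2_le _ _ LD); first by apply: measurable_funM; [exact: measurable_wt|case: LD].
move=> z; have [Oz|NO] := pselect (Omega R z); last first.
  by rewrite /grad (test_out tD NO) mulr0.
by rewrite /grad normrM ler_piMl// ger0_norm ?wt_le1// ltW ?wt_gt0.
Qed.

Lemma grad_lin b phi psi c d z : test_function phi -> test_function psi ->
  grad b (fun w => c * phi w + d * psi w) z = c * grad b phi z + d * grad b psi z.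
Proof.
move=> tf tg; rewrite !gradE D_lin; [|exact: test_smooth|exact: test_smooth].
by rewrite mulrDr ![wt b z * (_ * _)]mulrCA.
Qed.

(** The class C records constraints on the approximating test functions, such as
    nonnegativity. *)
Definition near_graph (C : (R * R -> R) -> Prop) u G := forall e : R, 0 < e ->
  exists phi, [/\ C phi, test_function phi, N2 mu (fun z => phi z - u z) <= e &
    forall b, N2 mu (fun z => grad b phi z - G b z) <= e].

Definition Wgraph C u G := [/\ L2 mu u, forall b, L2 mu (G b) & near_graph C u G].

(** Integration by parts holds for the approximating test functions and passes
    to the limit, because psi / wt b is square integrable. *)
Lemma Wgraph_is_wderiv C u G b : Wgraph C u G ->
  is_wderiv (dir R b) u (fun z => G b z / wt b z).
Proof.
move=> [Lu LG ap]; split.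
  split; first by apply: measurable_funM; [case: (LG b)|exact: measurable_wtV].
  move=> K cK KO; have [D D0 wD] := wtV_bounded b cK KO.
  have mK : measurable (K : set T).
    rewrite -[K]setCK; apply: measurableC; apply: open_measurable2.
    by apply: closed_openC; apply: compact_closed => //; exact: norm_hausdorff.
  have i1 : mu.-integrable K (EFin \o (fun z => D * G b z)).
    by apply: integrableS (L2_intble (muO_fin R) (L2Z D (LG b))).
  apply: le_integrable i1 => //.
    apply/measurable_EFinP/measurable_funTS.
    by apply: measurable_funM; [case: (LG b)|exact: measurable_wtV].
  move=> z Kz /=; rewrite lee_fin !normrM mulrC ler_wpM2r//.
  by rewrite normfV (ger0_norm D0) gtr0_norm ?wD//; exact/wt_gt0/KO.
move=> psi tpsi; have tD := testD_dir b tpsi.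
have LD := test_L2 tD; have LW := test_wtV_L2 b tpsi.
pose A := N2 mu ('D_(dir R b) psi) + N2 mu (fun z => psi z / wt b z).
have A0 : 0 <= A by rewrite addr_ge0// N2_ge0.
apply/eqP; rewrite -subr_eq0 opprK -normr_le0; apply/ler_addgt0Pr => e e0.
rewrite add0r.
have e1 : 0 < e / (A + 1) by rewrite divr_gt0// ltr_wpDl.
have [phi [_ tphi p1 p2]] := ap _ e1.
have Lp := test_L2 tphi.
have Lg := grad_L2 b tphi.
have E : \int[mu]_z (u z * 'D_(dir R b) psi z) +
   \int[mu]_z (G b z / wt b z * psi z) =
   \int[mu]_z ((u z - phi z) * 'D_(dir R b) psi z) +
   \int[mu]_z ((G b z - grad b phi z) * (psi z / wt b z)).
  have -> : \int[mu]_z ((u z - phi z) * 'D_(dir R b) psi z) =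
     \int[mu]_z (u z * 'D_(dir R b) psi z) - \int[mu]_z (phi z * 'D_(dir R b) psi z).
    rewrite -intB; [|exact: L2M|exact: L2M].
    by congr Rintegral; apply/funext => z; rewrite mulrBl.
  have -> : \int[mu]_z ((G b z - grad b phi z) * (psi z / wt b z)) =
     \int[mu]_z (G b z / wt b z * psi z) - \int[mu]_z ('D_(dir R b) phi z * psi z).
    have -> : \int[mu]_z ('D_(dir R b) phi z * psi z) =
       \int[mu]_z (grad b phi z * (psi z / wt b z)).
      congr Rintegral; apply/funext => z.
      have [Oz|NO] := pselect (Omega R z); last first.
        by rewrite (test_out tpsi NO) mul0r !mulr0.
      rewrite /grad; have := wt_gt0 b Oz; move: (wt b z) => w w0.
      by field; rewrite gt_eqF.
    have -> : \int[mu]_z (G b z / wt b z * psi z) =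
       \int[mu]_z (G b z * (psi z / wt b z)).
      by congr Rintegral; apply/funext => z; rewrite mulrAC mulrA.
    rewrite -intB; [|exact: L2M|exact: L2M].
    by congr Rintegral; apply/funext => z; rewrite mulrBl.
  by rewrite (test_ibp b tphi tpsi); ring.
rewrite E; apply: le_trans (ler_normD _ _) _.
have c1 := cauchy_schwarz (L2B Lu Lp) LD.
have c2 := cauchy_schwarz (L2B (LG b) Lg) LW.
have {}p2 := p2 b; rewrite N2_sub_sym in p2; rewrite N2_sub_sym in p1.
apply: (@le_trans _ _ (e / (A + 1) * A)).
  rewrite /A mulrDr; apply: lerD.
    by apply: le_trans c1 _; rewrite ler_wpM2r ?N2_ge0.
  by apply: le_trans c2 _; rewrite ler_wpM2r ?N2_ge0.
rewrite -[leRHS](divfK (x := A + 1)) ?gt_eqF ?ltr_wpDl//.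
by rewrite ler_wpM2l ?ltW// ltrDl.
Qed.

Lemma grd_ae_Wgraph C u G b : Wgraph C u G -> grd u b = G b %[ae mu].
Proof.
move=> /(Wgraph_is_wderiv b)/wderiv_ae H.
apply: (ae_imply2 H (muO_ae_Omega R)) => z + Oz zT => /(_ zT).
by rewrite /grd => ->; rewrite mulrC divfK// gt_eqF// wt_gt0.
Qed.

Lemma measurable_grd u g b : is_wderiv (dir R b) u g -> mf (grd u b).
Proof.
move=> /wderivP [[mg _] _]; apply: measurable_funM => //; exact: measurable_wt.
Qed.

Lemma grdB_test u phi b : L2 mu u -> (exists g, is_wderiv (dir R b) u g) ->
  test_function phi ->
  grd (fun z => u z - phi z) b = (fun z => grd u b z - grad b phi z) %[ae mu] /\
  mf (grd (fun z => u z - phi z) b).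
Proof.
move=> Lu [g Hg] tphi.
have H := is_wderivB Lu (test_L2 tphi) (wderivP Hg) (is_wderiv_test b tphi).
split; last exact: measurable_grd H.
apply: (ae_imply (wderiv_ae H)) => z + zT => /(_ zT) E.
by rewrite /grd E mulrBr.
Qed.

Lemma sqrt3_le (a b c e : R) : 0 <= a -> 0 <= b -> 0 <= c ->
  Num.sqrt (a ^+ 2 + b ^+ 2 + c ^+ 2) <= e -> [/\ a <= e, b <= e & c <= e].
Proof.
move=> a0 b0 c0 H; split; apply: le_trans H.
- by rewrite -[leLHS](ger0_norm a0) -sqrtr_sqr ler_wsqrtr// -addrA lerDl addr_ge0 ?sqr_ge0.
- by rewrite -[leLHS](ger0_norm b0) -sqrtr_sqr ler_wsqrtr//
    [_ + b ^+ 2]addrC -addrA lerDl addr_ge0 ?sqr_ge0.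
- by rewrite -[leLHS](ger0_norm c0) -sqrtr_sqr ler_wsqrtr//
    lerDr addr_ge0 ?sqr_ge0.
Qed.

Lemma H1_L2 u : H1 alpha1 alpha2 u ->
  [/\ L2 mu u, forall b, exists g, is_wderiv (dir R b) u g &
      forall b, L2 mu (grd u b)].
Proof.
move=> [/L2P Lu ex1 ex2 /L2P L1 /L2P L2'].
split; [exact: Lu|by case; [exact: ex1|exact: ex2]|].
by case; [exact: L1|exact: L2'].
Qed.

Lemma normH1E v : L2 mu v -> (forall b, L2 mu (grd v b)) ->
  normH1 alpha1 alpha2 v =
  Num.sqrt (N2 mu v ^+ 2 + N2 mu (grd v true) ^+ 2 + N2 mu (grd v false) ^+ 2).
Proof.
move=> Lv Lg; rewrite /normH1; congr (Num.sqrt (_ ^+ 2 + _ ^+ 2 + _ ^+ 2)).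
- exact: L2_normE.
- exact: L2_normE (Lg true).
- exact: L2_normE (Lg false).
Qed.

(** Together with Wgraph_H10: H10 is the closure of the graph of the weighted
    gradient over the test functions. The graph closure is the easier side to
    prove membership in, as it does not mention weak derivatives. *)
Lemma H10_Wgraph u : H10 alpha1 alpha2 u -> Wgraph (fun=> True) u (grd u).
Proof.
move=> [/H1_L2 [Lu wu Lgu] ap]; split; [exact: Lu|exact: Lgu|move=> e e0].
have [phi tphi] := ap e e0; move=> /ltW.
have Lp := test_L2 tphi.
have Lb b := grdB_test Lu (wu b) tphi.
have Lgb b : L2 mu (fun z => grd u b z - grad b phi z).
  by apply: L2B => //; exact: grad_L2.
have Lgp b : L2 mu (grd (fun z => u z - phi z) b).
  apply: L2_ae (Lgb b); first exact: (Lb b).2.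
  by apply: (ae_imply (Lb b).1) => z + zT => /(_ zT).
rewrite (normH1E (L2B Lu Lp) Lgp).
have Eb b : N2 mu (grd (fun z => u z - phi z) b) =
    N2 mu (fun z => grd u b z - grad b phi z).
  apply: N2_ae; [by case: (Lgp b)|by case: (Lgb b)|exact: (Lb b).1].
rewrite [X in _ + _ + X ^+ 2]Eb [X in _ + X ^+ 2 + _]Eb.
move=> /sqrt3_le [||| h1 h2 h3]; try exact: N2_ge0.
exists phi; split; [by []|exact: tphi|by rewrite N2_sub_sym|].
by case; rewrite N2_sub_sym.
Qed.

Lemma Wgraph_H10 C u G : Wgraph C u G -> H10 alpha1 alpha2 u.
Proof.
move=> W; have [Lu LG ap] := W.
have wd b := Wgraph_is_wderiv b W.
have ae b := grd_ae_Wgraph b W.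
have Lgu b : L2 mu (grd u b).
  apply: L2_ae (LG b); first exact: measurable_grd (wd b).
  by apply: (ae_imply (ae b)) => z + zT => /(_ zT).
split.
  split; [exact/L2P| | | |].
  - by exists (fun z => G true z / wt true z); exact: (wd true).
  - by exists (fun z => G false z / wt false z); exact: (wd false).
  - by apply/L2P; exact: (Lgu true).
  - by apply/L2P; exact: (Lgu false).
move=> e e0; have e2 : 0 < e / 2 by rewrite divr_gt0.
have [phi [_ tphi p1 p2]] := ap _ e2.
exists phi => //.
have Lp := test_L2 tphi.
have wu b : exists g, is_wderiv (dir R b) u g by exists (fun z => G b z / wt b z).
have Lb b := grdB_test Lu (wu b) tphi.
have Lgb b : L2 mu (fun z => G b z - grad b phi z).
  by apply: L2B => //; exact: grad_L2.
have aeb b : grd (fun z => u z - phi z) b = (fun z => G b z - grad b phi z) %[ae mu].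
  apply: (ae_imply2 (ae b) (Lb b).1) => z h1 h2 zT.
  by rewrite (h2 zT) (h1 zT).
have Lgp b : L2 mu (grd (fun z => u z - phi z) b).
  apply: L2_ae (Lgb b); first exact: (Lb b).2.
  by apply: (ae_imply (aeb b)) => z + zT => /(_ zT).
rewrite (normH1E (L2B Lu Lp) Lgp).
have Eb b : N2 mu (grd (fun z => u z - phi z) b) =
    N2 mu (fun z => G b z - grad b phi z).
  apply: N2_ae; [by case: (Lgp b)|by case: (Lgb b)|exact: aeb].
rewrite [X in _ + _ + X ^+ 2]Eb [X in _ + X ^+ 2 + _]Eb.
rewrite [X in X ^+ 2 + _ + _]N2_sub_sym [X in _ + _ + X ^+ 2]N2_sub_sym
  [X in _ + X ^+ 2 + _]N2_sub_sym.
have := p2 true; have := p2 false; move: p1.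
have := N2_ge0 mu (fun z => phi z - u z).
have := N2_ge0 mu (fun z => grad true phi z - G true z).
have := N2_ge0 mu (fun z => grad false phi z - G false z).
move: (N2 _ _) (N2 _ _) (N2 _ _) => a b c c0 b0 a0 ae' ce be.
rewrite -[ltRHS](ger0_norm (ltW e0)) -sqrtr_sqr ltr_sqrt ?exprn_gt0//.
nra.
Qed.

End GraphClosure.

#[global] Opaque grad grd.

(** * Limits of test functions of bounded energy *)

Lemma half_small (R : realType) (e : R) : 0 < e ->
  exists k, forall n, (k <= n)%N -> 2^-1 ^+ n <= e.
Proof.
move=> e0; have h : `|2^-1 : R| < 1 by rewrite ger0_norm//; lra.
have /cvgrPdist_le H := cvg_expr h; have [k _ Hk] := H _ e0.
exists k => n /Hk /=; rewrite sub0r normrN ger0_norm//.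
Qed.

Lemma cvg_sqr (R : realType) (x : nat -> R) (l : R) :
  x @ \oo --> l -> (fun n => x n ^+ 2) @ \oo --> l ^+ 2.
Proof. by move=> xl; rewrite expr2; under eq_fun do rewrite expr2; exact: cvgM. Qed.

Section NestedMinimisation.
Context (R : realType) (X : Type).

(** Almost minimizers of a functional over a decreasing sequence of sets that
    are stable under mid. The midpoint of two late ones cannot fall below the
    limit d of the infima, so that the midpoint defect tends to 0; for a strictly
    convex functional the sequence is then Cauchy. *)
Lemma nested_min (K : nat -> X -> Prop) (Phi : X -> R) (mid : X -> X -> X) (B : R) :
  (forall n x, K n.+1 x -> K n x) ->
  (forall n (e : R), 0 < e -> exists2 x, K n x & Phi x <= B + e) ->
  (forall x, 0 <= Phi x) ->
  (forall n x y, K n x -> K n y -> K n (mid x y)) ->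
  exists x : nat -> X, exists d : R, [/\ forall n, K n (x n), d <= B,
    forall e : R, 0 < e -> exists N, forall n, (N <= n)%N -> `|Phi (x n) - d| <= e &
    forall e : R, 0 < e -> exists N, forall n m, (N <= n)%N -> (N <= m)%N ->
      2^-1 * Phi (x n) + 2^-1 * Phi (x m) - Phi (mid (x n) (x m)) <= e].
Proof.
move=> Kdecr KB Phi0 Kmid.
have Khom n m x : (n <= m)%N -> K m x -> K n x.
  by move/subnK <-; elim: (m - n)%N => [//|k IH] /Kdecr.
pose S n := [set Phi x | x in K n].
have lbS n : lbound (S n) 0 by move=> _ [x _ <-].
have S0 n : S n !=set0.
  by have [x Kx _] := KB n 1 ltr01; exists (Phi x), x.
have iS n : has_inf (S n) by split; [exact: S0|exists 0; exact: lbS].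
pose dn n := inf (S n).
have dle n x : K n x -> dn n <= Phi x.
  by move=> Kx; apply: ge_inf; [exists 0; exact: lbS|exists x].
have dB n : dn n <= B.
  apply/ler_addgt0Pr => e e0; have [x Kx xB] := KB n e e0.
  exact: le_trans (dle _ _ Kx) xB.
have dhom : {homo dn : n m / (n <= m)%N >-> n <= m}.
  move=> n m nm; apply: lb_le_inf; first exact: S0.
  by move=> _ [x Kx <-]; apply: dle; exact: Khom Kx.
pose d := sup (range dn).
have hs : has_sup (range dn).
  by split; [exists (dn 0%N), 0%N|exists B => _ [n _ <-]].
have dnd n : dn n <= d by apply: ub_le_sup; [case: hs|exists n].
have dd : d <= B by apply: ge_sup; [case: hs|move=> _ [n _ <-]].
have half_gt0 n : 0 < (2^-1 : R) ^+ n by rewrite exprn_gt0.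
have Hx n : exists x, K n x /\ Phi x <= dn n + 2^-1 ^+ n.
  have [_ [x Kx <-] h] := inf_adherent (half_gt0 n) (iS n).
  by exists x; split=> //; exact: ltW.
have [x /all_and2 [Kx Px]] := choice Hx.
have conv (e : R) : 0 < e -> exists N, d - dn N <= e /\ 2^-1 ^+ N <= e.
  move=> e0; have [_ [n _ <-] h] := sup_adherent e0 hs.
  have [k Hk] := half_small e0; exists (maxn n k); split.
    by have := dhom _ _ (leq_maxl n k); move: h; rewrite -/d; lra.
  exact: Hk (leq_maxr n k).
have half_hom n m : (n <= m)%N -> 2^-1 ^+ m <= (2^-1 : R) ^+ n.
  by move=> nm; apply: ler_wiXn2l => //; lra.
exists x, d; split=> // e e0.
- have [N [h1 h2]] := conv e e0; exists N => n Nn.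
  have := dhom _ _ Nn; have := Px n; have := dle _ _ (Kx n); have := dnd n.
  have := half_hom _ _ Nn.
  by rewrite ler_norml; move=> *; apply/andP; split; lra.
- have e2 : 0 < e / 2 by rewrite divr_gt0.
  have [N [h1 h2]] := conv _ e2; exists N => n m Nn Nm.
  have := Px n; have := Px m; have := dnd n; have := dnd m.
  have := half_hom _ _ Nn; have := half_hom _ _ Nm.
  have := dle N _ (Kmid N _ _ (Khom _ _ _ Nn (Kx n)) (Khom _ _ _ Nm (Kx m))).
  lra.
Qed.
End NestedMinimisation.

Section WeakLimits.
Context (R : realType) (alpha1 alpha2 : R).
Hypotheses (alpha1_gt0 : 0 < alpha1) (alpha2_gt0 : 0 < alpha2).
Local Notation T := (measurableTypeR R * measurableTypeR R)%type.
Local Notation mf f := (measurable_fun [set: T] f).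
Local Notation mu := (muO R).
Local Notation grad := (grad alpha1 alpha2).
Local Notation grd := (grd alpha1 alpha2).
Local Notation H10 := (H10 alpha1 alpha2).
Local Notation aform := (aform alpha1 alpha2).
Local Notation Wgraph := (Wgraph alpha1 alpha2).
Implicit Types (f g u v phi psi : R * R -> R) (G : bool -> R * R -> R)
  (C : (R * R -> R) -> Prop).

Definition Et phi : R := N2 mu (grad true phi) ^+ 2 + N2 mu (grad false phi) ^+ 2.

Lemma EtE phi : Et phi = N2 mu (grad true phi) ^+ 2 + N2 mu (grad false phi) ^+ 2.
Proof. by []. Qed.

Lemma N2_limit (f : nat -> R * R -> R) g (B : R) : (forall n, L2 mu (f n)) -> L2 mu g ->
  (forall e : R, 0 < e -> exists N, forall n, (N <= n)%N ->
     N2 mu (fun z => f n z - g z) <= e) ->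
  (fun n => N2 mu (f n)) @ \oo --> N2 mu g.
Proof.
move=> Lf Lg H; apply/cvgrPdist_le => e e0; have [N HN] := H e e0.
exists N => // n /= Nn; apply: le_trans (HN _ Nn).
have h1 := N2_dist (Lf n) Lg; have := N2_dist Lg (Lf n).
rewrite [X in _ <= _ + X]N2_sub_sym => h2.
by rewrite ler_norml; apply/andP; split; lra.
Qed.

(** This plays the part of weak compactness. Among the test functions of class C
    at distance 2^-n from u, pick almost minimizers of Et; by the parallelogram
    identity the midpoint defect of Et is the squared distance of the gradients,
    which are then Cauchy. Their limit is the weighted gradient of u, and it
    inherits the bound E0. *)
Lemma weak_limit C u (E0 : R) : L2 mu u ->
  (forall phi psi, C phi -> C psi -> C (fun z => 2^-1 * phi z + 2^-1 * psi z)) ->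
  (forall e : R, 0 < e -> exists phi, [/\ C phi, test_function phi,
     N2 mu (fun z => phi z - u z) <= e & Et phi <= E0 + e]) ->
  exists2 G, Wgraph C u G & N2 mu (G true) ^+ 2 + N2 mu (G false) ^+ 2 <= E0.
Proof.
move=> Lu Cmid H.
have half_gt0 n : 0 < (2^-1 : R) ^+ n by rewrite exprn_gt0.
pose K n phi := [/\ C phi, test_function phi & N2 mu (fun z => phi z - u z) <= 2^-1 ^+ n].
pose mid phi psi : R * R -> R := fun z => 2^-1 * phi z + 2^-1 * psi z.
have mid_test phi psi : test_function phi -> test_function psi -> test_function (mid phi psi).
  by move=> t1 t2; apply: testD; exact: testZ.
have [||||phi [d [Kphi dE0 Pd Pm]]] := @nested_min _ _ K Et mid E0.
- move=> n phi [Cphi tphi h]; split; [exact: Cphi|exact: tphi|apply: le_trans h _].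
  by apply: ler_wiXn2l => //; lra.
- move=> n e e0; have m0 : 0 < Num.min e (2^-1 ^+ n) by rewrite lt_min e0 half_gt0.
  have [phi [Cphi tphi h1 h2]] := H _ m0; exists phi.
    split; [exact: Cphi|exact: tphi|apply: le_trans h1 _].
    by rewrite ge_min lexx orbT.
  by apply: le_trans h2 _; rewrite lerD2l ge_min lexx.
- by move=> phi; rewrite addr_ge0// sqr_ge0.
- move=> n phi psi [C1 t1 h1] [C2 t2 h2].
  split; [exact: Cmid|exact: mid_test|].
  have E : (fun z => mid phi psi z - u z) =
     (fun z => 2^-1 * (phi z - u z) + 2^-1 * (psi z - u z)).
    by apply/funext => z; rewrite /mid; field.
  have L1 := L2B (test_L2 t1) Lu; have L2' := L2B (test_L2 t2) Lu.
  rewrite E; apply: le_trans (N2D (L2Z 2^-1 L1) (L2Z 2^-1 L2')) _.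
  rewrite [X in X + _]N2Z// [X in _ + X]N2Z// ger0_norm//.
  lra.
have tphi n : test_function (phi n) by case: (Kphi n).
have Lg n b : L2 mu (grad b (phi n)) by exact: grad_L2.
have PE n m : N2 mu (fun z => grad true (phi n) z - grad true (phi m) z) ^+ 2 +
    N2 mu (fun z => grad false (phi n) z - grad false (phi m) z) ^+ 2 =
    4 * (2^-1 * Et (phi n) + 2^-1 * Et (phi m) - Et (mid (phi n) (phi m))).
  have gm b : (fun z => (grad b (phi n) z + grad b (phi m) z) / 2) =
      grad b (mid (phi n) (phi m)).
    apply/funext => z; rewrite grad_lin//.
    by rewrite mulrDl ![_ / 2]mulrC.
  rewrite [X in X + _]N2_parallelogram// [X in _ + X]N2_parallelogram//.
  rewrite /Et -(gm true) -(gm false).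
  have aux (a b c a' b' c' : R) : 2 * a + 2 * b - 4 * c + (2 * a' + 2 * b' - 4 * c') =
    4 * (2^-1 * (a + a') + 2^-1 * (b + b') - (c + c')) by field.
  exact: aux.
have Cauchy b (e : R) : 0 < e -> exists n0, forall n m, (n0 <= n)%N -> (n0 <= m)%N ->
    N2 mu (fun z => grad b (phi n) z - grad b (phi m) z) <= e.
  move=> e0; have e2 : 0 < e ^+ 2 / 4 by rewrite divr_gt0 ?exprn_gt0.
  have [N HN] := Pm _ e2; exists N => n m Nn Nm.
  rewrite -(@ler_pXn2r _ 2) ?nnegrE ?N2_ge0 ?(ltW e0)//.
  have aux (D : bool -> R) X : D true ^+ 2 + D false ^+ 2 = 4 * X ->
      X <= e ^+ 2 / 4 -> D b ^+ 2 <= e ^+ 2.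
    have := sqr_ge0 (D true); have := sqr_ge0 (D false).
    by case: b; lra.
  exact: (aux (fun b => N2 mu (fun z => grad b (phi n) z - grad b (phi m) z)) _
    (PE n m) (HN _ _ Nn Nm)).
have lim b := L2_complete (muO_fin R) (fun n => Lg n b) (Cauchy b).
have HG (b : bool) : exists G : R * R -> R, L2 mu G /\ forall e : R, 0 < e -> exists n0,
    forall n, (n0 <= n)%N -> N2 mu (fun z => grad b (phi n) z - G z) <= e.
  by have [G LG HG] := lim b; exists G.
have [G /all_and2 [LG GP]] := choice HG.
exists G.
  split; [exact: Lu|exact: LG|move=> e e0].
  have [N1 H1] := GP true e e0; have [N2' H2] := GP false e e0.
  have [k Hk] := half_small e0; pose n := maxn k (maxn N1 N2'); have [Cn tn pn] := Kphi n.
  exists (phi n); split; [exact: Cn|exact: tn| |].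
    exact: le_trans pn (Hk n (leq_maxl _ _)).
  case.
  - by apply: H1; rewrite /n (leq_trans (leq_maxl N1 N2'))// leq_maxr.
  - by apply: H2; rewrite /n (leq_trans (leq_maxr N1 N2'))// leq_maxr.
apply: le_trans dE0.
have c1 := N2_limit 0 (fun n => Lg n true) (LG true) (GP true).
have c2 := N2_limit 0 (fun n => Lg n false) (LG false) (GP false).
have c : (fun n => Et (phi n)) @ \oo --> N2 mu (G true) ^+ 2 + N2 mu (G false) ^+ 2.
  exact: (cvgD (cvg_sqr c1) (cvg_sqr c2)).
rewrite le_eqVlt; apply/orP; left; apply/eqP.
apply: (cvg_unique (@Rhausdorff R) c).
apply/cvgrPdist_le => e e0; have [N HN] := Pd e e0.
by exists N => // n /= Nn; rewrite distrC; exact: HN.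
Qed.

End WeakLimits.

(** * The bilinear form on H10 *)

Section H10Structure.
Context (R : realType) (alpha1 alpha2 : R).
Hypotheses (alpha1_gt0 : 0 < alpha1) (alpha2_gt0 : 0 < alpha2).
Local Notation T := (measurableTypeR R * measurableTypeR R)%type.
Local Notation mf f := (measurable_fun [set: T] f).
Local Notation mu := (muO R).
Local Notation grad := (grad alpha1 alpha2).
Local Notation grd := (grd alpha1 alpha2).
Local Notation H10 := (H10 alpha1 alpha2).
Local Notation aform := (aform alpha1 alpha2).
Local Notation Wgraph := (Wgraph alpha1 alpha2).
Local Notation Et := (Et alpha1 alpha2).
Local Notation near_graph := (near_graph alpha1 alpha2).
Implicit Types (f g u v w phi psi : R * R -> R) (G : bool -> R * R -> R)
  (C : (R * R -> R) -> Prop).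

Lemma H10_L2 u : H10 u -> L2 mu u.
Proof. by case=> /H1_L2[]. Qed.

Lemma H10_grd_L2 u b : H10 u -> L2 mu (grd u b).
Proof. by case=> /H1_L2[_ _ H] _. Qed.

Lemma N2_eq f g : f =1 g -> N2 mu f = N2 mu g.
Proof. by move=> /funext ->. Qed.

Lemma N2_cst1 : N2 mu (cst 1) = 1.
Proof.
rewrite /N2; under eq_Rintegral do rewrite /= expr1n.
by rewrite Rintegral_cst// mul1r muOT sqrtr1.
Qed.

Lemma Wgraph_test C phi : C phi -> test_function phi ->
  Wgraph C phi (fun b => grad b phi).
Proof.
move=> Cphi tphi; split; first exact: test_L2.
  by move=> b; exact: grad_L2.
move=> e e0; exists phi; split; [exact: Cphi|exact: tphi| |].
  rewrite (@N2_eq _ (cst 0)) ?N2_0 ?ltW// => z; exact: subrr.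
move=> b; rewrite (@N2_eq _ (cst 0)) ?N2_0 ?ltW// => z; exact: subrr.
Qed.

Lemma H10_test phi : test_function phi -> H10 phi.
Proof.
move=> tphi; have W : Wgraph (fun=> True) phi (fun b => grad b phi).
  exact: Wgraph_test.
exact: Wgraph_H10 W.
Qed.

Lemma grd_test phi b : test_function phi -> grd phi b = grad b phi %[ae mu].
Proof.
move=> tphi; have W : Wgraph (fun=> True) phi (fun b => grad b phi).
  exact: Wgraph_test.
exact: grd_ae_Wgraph W.
Qed.

Lemma Wgraph_lin u v (c d : R) : H10 u -> H10 v ->
  Wgraph (fun=> True) (fun z => c * u z + d * v z)
    (fun b z => c * grd u b z + d * grd v b z).
Proof.
move=> Hu Hv; have [Lu LGu apu] := H10_Wgraph alpha1_gt0 alpha2_gt0 Hu.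
have [Lv LGv apv] := H10_Wgraph alpha1_gt0 alpha2_gt0 Hv.
split; first by apply: L2D; exact: L2Z.
  by move=> b; apply: L2D; exact: L2Z.
move=> e e0; pose A := `|c| + `|d| + 1.
have A0 : 0 < A by rewrite ltr_wpDl// addr_ge0.
have e1 : 0 < e / A by rewrite divr_gt0.
have [phi [_ tphi p1 p2]] := apu _ e1; have [psi [_ tpsi q1 q2]] := apv _ e1.
have key f f' g g' : L2 mu f -> L2 mu f' -> L2 mu g -> L2 mu g' ->
    N2 mu (fun z => f z - f' z) <= e / A -> N2 mu (fun z => g z - g' z) <= e / A ->
    N2 mu (fun z => (c * f z + d * g z) - (c * f' z + d * g' z)) <= e.
  move=> Lf Lf' Lg Lg' h1 h2.
  rewrite (@N2_eq _ (fun z => c * (f z - f' z) + d * (g z - g' z))).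
    have L1 := L2B Lf Lf'; have L2' := L2B Lg Lg'.
    apply: le_trans (N2D (L2Z c L1) (L2Z d L2')) _.
    rewrite [X in X + _]N2Z// [X in _ + X]N2Z//.
    apply: (@le_trans _ _ ((`|c| + `|d|) * (e / A))).
      by rewrite mulrDl lerD// ler_wpM2l.
    rewrite mulrC -[leRHS](divfK (x := A)) ?gt_eqF//.
    by rewrite ler_wpM2l ?(ltW e1)// lerDl.
  by move=> z; ring.
exists (fun z => c * phi z + d * psi z); split=> //.
- by apply: testD; exact: testZ.
- by apply: key => //; exact: test_L2.
- move=> b; rewrite (@N2_eq _ (fun z => (c * grad b phi z + d * grad b psi z)
    - (c * grd u b z + d * grd v b z))).
    by apply: key; [exact: grad_L2|exact: LGu|exact: grad_L2|exact: LGv|exact: p2|exact: q2].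
  by move=> z; rewrite grad_lin.
Qed.

Lemma H10_lin u v c d : H10 u -> H10 v -> H10 (fun z => c * u z + d * v z).
Proof.
move=> Hu Hv; have W := Wgraph_lin c d Hu Hv; exact: Wgraph_H10 W.
Qed.

Lemma grd_lin u v c d b : H10 u -> H10 v ->
  grd (fun z => c * u z + d * v z) b = (fun z => c * grd u b z + d * grd v b z) %[ae mu].
Proof.
move=> Hu Hv; have W := Wgraph_lin c d Hu Hv.
exact: (grd_ae_Wgraph _ _ b W).
Qed.

Definition ip u v b : R := \int[mu]_z (grd u b z * grd v b z).

Lemma ipE u v b : ip u v b = \int[mu]_z (grd u b z * grd v b z).
Proof. by []. Qed.

#[global] Opaque ip.

Lemma aformE u v : H10 u -> H10 v -> aform u v = ip u v true + ip u v false.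
Proof.
move=> Hu Hv.
rewrite !ipE -intD; [|by apply: L2M; exact: H10_grd_L2|by apply: L2M; exact: H10_grd_L2].
by rewrite /Defs.aform; congr Rintegral; apply/funext => z; rewrite !grdE.
Qed.

Lemma ip_sqr u b : ip u u b = N2 mu (grd u b) ^+ 2.
Proof. by rewrite N2_sqr ipE; congr Rintegral; apply/funext => z; rewrite expr2. Qed.

Lemma aform_sqr u : H10 u ->
  aform u u = N2 mu (grd u true) ^+ 2 + N2 mu (grd u false) ^+ 2.
Proof.
by move=> Hu; rewrite (aformE Hu Hu); rewrite (ip_sqr u true) (ip_sqr u false).
Qed.

Lemma aform_ge0 u : H10 u -> 0 <= aform u u.
Proof. by move=> Hu; rewrite aform_sqr// addr_ge0// sqr_ge0. Qed.

Lemma ip_sym u v b : ip u v b = ip v u b.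
Proof. by rewrite !ipE; congr Rintegral; apply/funext => z; rewrite mulrC. Qed.

Lemma aform_sym u v : H10 u -> H10 v -> aform u v = aform v u.
Proof.
move=> Hu Hv; rewrite (aformE Hu Hv) (aformE Hv Hu).
by rewrite (ip_sym u v true) (ip_sym u v false).
Qed.

Lemma ip_linl u v w c d b : H10 u -> H10 v -> H10 w ->
  ip (fun z => c * u z + d * v z) w b = c * ip u w b + d * ip v w b.
Proof.
move=> Hu Hv Hw.
have Lu := H10_grd_L2 b Hu; have Lv := H10_grd_L2 b Hv; have Lw := H10_grd_L2 b Hw.
have Ll := H10_grd_L2 b (H10_lin c d Hu Hv).
rewrite !ipE.
transitivity (\int[mu]_z (c * (grd u b z * grd w b z) + d * (grd v b z * grd w b z))).
  apply: int_ae.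
  - by apply: measurable_funM; [case: Ll|case: Lw].
  - apply: (intble_measurable (mu := mu)).
    by apply: intbleD; apply: intbleZ; [exact: L2M Lu Lw|exact: L2M Lv Lw].
  - apply: (ae_imply (grd_lin c d b Hu Hv)) => z + zT => /(_ zT) ->.
    by rewrite mulrDl !mulrA.
have i1 := L2M Lu Lw; have i2 := L2M Lv Lw.
rewrite intD; [|exact: intbleZ|exact: intbleZ].
by rewrite (intZ c i1) (intZ d i2).
Qed.

Lemma aform_linl u v w c d : H10 u -> H10 v -> H10 w ->
  aform (fun z => c * u z + d * v z) w = c * aform u w + d * aform v w.
Proof.
move=> Hu Hv Hw; have Hl := H10_lin c d Hu Hv.
rewrite (aformE Hl Hw) (aformE Hu Hw) (aformE Hv Hw) (ip_linl c d true Hu Hv Hw)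
  (ip_linl c d false Hu Hv Hw).
have aux (a b e f : R) : c * a + d * b + (c * e + d * f) = c * (a + e) + d * (b + f).
  by ring.
exact: aux.
Qed.

Lemma aform_lin2 u v c d : H10 u -> H10 v ->
  aform (fun z => c * u z + d * v z) (fun z => c * u z + d * v z) =
  c ^+ 2 * aform u u + 2 * c * d * aform u v + d ^+ 2 * aform v v.
Proof.
move=> Hu Hv; have Hl := H10_lin c d Hu Hv.
rewrite (aform_linl c d Hu Hv Hl) (aform_sym Hu Hl) (aform_sym Hv Hl).
rewrite (aform_linl c d Hu Hv Hu) (aform_linl c d Hu Hv Hv) (aform_sym Hv Hu).
have aux (a b e : R) : c * (c * a + d * b) + d * (c * b + d * e) =
  c ^+ 2 * a + 2 * c * d * b + d ^+ 2 * e by ring.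
exact: aux.
Qed.

Lemma aformZ u c : H10 u -> aform (fun z => c * u z) (fun z => c * u z) = c ^+ 2 * aform u u.
Proof.
move=> Hu; have := aform_lin2 c 0 Hu Hu.
rewrite mulr0 mul0r addr0 expr0n/= mul0r addr0.
by have -> : (fun z => c * u z + 0 * u z) = (fun z => c * u z)
  by apply/funext => z; rewrite mul0r addr0.
Qed.

Lemma H10Z u c : H10 u -> H10 (fun z => c * u z).
Proof.
move=> Hu; have := H10_lin c 0 Hu Hu.
by have -> : (fun z => c * u z + 0 * u z) = (fun z => c * u z)
  by apply/funext => z; rewrite mul0r addr0.
Qed.

Lemma near_graph_Et C v (e : R) : H10 v -> near_graph C v (grd v) -> 0 < e ->
  exists phi, [/\ C phi, test_function phi,
     N2 mu (fun z => phi z - v z) <= e & Et phi <= aform v v + e].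
Proof.
move=> Hv ap e0; pose A := 2 * N2 mu (grd v true) + 2 * N2 mu (grd v false) + 2.
have A0 : 0 < A by rewrite ltr_wpDl// addr_ge0// mulr_ge0// N2_ge0.
pose e1 := Num.min 1 (Num.min e (e / A)).
have e10 : 0 < e1 by rewrite !lt_min ltr01 e0 divr_gt0.
have e1e : e1 <= e by rewrite !ge_min lexx orbT.
have e1A : e1 * A <= e by rewrite -ler_pdivlMr// !ge_min lexx !orbT.
have e11 : e1 <= 1 by rewrite ge_min lexx.
have [phi [Cphi tphi p1 p2]] := ap _ e10.
exists phi; split; [exact: Cphi|exact: tphi|exact: le_trans e1e|].
rewrite aform_sqr// EtE.
have h b : N2 mu (grad b phi) <= N2 mu (grd v b) + e1.
  have := N2_dist (grad_L2 alpha1_gt0 alpha2_gt0 b tphi) (H10_grd_L2 b Hv).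
  by move/le_trans; apply; rewrite lerD2l.
have aux (a b a' b' : R) : 0 <= a -> 0 <= b -> 0 <= a' -> 0 <= b' ->
    a' <= a + e1 -> b' <= b + e1 -> e1 * (2 * a + 2 * b + 2) <= e ->
    a' ^+ 2 + b' ^+ 2 <= a ^+ 2 + b ^+ 2 + e.
  move=> a0 b0 a'0 b'0 ha hb hA.
  have ha2 : a' ^+ 2 <= (a + e1) ^+ 2 by rewrite lerXn2r ?nnegrE// addr_ge0// ltW.
  have hb2 : b' ^+ 2 <= (b + e1) ^+ 2 by rewrite lerXn2r ?nnegrE// addr_ge0// ltW.
  nra.
by apply: aux; [exact: N2_ge0|exact: N2_ge0|exact: N2_ge0|exact: N2_ge0|exact: h|exact: h|
  exact: e1A].
Qed.

Lemma H10_approx v (e : R) : H10 v -> 0 < e ->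
  exists phi, [/\ test_function phi,
     N2 mu (fun z => phi z - v z) <= e & Et phi <= aform v v + e].
Proof.
move=> Hv e0; have [_ _ ap] := H10_Wgraph alpha1_gt0 alpha2_gt0 Hv.
have [phi [_ tphi h1 h2]] := near_graph_Et Hv ap e0.
by exists phi; split; [exact: tphi|exact: h1|exact: h2].
Qed.

Lemma weak_limit_aform C u (E0 : R) : L2 mu u ->
  (forall phi psi, C phi -> C psi -> C (fun z => 2^-1 * phi z + 2^-1 * psi z)) ->
  (forall e : R, 0 < e -> exists phi, [/\ C phi, test_function phi,
     N2 mu (fun z => phi z - u z) <= e & Et phi <= E0 + e]) ->
  H10 u /\ aform u u <= E0.
Proof.
move=> Lu Cmid H; have [G W GE] := weak_limit alpha1_gt0 alpha2_gt0 Lu Cmid H.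
have Hu : H10 u by exact: Wgraph_H10 W.
split=> //; rewrite aform_sqr//; have [_ LG _] := W.
have E b : N2 mu (grd u b) = N2 mu (G b).
  apply: N2_ae; [by case: (H10_grd_L2 b Hu)|by case: (LG b)|exact: (grd_ae_Wgraph _ _ b W)].
have aux (a b a' b' : R) : a = a' -> b = b' -> a' ^+ 2 + b' ^+ 2 <= E0 ->
    a ^+ 2 + b ^+ 2 <= E0 by move=> -> ->.
exact: aux (E true) (E false) GE.
Qed.

(** Elements of H10 can serve as approximants in weak_limit_aform, since each is
    close to a test function of nearly the same energy. *)
Lemma weak_limit_H10 u (E0 : R) : L2 mu u ->
  (forall e : R, 0 < e -> exists v, [/\ H10 v,
     N2 mu (fun z => v z - u z) <= e & aform v v <= E0 + e]) ->
  H10 u /\ aform u u <= E0.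
Proof.
move=> Lu H; apply: (@weak_limit_aform (fun=> True)) => // e e0.
have e2 : 0 < e / 2 by rewrite divr_gt0.
have [v [Hv h1 h2]] := H _ e2; have [phi [tphi h3 h4]] := H10_approx Hv e2.
exists phi; split=> //; last first.
  apply: le_trans h4 _; apply: le_trans (lerD h2 (lexx (e / 2))) _.
  by rewrite -addrA -splitr.
apply: le_trans (N2_triangle (test_L2 tphi) (H10_L2 Hv) Lu) _.
by rewrite [leRHS]splitr; exact: lerD.
Qed.

End H10Structure.

(** * Nonlinear operations that decrease the energy *)

Section PointwiseComparison.
Context d (T : measurableType d) (R : realType).
Variable mu : {measure set T -> \bar R}.
Implicit Types (f g h : T -> R).

Lemma N2_sqr_leD f g h : L2 mu f -> L2 mu g -> L2 mu h ->
  (forall x, f x ^+ 2 <= g x ^+ 2 + h x ^+ 2) ->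
  N2 mu f ^+ 2 <= N2 mu g ^+ 2 + N2 mu h ^+ 2.
Proof.
move=> [_ fi] [_ gi] [_ hi] H; rewrite !N2_sqr -intD//.
by apply: int_le => //; exact: intbleD.
Qed.

Lemma N2_sqr_le f g : L2 mu f -> L2 mu g ->
  (forall x, f x ^+ 2 <= g x ^+ 2) -> N2 mu f ^+ 2 <= N2 mu g ^+ 2.
Proof. by move=> [_ fi] [_ gi] H; rewrite !N2_sqr; exact: int_le. Qed.

End PointwiseComparison.

Section Operations.
Context (R : realType) (alpha1 alpha2 : R).
Hypotheses (alpha1_gt0 : 0 < alpha1) (alpha2_gt0 : 0 < alpha2).
Local Notation T := (measurableTypeR R * measurableTypeR R)%type.
Local Notation mf f := (measurable_fun [set: T] f).
Local Notation mu := (muO R).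
Local Notation grad := (grad alpha1 alpha2).
Local Notation grd := (grd alpha1 alpha2).
Local Notation H10 := (H10 alpha1 alpha2).
Local Notation aform := (aform alpha1 alpha2).
Local Notation Et := (Et alpha1 alpha2).
Local Notation near_graph := (near_graph alpha1 alpha2).
Implicit Types (f g u v phi psi : R * R -> R).

Lemma DM b f g (z : R * R) : smooth f -> smooth g ->
  'D_(dir R b) (fun w : R * R => f w * g w) z = 'D_(dir R b) f z * g z + f z * 'D_(dir R b) g z.
Proof. by case: b; [exact: DxM|exact: DyM]. Qed.

Lemma D_sqr b f (z : R * R) : smooth f ->
  'D_(dir R b) (fun w : R * R => f w ^+ 2) z = 2 * f z * 'D_(dir R b) f z.
Proof. by move=> sf; rewrite (DM b z sf sf); ring. Qed.

Lemma D_addc b f (c : R) (z : R * R) : smooth f ->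
  'D_(dir R b) (fun w : R * R => c + f w) z = 'D_(dir R b) f z.
Proof.
move=> sf; have [_] := is_derive_add (is_derive_cst c z (dir R b)) (smooth_is_dir b z sf).
by rewrite add0r.
Qed.

Lemma D_add b f g (z : R * R) : smooth f -> smooth g ->
  'D_(dir R b) (fun w : R * R => f w + g w) z = 'D_(dir R b) f z + 'D_(dir R b) g z.
Proof.
by move=> sf sg; have [_] := is_derive_add (smooth_is_dir b z sf) (smooth_is_dir b z sg).
Qed.

Lemma Et_le2 h phi psi : test_function h -> test_function phi -> test_function psi ->
  (forall b z, grad b h z ^+ 2 <= grad b phi z ^+ 2 + grad b psi z ^+ 2) ->
  Et h <= Et phi + Et psi.
Proof.
move=> th tp tq H.
have K b : N2 mu (grad b h) ^+ 2 <= N2 mu (grad b phi) ^+ 2 + N2 mu (grad b psi) ^+ 2.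
  by apply: N2_sqr_leD; [exact: grad_L2|exact: grad_L2|exact: grad_L2|exact: H].
have aux (a b c a' b' c' : R) : a <= b + c -> a' <= b' + c' ->
  a + a' <= (b + b') + (c + c') by lra.
exact: aux (K true) (K false).
Qed.

Lemma Et_le1 h phi : test_function h -> test_function phi ->
  (forall b z, grad b h z ^+ 2 <= grad b phi z ^+ 2) -> Et h <= Et phi.
Proof.
move=> th tp H.
have K b : N2 mu (grad b h) ^+ 2 <= N2 mu (grad b phi) ^+ 2.
  by apply: N2_sqr_le; [exact: grad_L2|exact: grad_L2|exact: H].
exact: lerD (K true) (K false).
Qed.

(** Addition of functions in the square variable u^2. *)
Definition hypot (u v : R * R -> R) (z : R * R) : R := Num.sqrt (u z ^+ 2 + v z ^+ 2).

(** The shift by eta makes the square root smooth, and the subtraction restores a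
    compact support. *)
Definition hypot_reg (eta : R) (u v : R * R -> R) (z : R * R) : R :=
  Num.sqrt (eta ^+ 2 + (u z ^+ 2 + v z ^+ 2)) - eta.

Lemma hypot_sqr u v z : hypot u v z ^+ 2 = u z ^+ 2 + v z ^+ 2.
Proof. by rewrite sqr_sqrtr// addr_ge0// sqr_ge0. Qed.

Lemma hypot_reg_ge0 eta u v z : 0 < eta -> 0 <= hypot_reg eta u v z.
Proof.
move=> e0; rewrite subr_ge0 -[leLHS](ger0_norm (ltW e0)) -sqrtr_sqr.
by rewrite ler_wsqrtr// lerDl addr_ge0// sqr_ge0.
Qed.

Section regularised.
Variables (eta : R) (phi psi : R * R -> R).
Hypotheses (eta_gt0 : 0 < eta) (tp : test_function phi) (tq : test_function psi).
Let S z := Num.sqrt (eta ^+ 2 + (phi z ^+ 2 + psi z ^+ 2)).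
Let sp := test_smooth tp.
Let sq := test_smooth tq.
Let sG : smooth (fun z => eta ^+ 2 + (phi z ^+ 2 + psi z ^+ 2)).
Proof.
by apply: smoothD; [exact: smooth_cst|apply: smoothD; exact: smooth_sqr].
Qed.
Let G0 z : 0 < eta ^+ 2 + (phi z ^+ 2 + psi z ^+ 2).
Proof. by rewrite ltr_pwDl ?exprn_gt0// addr_ge0// sqr_ge0. Qed.
Let sS : smooth S. Proof. by apply: smooth_sqrt sG G0. Qed.

Lemma test_hypot_reg : test_function (hypot_reg eta phi psi).
Proof.
apply: (test_dominated tp tq).
  by apply: smoothB => //; exact: smooth_cst.
move=> z p0 q0; rewrite /hypot_reg p0 q0 expr0n/= addr0 addr0 sqrtr_sqr.
by rewrite gtr0_norm// subrr.
Qed.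

(** Cauchy--Schwarz applied to S DS = phi D phi + psi D psi, with
    S^2 >= phi^2 + psi^2. *)
Lemma grad_hypot_reg b z :
  grad b (hypot_reg eta phi psi) z ^+ 2 <= grad b phi z ^+ 2 + grad b psi z ^+ 2.
Proof.
rewrite !gradE !exprMn -mulrDr ler_wpM2l ?sqr_ge0//.
have -> : 'D_(dir R b) (hypot_reg eta phi psi) z = 'D_(dir R b) S z.
  have [_ E] := is_derive_add (smooth_is_dir b z sS) (is_derive_cst (- eta) z (dir R b)).
  by rewrite addr0 in E.
have S0 : 0 < S z by rewrite sqrtr_gt0.
have SE : S z ^+ 2 = eta ^+ 2 + (phi z ^+ 2 + psi z ^+ 2) by rewrite sqr_sqrtr// ltW.
have : S z * 'D_(dir R b) S z = phi z * 'D_(dir R b) phi z + psi z * 'D_(dir R b) psi z.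
  have := D_sqr b z sS.
  have -> : (fun w => S w ^+ 2) = (fun z => eta ^+ 2 + (phi z ^+ 2 + psi z ^+ 2)).
    by apply/funext => w; rewrite sqr_sqrtr// ltW.
  rewrite D_addc; last by apply: smoothD; exact: smooth_sqr.
  rewrite D_add; [|exact: smooth_sqr|exact: smooth_sqr].
  rewrite !D_sqr//; lra.
move: ('D_(dir R b) S z) ('D_(dir R b) phi z) ('D_(dir R b) psi z) => d x y E.
rewrite -(ler_pM2l (exprn_gt0 2 S0)) -exprMn E SE.
have := sqr_ge0 (phi z * y - psi z * x); have := sqr_ge0 (eta * x).
have := sqr_ge0 (eta * y).
by rewrite !exprMn; nra.
Qed.

Lemma Et_hypot_reg : Et (hypot_reg eta phi psi) <= Et phi + Et psi.
Proof. by apply: Et_le2 => //; [exact: test_hypot_reg|exact: grad_hypot_reg]. Qed.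
End regularised.

Lemma sqrt2_lip (x y a b : R) :
  Num.sqrt (x ^+ 2 + y ^+ 2) <= Num.sqrt (a ^+ 2 + b ^+ 2) + (`|x - a| + `|y - b|).
Proof.
set r := Num.sqrt (a ^+ 2 + b ^+ 2); set s := `|x - a| + `|y - b|.
have r0 : 0 <= r by exact: sqrtr_ge0.
have s0 : 0 <= s by rewrite addr_ge0.
have rE : r ^+ 2 = a ^+ 2 + b ^+ 2.
  by rewrite sqr_sqrtr//; apply: addr_ge0; exact: sqr_ge0.
have ar : `|a| <= r.
  by rewrite -sqrtr_sqr ler_wsqrtr// lerDl sqr_ge0.
have br : `|b| <= r.
  by rewrite -sqrtr_sqr ler_wsqrtr// lerDr sqr_ge0.
rewrite -[leRHS](ger0_norm (addr_ge0 r0 s0)) -sqrtr_sqr ler_wsqrtr//.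
have hx : x ^+ 2 <= (`|a| + `|x - a|) ^+ 2.
  rewrite -(real_normK (num_real x)) lerXn2r ?nnegrE ?addr_ge0//.
  by rewrite -{1}(subrK a x) addrC ler_normD.
have hy : y ^+ 2 <= (`|b| + `|y - b|) ^+ 2.
  rewrite -(real_normK (num_real y)) lerXn2r ?nnegrE ?addr_ge0//.
  by rewrite -{1}(subrK b y) addrC ler_normD.
have ha := real_normK (num_real a); have hb := real_normK (num_real b).
move: hx hy; rewrite /s -ha -hb in rE *.
have := normr_ge0 (x - a); have := normr_ge0 (y - b).
have := normr_ge0 a; have := normr_ge0 b.
move: rE ar br r0; move: `|x - a| `|y - b| `|a| `|b| r => d e a' b' r'.
by move=> *; nra.
Qed.

Lemma sqrt_eta_le (eta t : R) : 0 <= eta -> 0 <= t ->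
  Num.sqrt t <= Num.sqrt (eta ^+ 2 + t) <= eta + Num.sqrt t.
Proof.
move=> e0 t0; apply/andP; split; first by rewrite ler_wsqrtr// lerDr sqr_ge0.
have s0 := sqrtr_ge0 t.
rewrite -[leRHS](ger0_norm (addr_ge0 e0 s0)) -sqrtr_sqr ler_wsqrtr//.
by rewrite sqrrD sqr_sqrtr// lerD2r lerDl mulrn_wge0// mulr_ge0.
Qed.

Lemma hypot_reg_dist eta phi psi u v z : 0 < eta ->
  `|hypot_reg eta phi psi z - hypot u v z| <= eta + (`|phi z - u z| + `|psi z - v z|).
Proof.
move=> e0; rewrite /hypot_reg /hypot.
have t0 : 0 <= phi z ^+ 2 + psi z ^+ 2 by rewrite addr_ge0// sqr_ge0.
have /andP[h1 h2] := sqrt_eta_le (ltW e0) t0.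
have h3 := sqrt2_lip (phi z) (psi z) (u z) (v z).
have h4 := sqrt2_lip (u z) (v z) (phi z) (psi z).
rewrite (distrC (u z)) (distrC (v z)) in h4.
by rewrite ler_norml; apply/andP; split; lra.
Qed.

Lemma measurable_sqrt f : mf f -> mf (fun z => Num.sqrt (f z)).
Proof.
move=> m; apply: (measurableT_comp (f := @Num.sqrt R)) => //.
by apply: continuous_measurable_fun; exact: sqrt_continuous.
Qed.

Lemma hypot_L2 u v : L2 mu u -> L2 mu v -> L2 mu (hypot u v).
Proof.
move=> [mu' ui] [mv vi]; split.
  apply: measurable_sqrt; apply: measurable_funD; exact: measurable_funX.
have -> : (fun z => hypot u v z ^+ 2) = (fun z => u z ^+ 2 + v z ^+ 2).
  by apply/funext => z; rewrite hypot_sqr.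
exact: intbleD.
Qed.

Lemma N2_le_sum3 f u v (eta a b : R) : L2 mu f -> L2 mu u -> L2 mu v -> 0 <= eta ->
  (forall z, `|f z| <= eta + (`|u z| + `|v z|)) ->
  N2 mu u <= a -> N2 mu v <= b -> N2 mu f <= eta + (a + b).
Proof.
move=> Lf Lu Lv e0 H ha hb.
have Lc := L2_cst (muO_fin R) eta.
have Lu' := L2_norm Lu; have Lv' := L2_norm Lv; have Luv := L2D Lu' Lv'.
have h1 : N2 mu f <= N2 mu (fun z => cst eta z + (`|u z| + `|v z|)).
  apply: N2_le => //; first exact: L2D.
  by move=> z; rewrite /= (le_trans (H z))// ler_norm.
have h2 := N2D Lc Luv; have h3 := N2D Lu' Lv'.
have h4 : N2 mu (cst eta) = eta.
  rewrite (@N2_eq _ (cst eta) (fun z => eta * cst 1 z)); last by move=> z; rewrite /= mulr1.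
  rewrite N2Z; last exact: (L2_cst (muO_fin R)).
  by rewrite N2_cst1 mulr1 ger0_norm.
rewrite (N2_norm mu u) (N2_norm mu v) in h3.
apply: le_trans h1 _; apply: le_trans h2 _; rewrite h4 lerD2l.
by apply: le_trans h3 _; exact: lerD.
Qed.

Lemma thirds_le (e : R) : e / 3 + (e / 3 + e / 3) <= e.
Proof. by lra. Qed.

Lemma thirds0_le (e : R) : 0 < e -> e / 3 + (e / 3 + 0) <= e.
Proof. by lra. Qed.

(** The energy is convex and homogeneous, hence subadditive, in the square
    variable. The regularised functions are test functions to which
    weak_limit_aform applies. *)
Lemma hypot_H10 u v : H10 u -> H10 v ->
  H10 (hypot u v) /\ aform (hypot u v) (hypot u v) <= aform u u + aform v v.
Proof.
move=> Hu Hv; have Lu := H10_L2 Hu; have Lv := H10_L2 Hv.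
apply: (weak_limit_aform alpha1_gt0 alpha2_gt0 (C := fun=> True)) => //; first exact: hypot_L2.
move=> e e0; have e3 : 0 < e / 3 by rewrite divr_gt0.
have [phi [tp p1 p2]] := H10_approx alpha1_gt0 alpha2_gt0 Hu e3.
have [psi [tq q1 q2]] := H10_approx alpha1_gt0 alpha2_gt0 Hv e3.
have th := test_hypot_reg e3 tp tq.
exists (hypot_reg (e / 3) phi psi); split; [by []|exact: th| |].
  apply: (le_trans _ (thirds_le e)).
  apply: (@N2_le_sum3 _ (fun z => phi z - u z) (fun z => psi z - v z)).
  - exact: (L2B (test_L2 th) (hypot_L2 Lu Lv)).
  - exact: (L2B (test_L2 tp) Lu).
  - exact: (L2B (test_L2 tq) Lv).
  - exact: ltW.
  - by move=> z; exact: hypot_reg_dist.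
  - exact: p1.
  - exact: q1.
apply: le_trans (Et_hypot_reg e3 tp tq) _.
apply: le_trans (lerD p2 q2) _.
have aux (a b : R) : a + e / 3 + (b + e / 3) <= a + b + e by clear -e0; lra.
exact: aux.
Qed.

Lemma abs_H10 u : H10 u ->
  H10 (fun z => `|u z|) /\ aform (fun z => `|u z|) (fun z => `|u z|) <= aform u u.
Proof.
move=> Hu; have H0 := H10_test alpha1_gt0 alpha2_gt0 (test0 R).
have := hypot_H10 Hu H0.
have -> : hypot u (cst 0) = (fun z => `|u z|).
  by apply/funext => z; rewrite /hypot/= expr0n/= addr0 sqrtr_sqr.
have -> : aform (cst 0) (cst 0) = 0.
  have E : (cst 0 : R * R -> R) = (fun z => 0 * (cst 0 : R * R -> R) z).
    by apply/funext => z; rewrite mul0r.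
  rewrite [in LHS]E; apply: etrans (aformZ alpha1_gt0 alpha2_gt0 0 H0) _.
  by rewrite expr0n/= mul0r.
by rewrite addr0.
Qed.

(** Composing test functions with sqrt (eta^2 + t^2) - eta makes them nonnegative
    without increasing the energy, and nonnegativity is stable under midpoints. *)
Lemma nonneg_approx (w : R * R -> R) : H10 w -> (forall z, 0 <= w z) ->
  near_graph (fun phi => forall z, 0 <= phi z) w (grd w).
Proof.
move=> Hw w0; have Lw := H10_L2 Hw.
have [||G W GE] := weak_limit alpha1_gt0 alpha2_gt0
  (C := fun phi => forall z, 0 <= phi z) (E0 := aform w w) Lw.
- by move=> phi psi p0 q0 z; rewrite addr_ge0// mulr_ge0.
- move=> e e0; have e3 : 0 < e / 3 by rewrite divr_gt0.
  have [phi [tp p1 p2]] := H10_approx alpha1_gt0 alpha2_gt0 Hw e3.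
  have tq : test_function (cst 0 : R * R -> R) by exact: test0.
  have th := test_hypot_reg e3 tp tq.
  exists (hypot_reg (e / 3) phi (cst 0)); split; [|exact: th| |].
  + by move=> z; exact: hypot_reg_ge0.
  + apply: (le_trans _ (thirds0_le e0)).
    apply: (@N2_le_sum3 _ (fun z => phi z - w z) (cst 0)).
    * exact: (L2B (test_L2 th) Lw).
    * exact: (L2B (test_L2 tp) Lw).
    * exact: L2_0.
    * exact: ltW.
    * move=> z; have := hypot_reg_dist phi (cst 0) w (cst 0) z e3.
      by rewrite /= /hypot/= expr0n/= addr0 sqrtr_sqr (ger0_norm (w0 z)) subrr.
    * exact: p1.
    * by rewrite N2_0.
  + apply: le_trans (Et_le1 (phi := phi) th tp _) _.
      move=> b z; apply: le_trans (grad_hypot_reg e3 tp tq b z) _.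
      rewrite [X in _ + X ^+ 2]gradE (_ : 'D_(dir R b) (cst 0) z = 0); last exact: derive_cst.
      by rewrite mulr0 expr0n/= addr0.
    apply: le_trans p2 _; rewrite lerD2l ler_pdivrMr// ler_peMr ?ltW//.
    by rewrite ltr1n.
have ae b := grd_ae_Wgraph alpha1_gt0 alpha2_gt0 b W.
have [_ LG ap] := W; move=> e e0; have [phi [Cphi tphi h1 h2]] := ap e e0.
exists phi; split; [exact: Cphi|exact: tphi|exact: h1|move=> b].
apply: le_trans (h2 b); rewrite le_eqVlt; apply/orP; left; apply/eqP.
have Lg := grad_L2 alpha1_gt0 alpha2_gt0 b tphi.
apply: N2_ae.
- by have [] := L2B Lg (H10_grd_L2 b Hw).
- by have [] := L2B Lg (LG b).
- by apply: (ae_imply (ae b)) => z E zT; rewrite E.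
Qed.

(** A smooth substitute for min (v, k): it is bounded by k and has slope at most
    1 on nonnegative values. *)
Definition trunc (k : R) (v : R * R -> R) (z : R * R) : R := k * v z / (k + v z).

Section truncation.
Variables (k : R).
Hypotheses (k_gt0 : 0 < k).

Lemma trunc_ge0 v z : 0 <= v z -> 0 <= trunc k v z.
Proof. by move=> v0; rewrite divr_ge0 ?mulr_ge0 ?addr_ge0// ltW. Qed.

Lemma trunc_le v z : 0 <= v z -> trunc k v z <= v z.
Proof.
move=> v0; have kv : 0 < k + v z by rewrite ltr_pwDl.
rewrite ler_pdivrMr// mulrC ler_wpM2l// lerDl//.
Qed.

Lemma trunc_lek v z : 0 <= v z -> trunc k v z <= k.
Proof.
move=> v0; have kv : 0 < k + v z by rewrite ltr_pwDl.
by rewrite ler_pdivrMr// ler_wpM2l ?(ltW k_gt0)// lerDr ltW.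
Qed.

Lemma trunc_lip u v z : 0 <= u z -> 0 <= v z ->
  `|trunc k u z - trunc k v z| <= `|u z - v z|.
Proof.
move=> u0 v0; rewrite /trunc; move: (u z) (v z) u0 v0 => a b a0 b0.
have ka : 0 < k + a by rewrite ltr_pwDl.
have kb : 0 < k + b by rewrite ltr_pwDl.
have -> : k * a / (k + a) - k * b / (k + b) = k ^+ 2 / ((k + a) * (k + b)) * (a - b).
  by field; rewrite !gt_eqF.
rewrite normrM ler_piMl// ger0_norm.
  rewrite ler_pdivrMr ?mulr_gt0// mul1r.
  have := ltW k_gt0; nra.
by rewrite divr_ge0 ?sqr_ge0// mulr_ge0 ?ltW.
Qed.

Lemma test_trunc phi : test_function phi -> (forall z, 0 <= phi z) ->
  test_function (trunc k phi).
Proof.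
move=> tp p0; have sp := test_smooth tp; apply: (test_dominated1 tp).
  apply: smoothM; first exact: smoothZ.
  apply: smooth_inv; first by apply: smoothD => //; exact: smooth_cst.
  by move=> z; rewrite ltr_pwDl.
by move=> z; rewrite /trunc => ->; rewrite mulr0 mul0r.
Qed.

Lemma grad_trunc phi b z : test_function phi -> (forall z, 0 <= phi z) ->
  grad b (trunc k phi) z ^+ 2 <= grad b phi z ^+ 2.
Proof.
move=> tp p0; have tt := test_trunc tp p0.
have sp := test_smooth tp; have st := test_smooth tt.
rewrite !gradE !exprMn ler_wpM2l ?sqr_ge0//.
have sk : smooth (fun w => k + phi w) by apply: smoothD => //; exact: smooth_cst.
have E : 'D_(dir R b) phi z * trunc k phi z + (k + phi z) * 'D_(dir R b) (trunc k phi) z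
   = k * 'D_(dir R b) phi z.
  rewrite -[X in X * trunc _ _ _](D_addc b k z sp) -(DM b z sk st).
  have -> : (fun w => (k + phi w) * trunc k phi w) = (fun w => k * phi w).
    by apply/funext => w; rewrite mulrC divfK// gt_eqF// ltr_pwDl.
  rewrite (DM b z (smooth_cst k) sp).
  by rewrite (_ : 'D_(dir R b) (cst k) z = 0) ?mul0r ?add0r//; exact: derive_cst.
have t0 := trunc_ge0 (p0 z); have tk := trunc_lek (p0 z).
move: E t0 tk (p0 z); move: ('D_(dir R b) phi z) ('D_(dir R b) (trunc k phi) z)
  (trunc k phi z) (phi z) => d e t f E t0 tk f0.
have kf : 0 < k + f by rewrite ltr_pwDl.
have Ed : (k + f) * e = (k - t) * d by lra.
rewrite -(ler_pM2l (exprn_gt0 2 kf)) -!exprMn Ed !exprMn.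
rewrite ler_wpM2r ?sqr_ge0// lerXn2r ?nnegrE ?subr_ge0// ?(ltW kf)//.
by lra.
Qed.

Lemma trunc_H10 v : H10 v -> (forall z, 0 <= v z) ->
  H10 (trunc k v) /\ aform (trunc k v) (trunc k v) <= aform v v.
Proof.
move=> Hv v0; have Lv := H10_L2 Hv.
have Lt : L2 mu (trunc k v).
  apply: (L2_le _ _ Lv); last first.
    by move=> z; rewrite !ger0_norm ?trunc_le// trunc_ge0.
  have [mv _] := Lv.
  rewrite (_ : trunc k v = fun z => k - k ^+ 2 * (k + v z) `^ (-1)).
    apply: measurable_funB => //; apply: measurable_funM => //.
    apply: (measurableT_comp (measurable_powR (-1))).
    exact: measurable_funD.
  apply/funext => z; rewrite powR_inv1 ?addr_ge0 ?(ltW k_gt0)// /trunc.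
  by field; rewrite gt_eqF// ltr_pwDl.
apply: (weak_limit_aform alpha1_gt0 alpha2_gt0 (C := fun=> True)) => // e e0.
have [phi [p0 tp h1 h2]] := near_graph_Et alpha1_gt0 alpha2_gt0 Hv (nonneg_approx Hv v0) e0.
have tt := test_trunc tp p0.
exists (trunc k phi); split; [by []|exact: tt| |].
  apply: le_trans h1; apply: N2_le.
  - exact: (L2B (test_L2 tt) Lt).
  - exact: (L2B (test_L2 tp) Lv).
  - by move=> z; exact: trunc_lip.
apply: le_trans h2; apply: Et_le1 => // b z; exact: grad_trunc.
Qed.

End truncation.

End Operations.

(** * Convexity of real powers *)

Section PowerInequalities.
Context (R : realType).
Implicit Types (a b c p q r s x : R).

Lemma bernoulli_powR q s : 1 < q -> 0 <= s -> 1 + q * (s - 1) <= s `^ q.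
Proof.
move=> q1 s0; have q0 : 0 < q by exact: lt_trans q1.
pose p := q / (q - 1).
have p0 : 0 < p by rewrite divr_gt0// subr_gt0.
have qp : q^-1 + p^-1 = 1 by rewrite /p invf_div; field; rewrite gt_eqF.
have := @conjugate_powR R s 1 q p s0 ler01 q0 p0 qp.
rewrite powR1 mulr1 => H.
have -> : 1 + q * (s - 1) = q * (s - p^-1).
  by rewrite /p invf_div; field; rewrite gt_eqF.
rewrite -ler_pdivlMl// mulrC lerBlDr.
by rewrite mul1r in H.
Qed.

Lemma sqr_powR r q : 0 <= r -> (r ^+ 2) `^ q = (r `^ q) ^+ 2.
Proof. by move=> r0; rewrite expr2 powRM. Qed.

(** Squaring the Bernoulli inequality at r gains a quadratic remainder, whence
    strictness. *)
Lemma bernoulli_sqr q r : 1 < q -> 0 <= r -> 0 <= 1 + q * (r - 1) ->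
  1 + q * (r ^+ 2 - 1) + q * (q - 1) * (r - 1) ^+ 2 <= (r ^+ 2) `^ q.
Proof.
move=> q1 r0 h; rewrite sqr_powR//.
have H : (1 + q * (r - 1)) ^+ 2 <= (r `^ q) ^+ 2.
  by rewrite lerXn2r ?nnegrE ?powR_ge0// bernoulli_powR.
apply: le_trans H; rewrite le_eqVlt; apply/orP; left; apply/eqP; ring.
Qed.

Lemma bernoulli_strict q s : 1 < q -> 0 <= s -> s != 1 -> 1 + q * (s - 1) < s `^ q.
Proof.
move=> q1 s0 s1; pose r := Num.sqrt s.
have r0 : 0 <= r by exact: sqrtr_ge0.
have rE : r ^+ 2 = s by rewrite sqr_sqrtr.
have r1 : r != 1 by apply: contra s1 => /eqP r1; rewrite -rE r1 expr1n.
rewrite -rE; have [h|h] := leP 0 (1 + q * (r - 1)).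
  apply: lt_le_trans (bernoulli_sqr q1 r0 h); rewrite ltrDl.
  have q0 : 0 < q by exact: lt_trans q1.
  by rewrite mulr_gt0 ?exprn_even_gt0//= ?subr_eq0// mulr_gt0// subr_gt0.
apply: (@lt_le_trans _ _ 0); last exact: powR_ge0.
have r1' : r < 1 by rewrite ltNge; apply/negP => r1'; nra.
nra.
Qed.

Lemma tangent_powR p x c : 1 < p -> 0 <= x -> 0 <= c ->
  c `^ p + p * c `^ (p - 1) * (x - c) <= x `^ p.
Proof.
move=> p1 x0; rewrite le_eqVlt => /orP[/eqP <-|c0].
  rewrite !powR0 ?gt_eqF ?subr_gt0//; first by rewrite mulr0 mul0r addr0 powR_ge0.
  exact: lt_trans p1.
have := bernoulli_powR p1 (divr_ge0 x0 (ltW c0)).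
rewrite -(ler_pM2l (powR_gt0 p c0)) -powRM ?divr_ge0 ?(ltW c0)//.
rewrite [c * _]mulrC divfK ?gt_eqF//; apply: le_trans.
rewrite -(@mulr_powRB1 _ c p) ?(ltW c0)// ?(lt_trans _ p1)//.
rewrite le_eqVlt; apply/orP; left; apply/eqP.
by field; rewrite gt_eqF.
Qed.

Lemma tangent_powR_eq p x c : 1 < p -> 0 <= x -> 0 <= c ->
  x `^ p <= c `^ p + p * c `^ (p - 1) * (x - c) -> x = c.
Proof.
move=> p1 x0; have p0 : 0 < p by exact: lt_trans p1.
rewrite le_eqVlt => /orP[/eqP <-|c0].
  rewrite !powR0 ?gt_eqF ?subr_gt0// mulr0 mul0r addr0 => h.
  have /eqP : x `^ p = 0 by apply/eqP; rewrite eq_le h powR_ge0.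
  by rewrite powR_eq0 => /andP[/eqP].
move=> h; apply/eqP; apply: contraTT h => xc; rewrite -ltNge.
have s1 : x / c != 1 
  by apply: contra xc => /eqP E; rewrite -[X in _ == X]mul1r -E divfK// gt_eqF.
have := bernoulli_strict p1 (divr_ge0 x0 (ltW c0)) s1.
rewrite -(ltr_pM2l (powR_gt0 p c0)) -powRM ?divr_ge0 ?(ltW c0)//.
rewrite [c * (x / c)]mulrC divfK ?gt_eqF//; apply: le_lt_trans.
rewrite -(@mulr_powRB1 _ c p) ?(ltW c0)//.
rewrite le_eqVlt; apply/orP; left; apply/eqP.
by field; rewrite gt_eqF.
Qed.

(** The midpoint convexity defect of x^q. *)
Definition defect q a b : R := 2^-1 * a `^ q + 2^-1 * b `^ q - ((a + b) / 2) `^ q.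

Lemma defect_sym q a b : defect q a b = defect q b a.
Proof. by rewrite /defect [a + b]addrC; ring. Qed.

(** Of the two tangent inequalities at c, the one above c is improved by
    bernoulli_sqr. *)
Lemma defect_lower q c s : 1 < q -> 0 <= c -> 0 <= s <= 1 ->
  q * (q - 1) / 18 * (c `^ q * s ^+ 2) <= defect q (c * (1 + s)) (c * (1 - s)).
Proof.
move=> q1 c0 /andP[s0 s1].
have s1' : 0 <= 1 - s by rewrite subr_ge0.
have s1'' : 0 <= 1 + s by rewrite addr_ge0.
rewrite /defect (_ : (c * (1 + s) + c * (1 - s)) / 2 = c); last by field.
rewrite !powRM//.
pose r := Num.sqrt (1 + s).
have rE : r ^+ 2 = 1 + s by rewrite sqr_sqrtr.
have r1 : 1 <= r by rewrite -sqrtr1 ler_wsqrtr// lerDl.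
have r0 : 0 <= r by exact: le_trans r1.
have h0 : 0 <= 1 + q * (r - 1) by rewrite addr_ge0// mulr_ge0 ?subr_ge0// ltW// (lt_trans _ q1).
have h1 := bernoulli_sqr q1 r0 h0.
have h2 := bernoulli_powR q1 s1'.
rewrite rE in h1.
have qq : 0 < q * (q - 1) by rewrite mulr_gt0 ?subr_gt0// (lt_trans _ q1).
have rs : s / 3 <= r - 1.
  have : r <= 2 by rewrite -(ler_pXn2r (ltn0Sn 1)) ?nnegrE// rE; lra.
  by move: rE; nra.
have rs2 : (s / 3) ^+ 2 <= (r - 1) ^+ 2.
  by rewrite lerXn2r ?nnegrE ?subr_ge0// divr_ge0.
have key : q * (q - 1) / 18 * s ^+ 2 <= 2^-1 * (1 + s) `^ q + 2^-1 * (1 - s) `^ q - 1.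
  have : q * (q - 1) * (s / 3) ^+ 2 <= q * (q - 1) * (r - 1) ^+ 2 by rewrite ler_pM2l.
  move: h1 h2; move: ((1 + s) `^ q) ((1 - s) `^ q) ((r - 1) ^+ 2) => A B C.
  by rewrite expr_div_n; lra.
have cq := powR_ge0 c q.
move: key; move: ((1 + s) `^ q) ((1 - s) `^ q) (c `^ q) cq (s ^+ 2) => A B C C0 S.
by move=> /(ler_wpM2l C0); lra.
Qed.

Lemma defect_ge0 q a b : 1 < q -> 0 <= a -> 0 <= b -> 0 <= defect q a b.
Proof.
move=> q1 a0 b0; pose c := (a + b) / 2.
have c0 : 0 <= c by rewrite divr_ge0 ?addr_ge0.
have := tangent_powR q1 a0 c0; have := tangent_powR q1 b0 c0.
rewrite /defect -/c => h1 h2.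
have : q * c `^ (q - 1) * (a - c) + q * c `^ (q - 1) * (b - c) = 0.
  rewrite -mulrDr /c (_ : a - (a + b) / 2 + (b - (a + b) / 2) = 0) ?mulr0//.
  by field.
lra.
Qed.

(** A quantitative strict convexity. With mean c and relative half-difference s,
    the first term absorbs the cases of small s and of small c; in the remaining
    one defect_lower gives the second term. *)
Lemma defect_control q (e : R) : 1 < q -> 0 < e -> exists2 C, 0 <= C &
  forall a b, 0 <= a -> 0 <= b -> `|a - b| <= e * (1 + (a + b)) + C * defect q a b.
Proof.
move=> q1 e0.
have qq : 0 < q * (q - 1) / 18 by rewrite divr_gt0// mulr_gt0 ?subr_gt0// (lt_trans _ q1).
have e2 : 0 < (e / 2) `^ (q - 1) by rewrite powR_gt0// divr_gt0.
(* C makes the second term at least 2 c s once e <= s and e / 2 <= c *)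
pose C := 2 / ((e / 2) `^ (q - 1) * e) / (q * (q - 1) / 18).
have C0 : 0 < C by rewrite divr_gt0// divr_gt0// mulr_gt0.
exists C; first exact: ltW.
suff H a b : 0 <= b -> b <= a -> `|a - b| <= e * (1 + (a + b)) + C * defect q a b.
  move=> a b a0 b0; have [ba|/ltW ab] := leP b a; first exact: H.
  by rewrite distrC [a + b]addrC defect_sym; exact: H.
move=> b0 ba; have a0 := le_trans b0 ba.
have D0 := defect_ge0 q1 a0 b0.
rewrite ger0_norm ?subr_ge0//.
pose c := (a + b) / 2.
have [c0|c0] := leP c 0.
  have [-> ->] : a = 0 /\ b = 0 by rewrite /c in c0; split; lra.
  rewrite subrr !addr0 mulr1 addr_ge0 ?(ltW e0)// mulr_ge0 ?(ltW C0)//.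
  exact: defect_ge0.
pose s := (a - b) / 2 / c.
have s0 : 0 <= s by rewrite divr_ge0 ?(ltW c0)// divr_ge0// subr_ge0.
have s1 : s <= 1 by rewrite ler_pdivrMr// mul1r /c; lra.
have aE : a = c * (1 + s) by rewrite /s /c; field; rewrite gt_eqF//; rewrite /c in c0; lra.
have bE : b = c * (1 - s) by rewrite /s /c; field; rewrite gt_eqF//; rewrite /c in c0; lra.
have abE : a - b = 2 * c * s by rewrite aE bE; ring.
have sumE : a + b = 2 * c by rewrite aE bE; ring.
clearbody s c.
have s01 : 0 <= s <= 1 by rewrite s0 s1.
have L := defect_lower q1 (ltW c0) s01; rewrite -aE -bE in L.
have CD : 0 <= C * defect q a b by rewrite mulr_ge0// ltW.
have ec : 0 <= e * c by rewrite mulr_ge0// ltW.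
rewrite abE sumE; have [se|se] := leP s e.
  have : c * s <= c * e by rewrite ler_pM2l.
  by nra.
have [ce|ce] := leP c (e / 2).
  have : c * s <= c * 1 by rewrite ler_pM2l.
  by lra.
have L2 : C * (q * (q - 1) / 18 * (c `^ q * s ^+ 2)) <= C * defect q a b.
  by rewrite ler_pM2l.
have cq : (e / 2) `^ (q - 1) <= c `^ (q - 1).
  by rewrite ge0_ler_powR ?nnegrE ?subr_ge0 ?ltW// divr_gt0.
have : 2 * c * s <= C * (q * (q - 1) / 18 * (c `^ q * s ^+ 2)).
  rewrite /C -(@mulr_powRB1 _ c q) ?(ltW c0) ?(lt_trans _ q1)//.
  move: qq e2 cq; move: (q * (q - 1) / 18) ((e / 2) `^ (q - 1)) (c `^ (q - 1)).
  move=> K D G K0 D0' DG.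
  have -> : 2 / (D * e) / K * (K * (c * G * s ^+ 2)) = 2 * c * s * (G * s / (D * e)).
    by field; rewrite !gt_eqF.
  apply: ler_peMr; first by rewrite !mulr_ge0// ltW.
  rewrite ler_pdivlMr ?mulr_gt0// mul1r.
  by rewrite ler_pM// ltW.
by lra.
Qed.

End PowerInequalities.

(** * The functional J in the square variable *)

Section Functional.
Context (R : realType) (alpha1 alpha2 q M : R).
Hypotheses (alpha1_gt0 : 0 < alpha1) (alpha2_gt0 : 0 < alpha2).
Hypotheses (q_gt1 : 1 < q) (M_gt0 : 0 < M).
Local Notation T := (measurableTypeR R * measurableTypeR R)%type.
Local Notation mf f := (measurable_fun [set: T] f).
Local Notation mu := (muO R).
Local Notation H10 := (H10 alpha1 alpha2).
Local Notation aform := (aform alpha1 alpha2).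
Local Notation U := (U alpha1 alpha2 q).
Local Notation J := (J alpha1 alpha2 q M).
Implicit Types (f g u v V : R * R -> R).

Let q_gt0 : 0 < q. Proof. exact: lt_trans q_gt1. Qed.

Definition Iq u : R := \int[mu]_z ((u z ^+ 2) `^ q).
(** The L^q norm of u^2, which is the square of the L^(2q) norm of u. *)
Definition Nq u : R := Iq u `^ q^-1.
Definition fin_q u := intble mu (fun z => (u z ^+ 2) `^ q).

Lemma sqr_powR2 (x : R) : (x ^+ 2) `^ q = `|x| `^ (2 * q).
Proof. by rewrite powRrM powR_mulrn// real_normK ?num_real. Qed.

Lemma measurable_sqr_powR u (s : R) : mf u -> mf (fun z => (u z ^+ 2) `^ s).
Proof.
move=> mu'; apply: (measurableT_comp (measurable_powR s)).
exact: measurable_funX.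
Qed.

Lemma UP u : U u <-> H10 u /\ fin_q u.
Proof.
have q2 : 0 < 2 * q by rewrite mulr_gt0.
have E : (fun z => (u z ^+ 2) `^ q) = (fun z => `|u z| `^ (2 * q)).
  by apply/funext => z; exact: sqr_powR2.
split=> -[Hu].
  have [mfu _] := H10_L2 Hu.
  by move=> /(integral_powR_lty mu mfu q2) H; split=> //; rewrite /fin_q E.
rewrite /fin_q E => H; split=> //; have [mfu _] := H10_L2 Hu.
exact/(integral_powR_lty mu mfu q2).
Qed.

Lemma Iq_ge0 u : 0 <= Iq u.
Proof. by apply: int_ge0 => z; exact: powR_ge0. Qed.

Lemma Nq_ge0 u : 0 <= Nq u. Proof. exact: powR_ge0. Qed.

Lemma Nq_powR u : Nq u `^ q = Iq u.
Proof. by rewrite -powRrM mulVf ?gt_eqF// powRr1// Iq_ge0. Qed.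

Lemma normL_2q u : fin_q u -> normL (2 * q) u ^+ 2 = Nq u.
Proof.
move=> fu; have E : (fun z => `|u z| `^ (2 * q)) = (fun z => (u z ^+ 2) `^ q).
  by apply/funext => z; rewrite sqr_powR2.
have H : intble mu (fun z => `|u z| `^ (2 * q)) by rewrite E.
rewrite /normL (LnormE H) E -/(Iq u) -powR_mulrn ?powR_ge0// -powRrM.
by congr powR; field; rewrite gt_eqF.
Qed.

Lemma normL_q u : fin_q u -> normL q (fun z => u z ^+ 2) = Nq u.
Proof.
move=> fu; have E : (fun z => `|u z ^+ 2| `^ q) = (fun z => (u z ^+ 2) `^ q).
  by apply/funext => z; rewrite ger0_norm// sqr_ge0.
have H : intble mu (fun z => `|u z ^+ 2| `^ q) by rewrite E.
by rewrite /normL (LnormE H) E.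
Qed.

Lemma V_ofE u z : fin_q u ->
  V_of q M u z = M * Nq u `^ (1 - q) * (u z ^+ 2) `^ (q - 1).
Proof.
move=> fu; rewrite /V_of normL_q//; congr (_ * _).
by rewrite powRrM powR_mulrn// real_normK ?num_real.
Qed.

Lemma JE u : fin_q u -> J u = (aform u u + M * Nq u) / N2 mu u ^+ 2.
Proof.
move=> fu; rewrite /Defs.J normL_2q//; congr (_ / _).
by rewrite N2_sqr; congr Rintegral; apply/funext => z; rewrite real_normK ?num_real.
Qed.

Lemma nonzeroP u : L2 mu u -> nonzero u <-> 0 < N2 mu u.
Proof.
move=> Lu; split=> [nz|n0 u0].
  rewrite lt_neqAle N2_ge0 andbT; apply/eqP => /esym n0; apply: nz.
  exact: int_sqr_eq0.
have [mfu _] := Lu.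
have E : N2 mu u = N2 mu (cst 0) by apply: N2_ae => //; exact: measurable_cst.
by rewrite E N2_0 ltxx in n0.
Qed.

Lemma fin_q_bounded f (C : R) : mf f -> (forall z, `|f z| <= C) -> fin_q f.
Proof.
move=> mff H; apply: (@bounded_intble _ _ ((C ^+ 2) `^ q)).
  exact: measurable_sqr_powR.
move=> z; rewrite ger0_norm ?powR_ge0// ge0_ler_powR ?nnegrE ?sqr_ge0 ?(ltW q_gt0)//.
rewrite -(real_normK (num_real (f z))) lerXn2r ?nnegrE//.
exact: le_trans (H z).
Qed.

Lemma test_U phi : test_function phi -> U phi.
Proof.
move=> tp; apply/UP; split; first exact: H10_test.
have [C _ HC] := test_bounded tp; apply: fin_q_bounded HC.
by have [] := test_L2 tp.
Qed.

Lemma minkowski_q f g : intble mu (fun z => f z `^ q) -> intble mu (fun z => g z `^ q) ->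
  mf f -> mf g -> (forall z, 0 <= f z) -> (forall z, 0 <= g z) ->
  intble mu (fun z => (f z + g z) `^ q) /\
  (\int[mu]_z ((f z + g z) `^ q)) `^ q^-1 <=
  (\int[mu]_z (f z `^ q)) `^ q^-1 + (\int[mu]_z (g z `^ q)) `^ q^-1.
Proof.
move=> fi gi mff mg f0 g0.
have mfg : mf (fun z => f z + g z) by exact: measurable_funD.
have nE (h : R * R -> R) : (forall z, 0 <= h z) -> (fun z => `|h z| `^ q) = (fun z => h z `^ q).
  by move=> h0; apply/funext => z; rewrite ger0_norm.
have fg0 z : 0 <= f z + g z by rewrite addr_ge0.
have := @minkowski_EFin _ _ _ mu f g q mff mg (ltW q_gt1).
have finN (h : R * R -> R) : mf h -> (forall z, 0 <= h z) -> intble mu (fun z => h z `^ q) ->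
    ('N[mu]_(q%:E)[EFin \o h])%E = ((\int[mu]_z (h z `^ q)) `^ q^-1)%:E.
  move=> mh h0 hi; have hi' : intble mu (fun z => `|h z| `^ q) by rewrite nE.
  have L := LnormE hi'; rewrite (nE h h0) in L; rewrite -L fineK//.
  have : h \in Lfun mu q%:E by apply/(integral_powR_lty mu mh q_gt0).
  rewrite inE => /andP[_]; rewrite inE/= /finite_norm => h1.
  by rewrite ge0_fin_numE ?Lnorm_ge0.
rewrite (finN f)// (finN g)// => H.
have Lfg : (fun z => f z + g z) \in Lfun mu q%:E.
  rewrite inE; apply/andP; split; first by rewrite inE.
  rewrite inE/= /finite_norm; apply: le_lt_trans H _.
  by rewrite -EFinD ltry.
have ifg : intble mu (fun z => (f z + g z) `^ q).
  by have /(integral_powR_lty mu mfg q_gt0) := Lfg; rewrite (nE (fun z => f z + g z)).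
split=> //; rewrite -lee_fin EFinD; apply: le_trans H.
by rewrite -(finN (fun z => f z + g z)).
Qed.

(** The mean in the square variable: the constraint N2 = 1 is affine in this
    variable, and both terms of the numerator of J are convex. *)
Definition mid u v := hypot (fun z => Num.sqrt 2^-1 * u z) (fun z => Num.sqrt 2^-1 * v z).

Lemma mid_sqr u v z : mid u v z ^+ 2 = 2^-1 * u z ^+ 2 + 2^-1 * v z ^+ 2.
Proof. by rewrite hypot_sqr !exprMn sqr_sqrtr. Qed.

Lemma mid_H10 u v : H10 u -> H10 v ->
  H10 (mid u v) /\ aform (mid u v) (mid u v) <= 2^-1 * aform u u + 2^-1 * aform v v.
Proof.
move=> Hu Hv; have s2 : Num.sqrt (2^-1 : R) ^+ 2 = 2^-1 by rewrite sqr_sqrtr.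
have := hypot_H10 alpha1_gt0 alpha2_gt0 (H10Z alpha1_gt0 alpha2_gt0 (Num.sqrt 2^-1) Hu)
  (H10Z alpha1_gt0 alpha2_gt0 (Num.sqrt 2^-1) Hv).
by rewrite (aformZ alpha1_gt0 alpha2_gt0 _ Hu) (aformZ alpha1_gt0 alpha2_gt0 _ Hv) s2.
Qed.

Lemma mid_q u v : mf u -> mf v -> fin_q u -> fin_q v ->
  fin_q (mid u v) /\ Nq (mid u v) <= 2^-1 * Nq u + 2^-1 * Nq v.
Proof.
move=> mu' mv fu fv.
have half0 : 0 <= (2^-1 : R) by [].
have E (w : R * R -> R) : (fun z => (2^-1 * w z ^+ 2) `^ q) = (fun z => 2^-1 `^ q * (w z ^+ 2) `^ q).
  by apply/funext => z; rewrite powRM// sqr_ge0.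
have P w : fin_q w -> intble mu (fun z => (2^-1 * w z ^+ 2) `^ q) /\
   (\int[mu]_z ((2^-1 * w z ^+ 2) `^ q)) `^ q^-1 = 2^-1 * Nq w.
  move=> fw; rewrite E; split; first exact: intbleZ.
  rewrite intZ// powRM ?powR_ge0 ?Iq_ge0// -powRrM mulfV ?gt_eqF// powRr1//.
have [iu Eu] := P u fu; have [iv Ev] := P v fv.
have m2 (w : R * R -> R) : mf w -> mf (fun z => 2^-1 * w z ^+ 2).
  by move=> mw; apply: measurable_funM => //; exact: measurable_funX.
have h0 (w : R * R -> R) z : 0 <= 2^-1 * w z ^+ 2 :> R by rewrite mulr_ge0// sqr_ge0.
have [ifg] := minkowski_q iu iv (m2 _ mu') (m2 _ mv) (h0 u) (h0 v).
rewrite Eu Ev => H.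
have Em : (fun z => (mid u v z ^+ 2) `^ q) =
    (fun z => (2^-1 * u z ^+ 2 + 2^-1 * v z ^+ 2) `^ q).
  by apply/funext => z; rewrite mid_sqr.
by rewrite /fin_q /Nq /Iq Em.
Qed.

Lemma NqZ u (c : R) : fin_q u -> fin_q (fun z => c * u z) /\
  Nq (fun z => c * u z) = c ^+ 2 * Nq u.
Proof.
move=> fu; have E : (fun z => ((c * u z) ^+ 2) `^ q) =
    (fun z => (c ^+ 2) `^ q * (u z ^+ 2) `^ q).
  by apply/funext => z; rewrite exprMn powRM// sqr_ge0.
rewrite /fin_q /Nq /Iq E; split; first exact: intbleZ.
rewrite intZ// powRM ?powR_ge0 ?Iq_ge0// -powRrM mulfV ?gt_eqF// powRr1//.
exact: sqr_ge0.
Qed.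

(** Jensen, as the square has area 1. *)
Lemma Iq_ge1 u : L2 mu u -> fin_q u -> N2 mu u = 1 -> 1 <= Iq u.
Proof.
move=> [mu' ui] fu n1.
have i1 : intble mu (cst (1 - q)) by exact: (finite_cst (muO_fin R)).
have iq : intble mu (fun z => q * u z ^+ 2) by exact: intbleZ.
have : \int[mu]_z ((1 - q) + q * u z ^+ 2) <= Iq u.
  apply: int_le => //; first exact: (intbleD i1 iq).
  move=> z; have := bernoulli_powR q_gt1 (sqr_ge0 (u z)).
  by apply: le_trans; rewrite le_eqVlt; apply/orP; left; apply/eqP; ring.
rewrite (intD i1 iq) intZ// -N2_sqr n1 expr1n mulr1 Rintegral_cst//.
by rewrite muOT mulr1 subrK.
Qed.

End Functional.

(** * Existence of a minimizer of J *)

Section RealAuxiliaries.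
Context (R : realType).
Implicit Types a b c e x y M : R.

Lemma half_le1 : (2^-1 : R) <= 1. Proof. by lra. Qed.

Lemma sqr_dist_le a b : 0 <= a -> 0 <= b -> (a - b) ^+ 2 <= `|a ^+ 2 - b ^+ 2|.
Proof.
move=> a0 b0; rewrite subr_sqr normrM (ger0_norm (addr_ge0 a0 b0)).
rewrite -(real_normK (num_real (a - b))) expr2 ler_wpM2l// ler_norml.
by apply/andP; split; lra.
Qed.

Lemma mean_combine M a b c a' b' c' : 0 <= M ->
  a <= 2^-1 * b + 2^-1 * c -> a' <= 2^-1 * b' + 2^-1 * c' ->
  a + M * a' <= 2^-1 * (b + M * b') + 2^-1 * (c + M * c').
Proof. by move=> M0 h1 /(ler_wpM2l M0) h2; lra. Qed.

Lemma mean_le x y t : x <= t -> y <= t -> 2^-1 * x + 2^-1 * y <= t.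
Proof. by lra. Qed.

Lemma drop_nonneg x y g t : 0 <= x -> x + y < g + t -> t <= 1 -> y <= g + 1.
Proof. by lra. Qed.

Lemma split_sqr e x : x <= e ^+ 2 / 2 -> 3 * (e ^+ 2 / 6) + x <= e ^+ 2.
Proof. by lra. Qed.

Lemma transfer_energy A x y e t g : A + x <= g + t -> y <= x + e / 2 -> t <= e / 2 ->
  A <= g - y + e.
Proof. by lra. Qed.

Lemma recombine A x y g : A <= g - y -> x <= y -> A + x <= g.
Proof. by lra. Qed.

End RealAuxiliaries.

Section Existence.
Context (R : realType) (alpha1 alpha2 q M : R).
Hypotheses (alpha1_gt0 : 0 < alpha1) (alpha2_gt0 : 0 < alpha2).
Hypotheses (q_gt1 : 1 < q) (M_gt0 : 0 < M).
Local Notation T := (measurableTypeR R * measurableTypeR R)%type.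
Local Notation mf f := (measurable_fun [set: T] f).
Local Notation mu := (muO R).
Local Notation H10 := (H10 alpha1 alpha2).
Local Notation aform := (aform alpha1 alpha2).
Local Notation U := (U alpha1 alpha2 q).
Local Notation J := (J alpha1 alpha2 q M).
Local Notation Iq := (Iq q).
Local Notation Nq := (Nq q).
Local Notation fin_q := (fin_q q).
Implicit Types (f g u v V : R * R -> R).

Let q_gt0 : 0 < q. Proof. exact: lt_trans q_gt1. Qed.

(** The numerator of J, which is homogeneous of degree 2. *)
Definition energy u : R := aform u u + M * Nq u.

Lemma energy_ge0 u : H10 u -> 0 <= energy u.
Proof.
move=> Hu; rewrite addr_ge0 ?aform_ge0// mulr_ge0 ?Nq_ge0// ltW//.
Qed.

Lemma energyZ u c : H10 u -> fin_q u -> energy (fun z => c * u z) = c ^+ 2 * energy u.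
Proof.
move=> Hu fu; rewrite /energy (aformZ alpha1_gt0 alpha2_gt0 c Hu).
have [_ ->] := NqZ q_gt1 c fu; ring.
Qed.

Lemma exists_nonzero_test : exists phi : R * R -> R, test_function phi /\ 0 < N2 mu phi.
Proof.
apply: contrapT => H.
have : (cst 1 : R * R -> R) = cst 0 %[ae mu].
  apply: fundamental_lemma; first exact: (L2_loc_integrable (L2_cst (muO_fin R) 1)).
  move=> phi tp; have Lp := test_L2 tp.
  have n0 : N2 mu phi = 0.
    apply/eqP; rewrite eq_le N2_ge0 andbT leNgt; apply/negP => n0.
    by apply: H; exists phi.
  have := cauchy_schwarz (L2_cst (muO_fin R) 1) Lp.
  by rewrite n0 mulr0 normr_le0 => /eqP.
move=> E1; have E : N2 mu (cst 1) = N2 mu (cst 0).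
  by apply: N2_ae; [exact: measurable_cst|exact: measurable_cst|exact: E1].
by move: E; rewrite N2_cst1 N2_0 => /eqP; rewrite oner_eq0.
Qed.

Definition sphere u := [/\ H10 u, fin_q u & N2 mu u = 1].

Lemma normalise u : H10 u -> fin_q u -> 0 < N2 mu u ->
  sphere (fun z => (N2 mu u)^-1 * u z).
Proof.
move=> Hu fu n0; split; [exact: H10Z|by have [] := NqZ q_gt1 (N2 mu u)^-1 fu|].
have Lu := H10_L2 Hu; rewrite N2Z// ger0_norm ?invr_ge0 ?N2_ge0//.
by rewrite mulVf// gt_eqF.
Qed.

Let S := [set energy u | u in sphere].

Lemma sphere_energy_inf : has_inf S.
Proof.
split; last by exists 0 => _ [u [Hu _ _] <-]; exact: energy_ge0.
have [phi [tp n0]] := exists_nonzero_test.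
have /(UP _ _ q_gt1) [Hp fp] := test_U alpha1_gt0 alpha2_gt0 q_gt1 tp.
by exists (energy (fun z => (N2 mu phi)^-1 * phi z)), (fun z => (N2 mu phi)^-1 * phi z);
  first exact: normalise.
Qed.

Definition ground : R := inf S.

Lemma ground_le u : sphere u -> ground <= energy u.
Proof.
move=> Su; apply: ge_inf; last by exists u.
by have [] := sphere_energy_inf.
Qed.

Lemma ground_energy u : H10 u -> fin_q u -> ground * N2 mu u ^+ 2 <= energy u.
Proof.
move=> Hu fu; have := N2_ge0 mu u; rewrite le_eqVlt => /orP[/eqP n0|n0].
  by rewrite -n0 expr0n/= mulr0; exact: energy_ge0.
have := ground_le (normalise Hu fu n0); rewrite energyZ//.
by rewrite exprVn ler_pdivlMl ?exprn_gt0// mulrC.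
Qed.

Lemma sphere_mid u v : sphere u -> sphere v -> sphere (mid u v) /\
  energy (mid u v) <= 2^-1 * energy u + 2^-1 * energy v.
Proof.
move=> [Hu fu nu] [Hv fv nv].
have Lu := H10_L2 Hu; have Lv := H10_L2 Hv.
have [mu' iu] := Lu; have [mv iv] := Lv.
have [Hm am] := mid_H10 alpha1_gt0 alpha2_gt0 Hu Hv.
have [fm nm] := mid_q q_gt1 mu' mv fu fv.
split.
  split=> //; apply/eqP; rewrite -(@eqrXn2 _ 2) ?N2_ge0// expr1n N2_sqr.
  have -> : (fun z => mid u v z ^+ 2) = (fun z => 2^-1 * u z ^+ 2 + 2^-1 * v z ^+ 2).
    by apply/funext => z; rewrite mid_sqr.
  rewrite intD; [|exact: intbleZ|exact: intbleZ].
  by rewrite (intZ _ iu) (intZ _ iv) -!N2_sqr nu nv; apply/eqP; field.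
exact: mean_combine (ltW M_gt0) am nm.
Qed.

(** Integrates defect_control at the values u^2 and v^2, since
    (|u| - |v|)^2 <= |u^2 - v^2|. *)
Lemma defect_L1 (e : R) : 0 < e -> exists2 C : R, 0 <= C & forall u v, sphere u -> sphere v ->
  N2 mu (fun z => `|u z| - `|v z|) ^+ 2 <=
  3 * e + C * (2^-1 * Iq u + 2^-1 * Iq v - Iq (mid u v)).
Proof.
move=> e0; have [C C0 HC] := defect_control q_gt1 e0; exists C => // u v.
move=> [Hu fu nu] [Hv fv nv].
have Lu := H10_L2 Hu; have Lv := H10_L2 Hv.
have [mu' iu] := Lu; have [mv iv] := Lv.
have [fm _] := mid_q q_gt1 mu' mv fu fv.
have Ld := L2B (L2_norm Lu) (L2_norm Lv).
rewrite N2_sqr.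
have i1 : intble mu (cst e) by exact: (finite_cst (muO_fin R)).
have iuv := intbleD iu iv.
have i2 := intbleZ e iuv.
have i12 := intbleD i1 i2.
have iq := intbleD (intbleZ 2^-1 fu) (intbleZ 2^-1 fv).
have iD := intbleB iq fm.
have iCD := intbleZ C iD.
have H : \int[mu]_z ((`|u z| - `|v z|) ^+ 2) <=
    \int[mu]_z ((cst e z + e * (u z ^+ 2 + v z ^+ 2)) +
      C * (2^-1 * (u z ^+ 2) `^ q + 2^-1 * (v z ^+ 2) `^ q - (mid u v z ^+ 2) `^ q)).
  apply: int_le; [by case: Ld|exact: (intbleD i12 iCD)|move=> z].
  apply: (le_trans _ (le_trans (HC _ _ (sqr_ge0 (u z)) (sqr_ge0 (v z))) _)); last first.
    rewrite /defect mid_sqr.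
    rewrite (_ : (u z ^+ 2 + v z ^+ 2) / 2 = 2^-1 * u z ^+ 2 + 2^-1 * v z ^+ 2).
      by rewrite (mulrDr e) mulr1.
    by rewrite mulrDl ![_ / 2]mulrC.
  rewrite -[X in _ <= `|X - _|](real_normK (num_real (u z))).
  rewrite -[X in _ <= `|_ - X|](real_normK (num_real (v z))).
  exact: sqr_dist_le.
apply: le_trans H _.
rewrite (intD i12 iCD) (intD i1 i2) (intZ C iD) (intZ e iuv) (intD iu iv) (intB iq fm).
rewrite (intD (intbleZ 2^-1 fu) (intbleZ 2^-1 fv)) (intZ _ fu) (intZ _ fv).
rewrite -(N2_sqr mu u) -(N2_sqr mu v) nu nv Rintegral_cst// muOT/=.
by rewrite lerD2r le_eqVlt; apply/orP; left; apply/eqP; ring.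
Qed.

Lemma powR_continuous (d s : R) : 0 < d -> {for d, continuous (fun x => x `^ s)}.
Proof. by move=> d0; exact: is_derive_continuous1 (is_derive1_powR s d0). Qed.

Lemma powR_cvg (x : nat -> R) (l s : R) : 0 < l -> x @ \oo --> l ->
  (fun n => x n `^ s) @ \oo --> l `^ s.
Proof.
move=> l0 xl; apply: (@cvg_comp _ _ _ x (fun y : R => y `^ s) _ (nbhs l) _ xl).
exact: powR_continuous.
Qed.

Lemma Iq_lsc (f : nat -> R * R -> R) (w : R * R -> R) (B : R) :
  (forall n, L2 mu (f n)) -> L2 mu w -> (forall n, fin_q (f n)) ->
  (forall n, N2 mu (fun z => f n z - w z) <= 2^-1 ^+ n) ->
  (forall n, Iq (f n) <= B) -> fin_q w /\ Iq w <= B.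
Proof.
move=> Lf Lw ff fw fB; have ae := N2_fast_ae Lf Lw fw.
apply: (@fatou_le _ _ _ mu (fun n z => (f n z ^+ 2) `^ q)) => //.
- by apply: measurable_sqr_powR; case: Lw.
- by move=> n z; exact: powR_ge0.
- apply: (ae_imply ae) => z cz; rewrite sqr_powR2.
  under eq_fun do rewrite sqr_powR2.
  have cn : (fun n => `|f n z|) @ \oo --> `|w z| by exact: cvg_norm.
  have [w0|w0] := eqVneq (w z) 0; last first.
    have w0' : 0 < `|w z| by rewrite normr_gt0.
    exact: (powR_cvg w0' cn).
  rewrite w0 normr0 powR0 ?gt_eqF ?mulr_gt0// in cn *.
  apply/cvgrPdist_le => e e0.
  have e1 : 0 < e `^ (2 * q)^-1 by rewrite powR_gt0.
  have /cvgrPdist_le /(_ _ e1) := cn; apply: filterS => n /=.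
  rewrite !sub0r !normrN normr_id => h.
  have q2 : 0 <= 2 * q by rewrite mulr_ge0// ltW.
  rewrite ger0_norm ?powR_ge0//.
  apply: (@le_trans _ _ ((e `^ (2 * q)^-1) `^ (2 * q))).
    by rewrite ge0_ler_powR ?nnegrE ?powR_ge0.
  by rewrite -powRrM mulVf ?powRr1 ?(ltW e0)// gt_eqF// mulr_gt0.
Qed.

(** The sets of almost minimizers of the energy on the sphere are stable under
    mid. Choosing in them almost minimizers of Iq makes its midpoint defect tend
    to 0, so that by defect_L1 the moduli are Cauchy in L^2. The energy of their
    limit is bounded by weak_limit_H10 for the gradient term, and by Fatou for Iq. *)
Lemma exists_ground : exists w, [/\ sphere w, energy w = ground & forall z, 0 <= w z].
Proof.
have half_gt0 n : 0 < (2^-1 : R) ^+ n by rewrite exprn_gt0.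
pose K (n : nat) u := sphere u /\ energy u <= ground + 2^-1 ^+ n.
pose B := ((ground + 1) / M) `^ q.
have [||||u [d [Ku dB ud um]]] := @nested_min R _ K Iq (@mid R) B.
- move=> n u [Su Eu]; split=> //; apply: le_trans Eu _.
  by rewrite lerD2l ler_wiXn2l//; exact: half_le1.
- move=> n e e0; have [_ [u Su <-] Eu] := inf_adherent (half_gt0 n) sphere_energy_inf.
  exists u; first by split=> //; exact: ltW.
  have [Hu fu nu] := Su; have a0 := aform_ge0 Hu.
  have N0 := Nq_ge0 q u.
  have NB : Nq u <= (ground + 1) / M.
    rewrite ler_pdivlMr// mulrC.
    have p1 : (2^-1 : R) ^+ n <= 1 by rewrite exprn_ile1//; exact: half_le1.
    move: Eu; rewrite /energy -/ground => Eu.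
    exact: drop_nonneg a0 Eu p1.
  apply: (@le_trans _ _ B); last by rewrite lerDl ltW.
  rewrite -Nq_powR// /B ge0_ler_powR ?nnegrE ?(ltW q_gt0)//.
  exact: le_trans N0 NB.
- by move=> u; exact: Iq_ge0.
- move=> n u v [Su Eu] [Sv Ev]; have [Sm Em] := sphere_mid Su Sv.
  split; [exact: Sm|exact: le_trans Em (mean_le Eu Ev)].
have Su n : sphere (u n) by case: (Ku n).
have Hu n : H10 (u n) by case: (Su n).
have fu n : fin_q (u n) by case: (Su n).
have nu n : N2 mu (u n) = 1 by case: (Su n).
pose v n z := `|u n z|.
have Lv n : L2 mu (v n) by exact: L2_norm (H10_L2 (Hu n)).
have vcauchy (e : R) : 0 < e -> exists n0, forall n m, (n0 <= n)%N -> (n0 <= m)%N ->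
    N2 mu (fun z => v n z - v m z) <= e.
  move=> e0; have e1 : 0 < e ^+ 2 / 6 by rewrite divr_gt0// exprn_gt0.
  have [C C0 HC] := defect_L1 e1.
  have e2 : 0 < e ^+ 2 / 2 / (C + 1) by rewrite !divr_gt0 ?exprn_gt0// ltr_wpDl.
  have [N HN] := um _ e2; exists N => n m Nn Nm.
  rewrite -(@ler_pXn2r _ 2) ?nnegrE ?N2_ge0 ?(ltW e0)//.
  apply: le_trans (HC _ _ (Su n) (Su m)) _.
  have := HN n m Nn Nm.
  move=> /(ler_wpM2l C0) HD; apply: split_sqr; apply: le_trans HD _.
  rewrite mulrA ler_pdivrMr ?ltr_wpDl// mulrC ler_wpM2l ?divr_ge0 ?sqr_ge0//.
  by rewrite lerDl.
have [w' Lw' vw'] := L2_complete (muO_fin R) Lv vcauchy.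
pose w z := `|w' z|.
have Lw : L2 mu w by exact: L2_norm.
have vw (e : R) : 0 < e -> exists n0, forall n, (n0 <= n)%N ->
    N2 mu (fun z => v n z - w z) <= e.
  move=> e0; have [n0 Hn0] := vw' e e0; exists n0 => n /Hn0; apply: le_trans.
  apply: N2_le; [exact: (L2B (Lv n) Lw)|exact: (L2B (Lv n) Lw')|move=> z].
  have := ler_dist_dist (v n z) (w' z).
  by rewrite /v normr_id.
have fv n : fin_q (v n).
  by apply: intble_ext (fu n) => z; rewrite /v real_normK ?num_real.
have Iv n : Iq (v n) = Iq (u n).
  by congr Rintegral; apply/funext => z; rewrite /v real_normK ?num_real.
have [Hv av] : (forall n, H10 (v n)) /\ (forall n, aform (v n) (v n) <= aform (u n) (u n)).
  by split=> n; have [] := abs_H10 alpha1_gt0 alpha2_gt0 (Hu n).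
have nw : N2 mu w = 1.
  have c1 := N2_limit 0 Lv Lw vw.
  apply: (cvg_unique (@Rhausdorff R) c1).
  apply: cvg_near_cst; apply: nearW => n.
  by rewrite -(nu n) /v N2_norm.
have fwI (e : R) : 0 < e -> fin_q w /\ Iq w <= d + e.
  move=> e0; have [N1 HN1] := ud e e0.
  have Hn k : exists n, N2 mu (fun z => v n z - w z) <= 2^-1 ^+ k /\ (N1 <= n)%N.
    have [N2' HN2] := vw _ (half_gt0 k); exists (maxn N1 N2').
    by split; [apply: HN2; rewrite leq_maxr|rewrite leq_maxl].
  have [s /all_and2 [Hs1 Hs2]] := choice Hn.
  apply: (@Iq_lsc (fun k => v (s k))) => //.
  move=> k; rewrite Iv; have := HN1 _ (Hs2 k); rewrite ler_distl => /andP[_].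
  by [].
have [fw _] := fwI 1 ltr01.
have Iw : Iq w <= d by apply/ler_addgt0Pr => e /fwI [].
have d1 : 1 <= d.
  apply/ler_addgt0Pr => e e0; have [N HN] := ud e e0.
  have := HN N (leqnn N); rewrite ler_distl => /andP[_].
  by apply: le_trans; apply: Iq_ge1 => //; exact: H10_L2.
have d0 : 0 < d by exact: lt_le_trans d1.
have Nud : (fun n => Nq (u n)) @ \oo --> d `^ q^-1.
  have cd : (fun n => Iq (u n)) @ \oo --> d.
    apply/cvgrPdist_le => e e0; have [N HN] := ud e e0.
    by exists N => // n /= Nn; rewrite distrC; exact: HN.
  exact: (powR_cvg d0 cd).
have [Hw aw] : H10 w /\ aform w w <= ground - M * d `^ q^-1.
  apply: (weak_limit_H10 alpha1_gt0 alpha2_gt0) => // e e0.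
  have e2 : 0 < e / 2 by rewrite divr_gt0.
  have eM : 0 < e / 2 / M by rewrite divr_gt0.
  have /cvgrPdist_le /(_ _ eM) [N1 _ HN1] := Nud.
  have [N2' HN2] := vw e e0; have [N3 HN3] := half_small e2.
  pose n := maxn N1 (maxn N2' N3).
  have n1 : (N1 <= n)%N by rewrite leq_maxl.
  have n2 : (N2' <= n)%N by rewrite /n maxnCA leq_maxl.
  have n3 : (N3 <= n)%N by rewrite /n maxnA leq_maxr.
  exists (v n); split; [exact: Hv|exact: HN2|apply: le_trans (av n) _].
  have := HN1 n n1; rewrite /= ler_distl => /andP[_ h1].
  have h2 := HN3 n n3; have [_ h3] := Ku n.
  have : M * d `^ q^-1 <= M * Nq (u n) + e / 2.
    have := ler_wpM2l (ltW M_gt0) h1; rewrite mulrDr => h5; apply: le_trans h5 _.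
    by rewrite lerD2l mulrC divfK// gt_eqF.
  move=> h4; exact: transfer_energy h3 h4 h2.
have Sw : sphere w by split.
exists w; split=> //.
  apply/eqP; rewrite eq_le ground_le// andbT /energy.
  have : Nq w <= d `^ q^-1.
    by rewrite ge0_ler_powR ?nnegrE ?Iq_ge0 ?(ltW d0)// invr_ge0 ltW.
  by move=> /(ler_wpM2l (ltW M_gt0)); exact: recombine aw.
by move=> z; rewrite /w.
Qed.

Lemma J_energy u : fin_q u -> J u = energy u / N2 mu u ^+ 2.
Proof. exact: JE. Qed.

Lemma J_unit u (g : R) : fin_q u -> N2 mu u = 1 -> energy u = g -> J u = g.
Proof. by move=> fu nu <-; rewrite (J_energy fu) nu expr1n divr1. Qed.

Lemma ground_minimizer u : J_minimizer alpha1 alpha2 q M u ->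
  [/\ H10 u, fin_q u, 0 < N2 mu u & energy u = ground * N2 mu u ^+ 2].
Proof.
move=> [/(UP _ _ q_gt1) [Hu fu] nz mini].
have n0 := (nonzeroP (H10_L2 Hu)).1 nz; split; [exact: Hu|exact: fu|exact: n0|].
apply/eqP; rewrite eq_le ground_energy// andbT.
have [w [[Hw fw nw] Ew _]] := exists_ground.
have Uw : U w by apply/(UP _ _ q_gt1).
have nzw : nonzero w by apply/(nonzeroP (H10_L2 Hw)); rewrite nw.
have := mini w Uw nzw; rewrite (J_energy fu) (J_unit fw nw Ew).
by rewrite ler_pdivrMr// exprn_gt0.
Qed.

Lemma exists_minimizer : exists u, J_minimizer alpha1 alpha2 q M u.
Proof.
have [w [[Hw fw nw] Ew _]] := exists_ground; exists w; split.
- exact/(UP _ _ q_gt1).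
- by apply/(nonzeroP (H10_L2 Hw)); rewrite nw.
- move=> v /(UP _ _ q_gt1) [Hv fv] nz.
  have n0 := (nonzeroP (H10_L2 Hv)).1 nz.
  rewrite (J_energy fv) (J_unit fw nw Ew) ler_pdivlMr ?exprn_gt0//.
  exact: ground_energy.
Qed.

Lemma J_ground u : J_minimizer alpha1 alpha2 q M u -> J u = ground.
Proof.
move=> /ground_minimizer [Hu fu n0 E].
by rewrite (J_energy fu) E mulfK// gt_eqF// exprn_gt0.
Qed.

End Existence.

(** * The potential built on a minimizer *)

Section PathAuxiliaries.
Context (R : realType).
Implicit Types a b c d e f g q t x : R.

Lemma tangent_chain q a b c d x y t i : 0 < q -> 0 <= c ->
  a + q * d * (x - y) <= b -> b - a <= q * t * i -> c * (d * (x - y)) <= c * (t * i).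
Proof.
move=> q0 c0 h1 h2; apply: ler_wpM2l => //.
by rewrite -(ler_pM2l q0) !mulrA; apply: le_trans h2; rewrite lerBrDl.
Qed.

Lemma powR_cancel m x q : 0 < x -> m * x `^ (1 - q) * x `^ (q - 1) = m.
Proof.
move=> x0; rewrite -mulrA -powRD; last by rewrite (gt_eqF x0) implybT.
by rewrite (_ : 1 - q + (q - 1) = 0) ?powRr0 ?mulr1//; ring.
Qed.

Lemma combine_chain m c d x y t i : c * d = m -> c * (d * (x - y)) <= c * (t * i) ->
  m * x <= m * y + t * (c * i).
Proof. by move=> <-; lra. Qed.

Lemma slope_combine t a b c d e f g : a <= b + t * e -> c <= d + t * f ->
  b + d + t * g <= a + c -> t * g <= t * (e + f).
Proof. by rewrite mulrDr; lra. Qed.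

Lemma trunc_cvg (x : R) : 0 <= x ->
  (fun n : nat => n.+1%:R * x / (n.+1%:R + x)) @ \oo --> x.
Proof.
move=> x0.
have -> : (fun n : nat => n.+1%:R * x / (n.+1%:R + x)) =
    (fun n : nat => x / (1 + harmonic n * x)).
  apply/funext => n /=; have n0 : (0 : R) < n.+1%:R by rewrite ltr0n.
  have nx : (0 : R) < n.+1%:R + x by rewrite ltr_pwDl.
  have E : 1 + n.+1%:R^-1 * x = (n.+1%:R + x) / n.+1%:R.
    by rewrite mulrDl mulfV ?gt_eqF// [x / _]mulrC.
  by rewrite E invf_div mulrA [x * _]mulrC.
rewrite -[X in _ --> X]mulr1; apply: cvgM; first exact: cvg_cst.
rewrite -[X in _ --> X]invr1; apply: cvgV; first exact: oner_neq0.
rewrite -[X in _ --> X]addr0; apply: cvgD; first exact: cvg_cst.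
by rewrite -(mul0r x); apply: cvgM; [exact: cvg_harmonic|exact: cvg_cst].
Qed.

End PathAuxiliaries.

Section OptimalPotential.
Context (R : realType) (alpha1 alpha2 p q M : R).
Hypotheses (alpha1_gt0 : 0 < alpha1) (alpha2_gt0 : 0 < alpha2).
Hypotheses (p_gt1 : 1 < p) (q_gt1 : 1 < q) (pq : p^-1 + q^-1 = 1) (M_gt0 : 0 < M).
Local Notation T := (measurableTypeR R * measurableTypeR R)%type.
Local Notation mf f := (measurable_fun [set: T] f).
Local Notation mu := (muO R).
Local Notation H10 := (H10 alpha1 alpha2).
Local Notation aform := (aform alpha1 alpha2).
Local Notation Iq := (Iq q).
Local Notation Nq := (Nq q).
Local Notation fin_q := (fin_q q).
Local Notation ground := (ground alpha1 alpha2 q M).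
Implicit Types (f g u v V : R * R -> R).

Let q_gt0 : 0 < q. Proof. exact: lt_trans q_gt1. Qed.
Let p_gt0 : 0 < p. Proof. exact: lt_trans p_gt1. Qed.

Lemma conj_mul : p * (q - 1) = q.
Proof.
have p0 : p != 0 by rewrite gt_eqF.
have q0 : q != 0 by rewrite gt_eqF.
have E : p + q = p * q.
  transitivity (p * q * (p^-1 + q^-1)); last by rewrite pq mulr1.
  by field; rewrite p0 q0.
by rewrite mulrBr mulr1 -E addrAC subrr add0r.
Qed.

Lemma conj_mul1 : (q - 1) * (p - 1) = 1.
Proof. by have := conj_mul; lra. Qed.

Lemma powR_cvg_ge0 (x : nat -> R) (l s : R) : 0 < s -> (forall n, 0 <= x n) -> 0 <= l ->
  x @ \oo --> l -> (fun n => x n `^ s) @ \oo --> l `^ s.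
Proof.
move=> s0 x0; rewrite le_eqVlt => /orP[/eqP <-|l0] xl; last exact: powR_cvg xl.
rewrite powR0 ?gt_eqF//; apply/cvgrPdist_le => e e0.
have e1 : 0 < e `^ s^-1 by rewrite powR_gt0.
have /cvgrPdist_le /(_ _ e1) := xl; apply: filterS => n /=.
rewrite !sub0r !normrN !ger0_norm ?powR_ge0// => h.
apply: (@le_trans _ _ ((e `^ s^-1) `^ s)).
  by rewrite ge0_ler_powR ?nnegrE ?powR_ge0 ?(ltW s0).
by rewrite -powRrM mulVf ?gt_eqF// powRr1// ltW.
Qed.

Lemma young_q (c x : R) : 0 <= c -> 0 <= x ->
  q * (c `^ (q - 1) * x) <= x `^ q + (q - 1) * c `^ q.
Proof.
move=> c0 x0; have := tangent_powR q_gt1 x0 c0.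
by have := mulr_powRB1 c0 q_gt0; move: (c `^ (q - 1)) => d <-; nra.
Qed.

Lemma intble_powR_mul u v : mf u -> mf v -> fin_q u -> fin_q v ->
  intble mu (fun z => (u z ^+ 2) `^ (q - 1) * v z ^+ 2).
Proof.
move=> mu' mv fu fv.
apply: (@intble_le _ _ _ _ _ (fun z : T => q^-1 * ((v z ^+ 2) `^ q + (q - 1) * (u z ^+ 2) `^ q))).
- by apply: measurable_funM; [exact: measurable_sqr_powR|exact: measurable_funX].
- move=> z; have v0 := sqr_ge0 (v z); rewrite ger0_norm; last first.
    exact: mulr_ge0 (powR_ge0 _ _) v0.
  by rewrite ler_pdivlMl//; exact: young_q (sqr_ge0 _) v0.
- exact: (intbleZ q^-1 (intbleD fv (intbleZ (q - 1) fu))).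
Qed.

Section minimizer.
Variable u0 : R * R -> R.
Hypotheses (Hu0 : H10 u0) (fu0 : fin_q u0) (n0 : 0 < N2 mu u0).

Let Lu0 := H10_L2 Hu0.
Let mu0 : mf u0. Proof. by case: Lu0. Qed.

Lemma Iq_gt0 : 0 < Iq u0.
Proof.
rewrite lt_neqAle Iq_ge0 andbT; apply/eqP => /esym I0.
have : (fun z => (u0 z ^+ 2) `^ q) = cst 0 %[ae mu].
  apply: int_eq0_ae.
  - exact: fu0.
  - by apply: aeW => z; exact: powR_ge0.
  - by rewrite -/(Iq u0) I0.
move=> E; have : u0 = cst 0 %[ae mu].
  apply: (ae_imply E) => z + zT => /(_ zT) /powR_eq0_eq0 /eqP.
  by rewrite sqrf_eq0 => /eqP.
exact: (nonzeroP Lu0).2 n0.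
Qed.

Lemma Nq_gt0 : 0 < Nq u0. Proof. by rewrite powR_gt0// Iq_gt0. Qed.

Let c0 : R := M * Nq u0 `^ (1 - q).
Let c0_gt0 : 0 < c0. Proof. by rewrite mulr_gt0// powR_gt0// Nq_gt0. Qed.

(** V_of q M u0 written in the square variable; V0^(p - 1) is proportional to
    u0^2, which is the equality case in the inequality of Hoelder. *)
Definition V0 (z : R * R) : R := c0 * (u0 z ^+ 2) `^ (q - 1).

Lemma V_of_V0 : V_of q M u0 = V0.
Proof. by apply/funext => z; rewrite V_ofE. Qed.

Lemma V0_ge0 z : 0 <= V0 z.
Proof. by rewrite mulr_ge0 ?powR_ge0// ltW. Qed.

Lemma measurable_V0 : mf V0.
Proof. by apply: measurable_funM => //; exact: measurable_sqr_powR. Qed.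

Lemma V0_p z : V0 z `^ p = c0 `^ p * (u0 z ^+ 2) `^ q.
Proof. by rewrite powRM ?powR_ge0 ?(ltW c0_gt0)// -powRrM mulrC [_ * p]mulrC conj_mul mulrC. Qed.

Lemma V0_p1 z : V0 z `^ (p - 1) = c0 `^ (p - 1) * u0 z ^+ 2.
Proof.
rewrite powRM ?powR_ge0 ?(ltW c0_gt0)// -powRrM conj_mul1 powRr1//.
exact: sqr_ge0.
Qed.

Lemma c0_p : c0 `^ p * Iq u0 = M `^ p.
Proof.
rewrite powRM ?powR_ge0 ?(ltW M_gt0)// -(Nq_powR q_gt1) -mulrA -powRrM -powRD; last first.
  by rewrite (gt_eqF Nq_gt0) implybT.
rewrite (_ : (1 - q) * p + q = 0) ?powRr0 ?mulr1//.
by have := conj_mul; lra.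
Qed.

Lemma c0_Iq : c0 * Iq u0 = M * Nq u0.
Proof.
rewrite -(Nq_powR q_gt1) -mulrA -powRD; last by rewrite (gt_eqF Nq_gt0) implybT.
by rewrite subrK powRr1// ltW// Nq_gt0.
Qed.

Lemma V0_int v : mf v -> fin_q v -> intble mu (fun z => V0 z * v z ^+ 2).
Proof.
move=> mv fv; have := intbleZ c0 (intble_powR_mul mu0 mv fu0 fv).
by apply: intble_ext => z; rewrite mulrA.
Qed.

Lemma V0_u0 : \int[mu]_z (V0 z * u0 z ^+ 2) = M * Nq u0.
Proof.
rewrite -c0_Iq -intZ//; congr Rintegral; apply/funext => z.
by rewrite -mulrA [_ `^ _ * _]mulrC mulr_powRB1// sqr_ge0.
Qed.

Lemma V0_Ip : intble mu (fun z => V0 z `^ p) /\ \int[mu]_z (V0 z `^ p) = M `^ p.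
Proof.
have E : (fun z => V0 z `^ p) = (fun z => c0 `^ p * (u0 z ^+ 2) `^ q).
  by apply/funext => z; exact: V0_p.
by rewrite E; split; [exact: intbleZ|rewrite intZ// c0_p].
Qed.

Lemma SpP V : Sp p M V -> [/\ mf V, intble mu (fun z => `|V z| `^ p),
  \int[mu]_z (`|V z| `^ p) <= M `^ p & {ae mu, forall z, 0 <= V z}].
Proof.
move=> [LV V_ge0 nV]; have mV : mf V.
  by move: LV; rewrite inE => /andP[]; rewrite inE.
have iV := (integral_powR_lty mu mV p_gt0).1 LV.
split=> //.
have I0 : 0 <= \int[mu]_z (`|V z| `^ p) by apply: int_ge0 => z; exact: powR_ge0.
move: nV; rewrite /normL (LnormE iV) => nV.
rewrite -[leLHS](powRr1 I0) -(mulVf (_ : p != 0)) ?gt_eqF// powRrM.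
by rewrite ge0_ler_powR ?nnegrE ?powR_ge0 ?(ltW p_gt0) ?(ltW M_gt0).
Qed.

Lemma Sp_V0 : Sp p M V0.
Proof.
have nE : (fun z => `|V0 z| `^ p) = (fun z => V0 z `^ p).
  by apply/funext => z; rewrite ger0_norm ?V0_ge0.
have [iV EV] := V0_Ip.
have iV' : intble mu (fun z => `|V0 z| `^ p) by rewrite nE.
split.
- exact/(integral_powR_lty mu measurable_V0 p_gt0).
- by apply: aeW => z; exact: V0_ge0.
- rewrite /normL (LnormE iV') nE EV -powRrM mulfV ?gt_eqF// powRr1// ltW//.
Qed.

Lemma young_pq (a b : R) : 0 <= a -> 0 <= b -> a * b <= p^-1 * a `^ p + q^-1 * b `^ q.
Proof.
by move=> a0 b0; rewrite ![_^-1 * _]mulrC; exact: conjugate_powR.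
Qed.

Lemma Sp_int V v : Sp p M V -> mf v -> fin_q v -> intble mu (fun z => V z * v z ^+ 2).
Proof.
move=> /SpP[mV iV _ _] mv fv.
apply: (@intble_le _ _ _ _ _ (fun z : T => p^-1 * `|V z| `^ p + q^-1 * (v z ^+ 2) `^ q)).
- by apply: measurable_funM => //; exact: measurable_funX.
- move=> z; rewrite normrM [X in _ * X]ger0_norm ?sqr_ge0//.
  by apply: young_pq => //; exact: sqr_ge0.
- exact: (intbleD (intbleZ p^-1 iV) (intbleZ q^-1 fv)).
Qed.

(** d is the gap in the tangent inequality of x^p at V0. As V0^(p - 1) is a
    multiple of u0^2, the linear term integrates to the difference of the
    integrals of V u0^2 and V0 u0^2, and V0 saturates the constraint on the norm. *)
Lemma Sp_defect V : Sp p M V ->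
  let d z := `|V z| `^ p - (V0 z `^ p + p * V0 z `^ (p - 1) * (`|V z| - V0 z)) in
  [/\ forall z, 0 <= d z, intble mu d &
   \int[mu]_z d z <= p * c0 `^ (p - 1) *
     (M * Nq u0 - \int[mu]_z (V z * u0 z ^+ 2))].
Proof.
move=> SV d; have [mV iV IV Vpos] := SpP SV.
have [i0 E0] := V0_Ip.
have iVu := Sp_int SV mu0 fu0.
have iV0u := V0_int mu0 fu0.
have Vabs : (fun z => `|V z| * u0 z ^+ 2) = (fun z => V z * u0 z ^+ 2) %[ae mu].
  by apply: (ae_imply Vpos) => z Vz _; rewrite ger0_norm.
have mVa : mf (fun z => `|V z| * u0 z ^+ 2).
  by apply: measurable_funM; [exact: measurableT_comp|exact: measurable_funX].
have iVa : intble mu (fun z => `|V z| * u0 z ^+ 2).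
  apply: intble_ae iVu => //.
  by apply: (ae_imply Vpos) => z Vz _; rewrite ger0_norm.
have EVa : \int[mu]_z (`|V z| * u0 z ^+ 2) = \int[mu]_z (V z * u0 z ^+ 2).
  by apply: int_ae => //; exact: intble_measurable iVu.
pose K := p * c0 `^ (p - 1).
have dE : d = (fun z => `|V z| `^ p - (V0 z `^ p +
   K * (`|V z| * u0 z ^+ 2 - V0 z * u0 z ^+ 2))).
  apply/funext => z; rewrite /d V0_p1 /K.
  by congr (_ - (_ + _)); ring.
have iB := intbleB iVa iV0u; have iK := intbleZ K iB; have i0K := intbleD i0 iK.
have id := intbleB iV i0K.
split.
- by move=> z; rewrite subr_ge0 tangent_powR// V0_ge0.
- by rewrite dE.
- rewrite dE (intB iV i0K) (intD i0 iK) (intZ K iB) (intB iVa iV0u) EVa E0 V0_u0.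
  move: IV; rewrite -/K.
  have aux (a b m n k : R) : a <= m -> a - (m + k * (b - n)) <= k * (n - b) by lra.
  by move=> IV; exact: aux.
Qed.

Lemma Sp_le V : Sp p M V -> \int[mu]_z (V z * u0 z ^+ 2) <= M * Nq u0.
Proof.
move=> /Sp_defect [d0 _ H].
have := le_trans (int_ge0 mu d0) H.
by rewrite pmulr_rge0 ?subr_ge0// mulr_gt0// powR_gt0.
Qed.

(** When V does as well as V0 the gap of Sp_defect vanishes, and strict convexity
    forces V = V0. *)
Lemma Sp_eq V : Sp p M V -> M * Nq u0 <= \int[mu]_z (V z * u0 z ^+ 2) ->
  V = V0 %[ae mu].
Proof.
move=> SV HV; have [_ _ _ Vpos] := SpP SV; have [d0 id Hd] := Sp_defect SV.
have I0 : \int[mu]_z (`|V z| `^ p - (V0 z `^ p + p * V0 z `^ (p - 1) * (`|V z| - V0 z))) <= 0.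
  apply: le_trans Hd _; rewrite pmulr_rle0 ?subr_le0//.
  by rewrite mulr_gt0// powR_gt0.
have E : (fun z => `|V z| `^ p - (V0 z `^ p + p * V0 z `^ (p - 1) * (`|V z| - V0 z)))
    = cst 0 %[ae mu].
  by apply: int_eq0_ae id _ I0; apply: aeW => z; exact: d0.
apply: (ae_imply2 E Vpos) => z Ez Vz zT.
rewrite -(ger0_norm Vz); apply: (tangent_powR_eq p_gt1) => //; first exact: V0_ge0.
by rewrite -subr_le0 (Ez zT).
Qed.

Hypothesis E0 : energy alpha1 alpha2 q M u0 = ground * N2 mu u0 ^+ 2.

(** A path from u0 that is affine in the square variable. *)
Definition wt_path (t : R) v := hypot u0 (fun z => Num.sqrt t * v z).

Lemma path_sqr t v z : 0 <= t -> wt_path t v z ^+ 2 = u0 z ^+ 2 + t * v z ^+ 2.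
Proof. by move=> t0; rewrite hypot_sqr exprMn sqr_sqrtr. Qed.

Lemma fin_q_path t v : 0 <= t -> mf v -> fin_q v -> fin_q (wt_path t v).
Proof.
move=> t0 mv fv.
have [fs _] := NqZ q_gt1 (Num.sqrt t) fv.
have msv : mf (fun z => Num.sqrt t * v z) by exact: measurable_funM.
have [] := minkowski_q q_gt1 fu0 fs (measurable_funX 2 mu0) (measurable_funX 2 msv)
  (fun z => sqr_ge0 _) (fun z => sqr_ge0 _).
by move=> H _; apply: intble_ext H => z; rewrite hypot_sqr.
Qed.

(** By minimality of u0 the energy grows along the path at least as fast as
    ground * N2^2. The growth of the gradient term is at most t (aform v v) by
    hypot_H10, and tangent inequalities bound that of Nq. *)
Lemma path_slope t v : 0 < t -> H10 v -> fin_q v ->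
  ground * N2 mu v ^+ 2 <= aform v v +
    c0 * \int[mu]_z ((wt_path t v z ^+ 2) `^ (q - 1) * v z ^+ 2).
Proof.
move=> t0 Hv fv; have Lv := H10_L2 Hv; have [mv iv] := Lv; have [_ iu] := Lu0.
set w := wt_path t v.
have fw : fin_q w by apply: fin_q_path => //; exact: ltW.
have [Hw aw] : H10 w /\ aform w w <= aform u0 u0 + t * aform v v.
  have := hypot_H10 alpha1_gt0 alpha2_gt0 Hu0 (H10Z alpha1_gt0 alpha2_gt0 (Num.sqrt t) Hv).
  by rewrite (aformZ alpha1_gt0 alpha2_gt0 _ Hv) (sqr_sqrtr (ltW t0)).
have [mw _] := H10_L2 Hw.
have iI := intble_powR_mul mw mv fw fv.
set I := \int[mu]_z _.
have nw : N2 mu w ^+ 2 = N2 mu u0 ^+ 2 + t * N2 mu v ^+ 2.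
  rewrite !N2_sqr -(intZ _ iv) -(intD iu (intbleZ t iv)); congr Rintegral.
  by apply/funext => z; rewrite (path_sqr v z (ltW t0)).
have IqI : Iq w - Iq u0 <= q * t * I.
  rewrite -(intB fw fu0) -(intZ _ iI); apply: int_le.
  - exact: (intbleB fw fu0).
  - exact: intbleZ.
  - move=> z; have := tangent_powR q_gt1 (sqr_ge0 (u0 z)) (sqr_ge0 (w z)).
    rewrite {2}/w (path_sqr v z (ltW t0)).
    move: ((w z ^+ 2) `^ q) ((w z ^+ 2) `^ (q - 1)) ((u0 z ^+ 2) `^ q) => A B C.
    rewrite (_ : u0 z ^+ 2 - (u0 z ^+ 2 + t * v z ^+ 2) = - (t * v z ^+ 2)); last by ring.
    rewrite mulrN -/(A - _) => h; rewrite lerBlDr -lerBlDl.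
    apply: le_trans h; rewrite le_eqVlt; apply/orP; left; apply/eqP; ring.
have NqI : M * Nq w <= M * Nq u0 + t * (c0 * I).
  have N0 := Nq_gt0.
  have h := tangent_powR q_gt1 (Nq_ge0 q w) (ltW N0).
  rewrite [X in X + _](Nq_powR q_gt1) [X in _ <= X](Nq_powR q_gt1) in h.
  exact: combine_chain (powR_cancel M q N0) (tangent_chain q_gt0 (ltW c0_gt0) h IqI).
have h := ground_energy alpha1_gt0 alpha2_gt0 q_gt1 M_gt0 Hw fw.
rewrite nw (mulrDr ground) -E0 in h.
have : t * (ground * N2 mu v ^+ 2) <= t * (aform v v + c0 * I).
  rewrite /energy (mulrCA ground) in h.
  exact: (slope_combine aw NqI h).
by rewrite (ler_pM2l t0).
Qed.

Lemma measurable_path t v : H10 v -> mf (wt_path t v).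
Proof.
move=> Hv.
have [Hw _] := hypot_H10 alpha1_gt0 alpha2_gt0 Hu0 (H10Z alpha1_gt0 alpha2_gt0 (Num.sqrt t) Hv).
by have [] := H10_L2 Hw.
Qed.

(** Letting t tend to 0 in path_slope. *)
Lemma ground_V0_fin v : H10 v -> fin_q v ->
  ground * N2 mu v ^+ 2 <= aform v v + \int[mu]_z (V0 z * v z ^+ 2).
Proof.
move=> Hv fv; have [mv _] := H10_L2 Hv.
pose t n : R := harmonic n.
have t0 n : 0 < t n by rewrite /t /= invr_gt0 ltr0n.
have t1 n : t n <= 1 by rewrite /t /= invf_le1 ?ler1n ?ltr0n.
have q1 : 0 < q - 1 by rewrite subr_gt0.
pose f n z := (wt_path (t n) v z ^+ 2) `^ (q - 1) * v z ^+ 2.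
have m2 : mf (fun z => v z ^+ 2) by exact: measurable_funX.
have [gi cv] : intble mu (fun z => (u0 z ^+ 2) `^ (q - 1) * v z ^+ 2) /\
    (fun n => \int[mu]_z f n z) @ \oo --> \int[mu]_z ((u0 z ^+ 2) `^ (q - 1) * v z ^+ 2).
  apply: (@dominated_le _ _ _ mu f _ (fun z : T => (wt_path 1 v z ^+ 2) `^ (q - 1) * v z ^+ 2)).
  - move=> n; apply: measurable_funM => //; apply: measurable_sqr_powR.
    exact: measurable_path.
  - by apply: measurable_funM => //; exact: measurable_sqr_powR.
  - by apply: intble_powR_mul; [exact: measurable_path|exact: mv|exact: fin_q_path|exact: fv].
  - move=> n z; have f0 : 0 <= f n z := mulr_ge0 (powR_ge0 _ _) (sqr_ge0 _).
    rewrite (ger0_norm f0).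
    apply: ler_wpM2r; first exact: sqr_ge0.
    rewrite ge0_ler_powR ?nnegrE ?sqr_ge0 ?(ltW q1)//.
    rewrite (path_sqr v z (ltW (t0 n))) (path_sqr v z ler01) lerD2l.
    by apply: ler_wpM2r (t1 n); exact: sqr_ge0.
  - apply: aeW => z; apply: cvgM; last exact: cvg_cst.
    apply: (powR_cvg_ge0 q1) => [n||]; [exact: sqr_ge0|exact: sqr_ge0|].
    have -> : (fun n => wt_path (t n) v z ^+ 2) = (fun n => u0 z ^+ 2 + t n * v z ^+ 2).
      by apply/funext => n; exact: path_sqr (ltW (t0 n)).
    rewrite -[X in _ --> X]addr0; apply: cvgD; first exact: cvg_cst.
    by rewrite -(mul0r (v z ^+ 2)); apply: cvgM; [exact: cvg_harmonic|exact: cvg_cst].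
have E : \int[mu]_z (V0 z * v z ^+ 2) = c0 * \int[mu]_z ((u0 z ^+ 2) `^ (q - 1) * v z ^+ 2).
  by rewrite -(intZ c0 gi); congr Rintegral; apply/funext => z; rewrite mulrA.
rewrite E.
have cl : (fun n => aform v v + c0 * \int[mu]_z f n z) @ \oo -->
    aform v v + c0 * \int[mu]_z ((u0 z ^+ 2) `^ (q - 1) * v z ^+ 2).
  apply: cvgD; first exact: cvg_cst.
  by apply: cvgM; first exact: cvg_cst.
apply: (cvgr_to_ge cl); apply: nearW => n; exact: path_slope (t0 n) Hv fv.
Qed.

(** The truncations of |v| are bounded, hence of finite Iq, and both terms on the
    right decrease under truncation. *)
Lemma ground_V0 v : H10 v -> intble mu (fun z => V0 z * v z ^+ 2) ->
  ground * N2 mu v ^+ 2 <= aform v v + \int[mu]_z (V0 z * v z ^+ 2).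
Proof.
move=> Hv iv; have Lv := H10_L2 Hv; have [mv i2] := Lv.
pose a z := `|v z|.
have a0 z : 0 <= a z by exact: normr_ge0.
have a2 z : a z ^+ 2 = v z ^+ 2 by rewrite real_normK ?num_real.
have [Ha aa] := abs_H10 alpha1_gt0 alpha2_gt0 Hv; rewrite -/a in Ha aa.
pose k n : R := n.+1%:R; have k0 n : 0 < k n by rewrite ltr0n.
pose w n := trunc (k n) a.
have w0 n z : 0 <= w n z by exact: trunc_ge0.
have Hw n : H10 (w n) /\ aform (w n) (w n) <= aform a a.
  exact: (trunc_H10 alpha1_gt0 alpha2_gt0 (k0 n) Ha a0).
have mw n : mf (w n) by have [/H10_L2 []] := Hw n.
have fw n : fin_q (w n).
  apply: (@fin_q_bounded _ q q_gt1 _ (k n)) => // z.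
  by rewrite ger0_norm//; exact: trunc_lek.
have w2 n z : w n z ^+ 2 <= v z ^+ 2.
  by rewrite -a2 lerXn2r ?nnegrE//; exact: trunc_le.
have wc z : (fun n => w n z ^+ 2) @ \oo --> v z ^+ 2.
  rewrite -a2; apply: cvg_sqr; exact: trunc_cvg.
have V0w n : \int[mu]_z (V0 z * w n z ^+ 2) <= \int[mu]_z (V0 z * v z ^+ 2).
  apply: int_le => //; first exact: V0_int.
  by move=> z; apply: ler_wpM2l (w2 n z); exact: V0_ge0.
have dom n z : `|w n z ^+ 2| <= v z ^+ 2 by rewrite ger0_norm ?sqr_ge0.
have wa : {ae mu, forall z, (fun n => w n z ^+ 2) @ \oo --> v z ^+ 2}.
  by apply: aeW => z; exact: wc.
have [_ cv] := @dominated_le _ _ _ mu (fun n z => w n z ^+ 2) (fun z => v z ^+ 2)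
  (fun z => v z ^+ 2) (fun n => measurable_funX 2 (mw n)) (measurable_funX 2 mv) i2
  dom wa.
have cl : (fun n => ground * \int[mu]_z (w n z ^+ 2)) @ \oo -->
    ground * \int[mu]_z (v z ^+ 2).
  by apply: cvgM; first exact: cvg_cst.
rewrite N2_sqr; apply: (cvgr_to_le cl); apply: nearW => n; rewrite -N2_sqr.
have [Hwn awn] := Hw n.
apply: le_trans (ground_V0_fin Hwn (fw n)) _.
exact: lerD (le_trans awn aa) (V0w n).
Qed.

End minimizer.
End OptimalPotential.

(** * The first eigenvalue and its quadratic form *)

Section QuadraticAuxiliaries.
Context (R : realType).
Implicit Types b c t : R.

Lemma linear_dominates b c : (forall t, 0 <= 2 * t * b + t ^+ 2 * c) -> b = 0.
Proof.
move=> H; have c0 : 0 < `|c| + 1 by rewrite ltr_wpDl.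
apply/eqP/negPn/negP => b0.
have := H (- b / (`|c| + 1)).
have cle : c <= `|c| + 1 by rewrite (le_trans (ler_norm c))// lerDl.
have b2 : 0 < b ^+ 2 / (`|c| + 1) by rewrite divr_gt0// exprn_even_gt0.
have E1 : 2 * (- b / (`|c| + 1)) * b = - 2 * (b ^+ 2 / (`|c| + 1)) by ring.
have E2 : (- b / (`|c| + 1)) ^+ 2 * c = b ^+ 2 / (`|c| + 1) * (c / (`|c| + 1)).
  by rewrite mulNr sqrrN !expr2; ring.
rewrite E1 E2; have : c / (`|c| + 1) <= 1 by rewrite ler_pdivrMr// mul1r.
by move: (c / _) (b ^+ 2 / _) b2 => x y y0 x1; nra.
Qed.

End QuadraticAuxiliaries.

Section Spectrum.
Context (R : realType) (alpha1 alpha2 : R).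
Hypotheses (alpha1_gt0 : 0 < alpha1) (alpha2_gt0 : 0 < alpha2).
Local Notation T := (measurableTypeR R * measurableTypeR R)%type.
Local Notation mf f := (measurable_fun [set: T] f).
Local Notation mu := (muO R).
Local Notation H10 := (H10 alpha1 alpha2).
Local Notation H0 := (H0 alpha1 alpha2).
Local Notation aform := (aform alpha1 alpha2).
Local Notation lambda1 := (lambda1 alpha1 alpha2).
Implicit Types (f g u v V w : R * R -> R).

Section potential.
Variable V : R * R -> R.
Hypotheses (mV : mf V) (V_ge0 : {ae mu, forall z, 0 <= V z}).

Lemma H0P u : H0 V u <-> H10 u /\ intble mu (fun z => V z * u z ^+ 2).
Proof.
split=> -[Hu]; have [mu' _] := H10_L2 Hu.
all: have mVu : mf (fun z => V z * u z ^+ 2) by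
  apply: measurable_funM => //; exact: measurable_funX.
all: have E : (\int[mu]_z `|(V z * u z ^+ 2)%:E| = \int[mu]_z (V z * u z ^+ 2)%:E)%E.
1,3: apply: ae_eq_integral => //;
  [by apply: measurableT_comp => //; exact/measurable_EFinP|exact/measurable_EFinP|];
  apply: (ae_imply V_ge0) => z Vz _; congr EFin; rewrite ger0_norm//;
  by rewrite mulr_ge0// sqr_ge0.
- move=> fin; split=> //; apply/integrableP; split; first exact/measurable_EFinP.
  by rewrite E.
- by move=> /integrableP[_ fin]; split=> //; rewrite -E.
Qed.

Lemma V_int_ge0 u : H0 V u -> 0 <= \int[mu]_z (V z * u z ^+ 2).
Proof.
move=> /H0P[_ iu]; have i0 : intble mu (cst 0) by exact: (finite_cst (muO_fin R)).
have := int_le_ae i0 iu; rewrite Rintegral_cst// mul0r; apply.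
by apply: (ae_imply V_ge0) => z Vz; rewrite mulr_ge0// sqr_ge0.
Qed.

Lemma lambda1_le u : H0 V u -> nonzero u ->
  lambda1 V * N2 mu u ^+ 2 <= aform u u + \int[mu]_z (V z * u z ^+ 2).
Proof.
move=> Hu nz; have /H0P[H _] := Hu.
have n0 := (nonzeroP (H10_L2 H)).1 nz.
rewrite -ler_pdivlMr ?exprn_gt0//; apply: ge_inf; last first.
  by exists u; [split|rewrite N2_sqr].
exists 0 => _ [v [Hv _] <-]; have /H0P[Hv' _] := Hv.
by rewrite divr_ge0 ?addr_ge0 ?aform_ge0 ?V_int_ge0// int_ge0// => z; exact: sqr_ge0.
Qed.

Lemma lambda1_ge u (m : R) : H0 V u -> nonzero u ->
  (forall v, H0 V v -> m * N2 mu v ^+ 2 <= aform v v + \int[mu]_z (V z * v z ^+ 2)) ->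
  m <= lambda1 V.
Proof.
move=> Hu nz Hm; apply: lb_le_inf.
  by exists ((aform u u + \int[mu]_z (V z * u z ^+ 2)) / \int[mu]_z (u z ^+ 2)), u.
move=> _ [v [Hv nv] <-]; have /H0P[Hv' _] := Hv.
have n0 := (nonzeroP (H10_L2 Hv')).1 nv.
by rewrite -N2_sqr ler_pdivlMr ?exprn_gt0//; exact: Hm.
Qed.

Lemma intble_VM u v : H0 V u -> H0 V v -> intble mu (fun z => V z * u z * v z).
Proof.
move=> /H0P[Hu iu] /H0P[Hv iv].
have [mu' _] := H10_L2 Hu; have [mv _] := H10_L2 Hv.
apply: (@intble_le _ _ _ _ _ (fun z : T => `|V z * u z ^+ 2| + `|V z * v z ^+ 2|)).
- by do 2 apply: measurable_funM => //.
- move=> z; rewrite !normrM -mulrA -mulrDr ler_wpM2l ?normr_ge0//.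
  by move: `|u z| `|v z| (normr_ge0 (u z)) (normr_ge0 (v z)) => a b; nra.
- exact: (intbleD (intble_norm iu) (intble_norm iv)).
Qed.

Lemma V_sqr_lin u v (c d : R) z : V z * (c * u z + d * v z) ^+ 2 =
  c ^+ 2 * (V z * u z ^+ 2) + (2 * c * d * (V z * u z * v z) + d ^+ 2 * (V z * v z ^+ 2)).
Proof. by ring. Qed.

Lemma H0_lin u v (c d : R) : H0 V u -> H0 V v -> H0 V (fun z => c * u z + d * v z).
Proof.
move=> Hu Hv; have iuv := intble_VM Hu Hv.
have /H0P[Hu' iu] := Hu; have /H0P[Hv' iv] := Hv.
apply/H0P; split; first exact: H10_lin.
have := intbleD (intbleZ (c ^+ 2) iu) (intbleD (intbleZ (2 * c * d) iuv) (intbleZ (d ^+ 2) iv)).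
by apply: intble_ext => z; rewrite V_sqr_lin.
Qed.

Section form.
Variable m : R.

(** The eigenvalue equation at level m says that form u vanishes on H0. *)
Definition form u v : R :=
  aform u v + \int[mu]_z (V z * u z * v z) - m * \int[mu]_z (u z * v z).

Lemma form_sqr u : form u u =
  aform u u + \int[mu]_z (V z * u z ^+ 2) - m * N2 mu u ^+ 2.
Proof.
have E : (fun z => V z * u z * u z) = (fun z => V z * u z ^+ 2).
  by apply/funext => z; rewrite -mulrA.
by rewrite /form E N2_sqr.
Qed.

Lemma form_lin2 u v (c d : R) : H0 V u -> H0 V v ->
  form (fun z => c * u z + d * v z) (fun z => c * u z + d * v z) =
  c ^+ 2 * form u u + 2 * c * d * form u v + d ^+ 2 * form v v.
Proof.
move=> Hu Hv; have iuv := intble_VM Hu Hv.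
have /H0P[Hu' iu] := Hu; have /H0P[Hv' iv] := Hv.
have Lu := H10_L2 Hu'; have Lv := H10_L2 Hv'.
have [_ i2u] := Lu; have [_ i2v] := Lv; have i2uv := L2M Lu Lv.
have EV : \int[mu]_z (V z * (c * u z + d * v z) ^+ 2) =
    c ^+ 2 * \int[mu]_z (V z * u z ^+ 2) + (2 * c * d * \int[mu]_z (V z * u z * v z) +
    d ^+ 2 * \int[mu]_z (V z * v z ^+ 2)).
  have iZ := intbleZ (2 * c * d) iuv; have iW := intbleZ (d ^+ 2) iv.
  rewrite -(intZ (c ^+ 2) iu) -(intZ _ iuv) -(intZ _ iv) -(intD iZ iW).
  rewrite -(intD (intbleZ (c ^+ 2) iu) (intbleD iZ iW)).
  by congr Rintegral; apply/funext => z; exact: V_sqr_lin.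
have EN : N2 mu (fun z => c * u z + d * v z) ^+ 2 =
    c ^+ 2 * N2 mu u ^+ 2 + (2 * c * d * \int[mu]_z (u z * v z) + d ^+ 2 * N2 mu v ^+ 2).
  have iZ := intbleZ (2 * c * d) i2uv; have iW := intbleZ (d ^+ 2) i2v.
  rewrite !N2_sqr -(intZ (c ^+ 2) i2u) -(intZ _ i2uv) -(intZ _ i2v) -(intD iZ iW).
  rewrite -(intD (intbleZ (c ^+ 2) i2u) (intbleD iZ iW)).
  by congr Rintegral; apply/funext => z; ring.
rewrite !form_sqr EV EN (aform_lin2 alpha1_gt0 alpha2_gt0 c d Hu' Hv') /form.
have aux (a1 a2 a3 b1 b2 b3 c1 c2 c3 : R) :
  c ^+ 2 * a1 + 2 * c * d * a2 + d ^+ 2 * a3 +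
  (c ^+ 2 * b1 + (2 * c * d * b2 + d ^+ 2 * b3)) -
  m * (c ^+ 2 * c1 + (2 * c * d * c2 + d ^+ 2 * c3)) =
  c ^+ 2 * (a1 + b1 - m * c1) + 2 * c * d * (a2 + b2 - m * c2) +
  d ^+ 2 * (a3 + b3 - m * c3) by ring.
exact: aux.
Qed.

Hypothesis form_ge0 : forall v, H0 V v -> 0 <= form v v.

(** A nonnegative quadratic form is stationary at its zeros. *)
Lemma form_null u v : H0 V u -> form u u = 0 -> H0 V v -> form u v = 0.
Proof.
move=> Hu Qu Hv; apply: (@linear_dominates _ _ (form v v)) => t.
have := form_ge0 (H0_lin 1 t Hu Hv).
by rewrite (form_lin2 1 t Hu Hv) Qu mulr0 add0r mulr1.
Qed.

Definition null u := H0 V u /\ form u u = 0.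

Lemma null_lin u v (c d : R) : null u -> null v -> null (fun z => c * u z + d * v z).
Proof.
move=> [Hu Qu] [Hv Qv]; split; first exact: H0_lin.
by rewrite (form_lin2 c d Hu Hv) Qu (form_null Hu Qu Hv) Qv !mulr0 !addr0.
Qed.

(** Taking the modulus preserves the integrals and does not increase aform. *)
Lemma null_abs u : null u -> null (fun z => `|u z|).
Proof.
move=> [Hu Qu]; have /H0P[Hu' iu] := Hu.
have E2 z : `|u z| ^+ 2 = u z ^+ 2 by rewrite real_normK ?num_real.
have [Ha aa] := abs_H10 alpha1_gt0 alpha2_gt0 Hu'.
have EV : (fun z => V z * `|u z| ^+ 2) = (fun z => V z * u z ^+ 2).
  by apply/funext => z; rewrite E2.
have Ha0 : H0 V (fun z => `|u z|) by apply/H0P; rewrite EV.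
split; first exact: Ha0.
apply/eqP; rewrite eq_le (form_ge0 Ha0) andbT -Qu.
rewrite (form_sqr u) (form_sqr (fun z => `|u z|)) EV (N2_norm mu u).
by rewrite lerD2r lerD2r.
Qed.

End form.
End potential.
End Spectrum.

(** * The logarithmic gradient estimate *)

Section LogAuxiliaries.
Context (R : realType).
Implicit Types a b c d e f k s w x y K X Y : R.

Lemma quot_deriv D e d x k : 0 < k -> e * k + x ^+ 2 / k * D = 2 * x * d ->
  e = 2 * d * (x / k) - (x / k) ^+ 2 * D.
Proof.
move=> k0 H; have kn : k != 0 by rewrite gt_eqF.
apply: (mulIf kn); rewrite mulrBl (_ : e * k = 2 * x * d - x ^+ 2 / k * D); last first.
  by rewrite -H; ring.
by field.
Qed.

(** The equation is the derivative of quot * k = x^2; the cross term is absorbed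
    by half of the square. *)
Lemma log_pointwise D e d x k w : 0 < k -> e * k + x ^+ 2 / k * D = 2 * x * d ->
  (w * D) * (w * e) <= 2 * (w * d) ^+ 2 - 2^-1 * (x * (w * D) / k) ^+ 2.
Proof.
move=> k0 H; rewrite (quot_deriv k0 H) (_ : x * (w * D) / k = w * D * (x / k)); last by ring.
move: (x / k) => y.
have : 0 <= (w * (D * y - 2 * d)) ^+ 2 by exact: sqr_ge0.
rewrite -subr_ge0 => h; rewrite -subr_ge0; rewrite subr0 in h.
have -> : 2 * (w * d) ^+ 2 - 2^-1 * (w * D * y) ^+ 2 -
  w * D * (w * (2 * d * y - y ^+ 2 * D)) = 2^-1 * (w * (D * y - 2 * d)) ^+ 2
  by field.
by rewrite mulr_ge0// invr_ge0.
Qed.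

Lemma quot_bound D e d x k c w : 0 < c -> c <= k -> 0 <= x -> x <= 1 ->
  e * k + x ^+ 2 / k * D = 2 * x * d ->
  `|w * e| <= 0 + (`|2 / c * (w * d)| + `|c ^- 2 * (w * D)|).
Proof.
move=> c0 ck x0 x1 H; have k0 := lt_le_trans c0 ck.
have xk : x / k <= c^-1.
  by rewrite ler_pdivrMr// (le_trans x1)// ler_pdivlMl// mulr1.
have xk0 : 0 <= x / k by rewrite divr_ge0// ltW.
have Ee : w * e = 2 * (x / k) * (w * d) - (x / k) ^+ 2 * (w * D).
  by rewrite (quot_deriv k0 H); ring.
rewrite add0r Ee; apply: le_trans (ler_normB _ _) _.
rewrite !(normrM _ (w * _)); apply: lerD; apply: ler_wpM2r => //.
  have h1 : 0 <= 2 * (x / k) by rewrite mulr_ge0.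
  have h2 : 0 <= 2 / c by rewrite divr_ge0// ltW.
  by rewrite (ger0_norm h1) (ger0_norm h2); apply: ler_wpM2l.
have h1 : 0 <= (x / k) ^+ 2 by exact: sqr_ge0.
have h2 : 0 <= c ^- 2 by rewrite invr_ge0 exprn_ge0// ltW.
rewrite (ger0_norm h1) (ger0_norm h2) -exprVn.
by rewrite lerXn2r ?nnegrE ?invr_ge0 ?(ltW c0).
Qed.

Lemma log_combine a b c d e f s K X Y : a <= 2 * c - 2^-1 * X + s ->
  b <= 2 * d - 2^-1 * Y + s -> 0 <= a + b + e -> e <= f + 1 -> s <= 2^-1 ->
  0 <= X -> 0 <= Y -> K = 4 * (c + d) + 2 * f + 4 -> X <= K /\ Y <= K.
Proof. by move=> *; split; lra. Qed.

Lemma le_sum_succ x y : 0 <= x -> 0 <= y -> x <= x + y + 1 /\ y <= x + y + 1.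
Proof. by move=> *; split; lra. Qed.

Lemma frac_le1 e x : 0 < e -> 0 <= x -> x / (e + x) <= 1.
Proof. by move=> e0 x0; rewrite ler_pdivrMr ?ltr_pwDl// mul1r lerDr ltW. Qed.

End LogAuxiliaries.

Section LogEstimate.
Context (R : realType) (alpha1 alpha2 : R).
Hypotheses (alpha1_gt0 : 0 < alpha1) (alpha2_gt0 : 0 < alpha2).
Local Notation T := (measurableTypeR R * measurableTypeR R)%type.
Local Notation mf f := (measurable_fun [set: T] f).
Local Notation mu := (muO R).
Local Notation H10 := (H10 alpha1 alpha2).
Local Notation aform := (aform alpha1 alpha2).
Local Notation grad := (grad alpha1 alpha2).
Local Notation grd := (grd alpha1 alpha2).
Local Notation ip := (ip alpha1 alpha2).
Local Notation wt := (wt alpha1 alpha2).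
Local Notation Et := (Et alpha1 alpha2).
Implicit Types (f g u v V w phi chi : R * R -> R).

Section quotient.
Variables (e : R) (phi chi : R * R -> R).
Hypotheses (e0 : 0 < e) (tp : test_function phi) (p0 : forall z, 0 <= phi z).
Hypotheses (tc : test_function chi) (c0 : forall z, 0 <= chi z) (c1 : forall z, chi z <= 1).

Let k z := e + phi z.
Let k_gt0 z : 0 < k z. Proof. by rewrite ltr_pwDl. Qed.

(** Tested in the equation, this function yields the gradient of ln (e + phi). *)
Definition quot z : R := chi z ^+ 2 / (e + phi z).

Lemma smooth_shift : smooth k.
Proof. by apply: smoothD; [exact: smooth_cst|exact: test_smooth]. Qed.

Lemma test_quot : test_function quot.
Proof.
have t2 := testMl tc (test_smooth tc).
exact: (testMl t2 (smooth_inv smooth_shift k_gt0)).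
Qed.

Lemma quot_ge0 z : 0 <= quot z.
Proof. by rewrite divr_ge0 ?sqr_ge0// (ltW (k_gt0 z)). Qed.

Lemma quot_le z : quot z <= e^-1.
Proof.
rewrite /quot ler_pdivrMr ?k_gt0// ler_pdivlMl//; apply: (@le_trans _ _ e); last first.
  by rewrite lerDl.
by rewrite ger_pMr//; exact: exprn_ile1 (c0 z) (c1 z).
Qed.

Lemma D_quot b z : 'D_(dir R b) quot z * k z + chi z ^+ 2 / k z * 'D_(dir R b) phi z
  = 2 * chi z * 'D_(dir R b) chi z.
Proof.
have sc := test_smooth tc; have sq := test_smooth test_quot.
rewrite -(D_sqr b z sc) -[X in _ + _ * X = _](D_addc b e z (test_smooth tp)).
rewrite -/k -[chi z ^+ 2 / k z]/(quot z) -(DM b z sq smooth_shift).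
have -> : (fun z => quot z * k z) = (fun z => chi z ^+ 2) => //.
by apply/funext => y; rewrite /quot divfK// gt_eqF// k_gt0.
Qed.

(** The weighted gradient of ln (e + phi), localised by chi. *)
Definition log_grad b z : R := chi z * grad b phi z / (e + phi z).

Lemma log_grad_L2 b : L2 mu (log_grad b).
Proof.
have Lg := grad_L2 alpha1_gt0 alpha2_gt0 b tp.
apply: (L2_le _ _ (L2Z e^-1 Lg)).
  have [mg _] := Lg; have [mc _] := test_L2 tc.
  apply: measurable_funM; first exact: measurable_funM.
  exact: smooth_measurable (smooth_inv smooth_shift k_gt0).
move=> z; rewrite /log_grad -mulrA [_ * (_ / _)]mulrCA [X in _ <= X]normrM normrM mulrC.
apply: ler_wpM2r => //; rewrite -[chi z / _]/(chi z / k z).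
rewrite !ger0_norm ?divr_ge0 ?invr_ge0 ?(ltW e0) ?(ltW (k_gt0 z))//.
rewrite ler_pdivrMr// ler_pdivlMl//; apply: (@le_trans _ _ e); last by rewrite lerDl.
by rewrite ger_pMr.
Qed.

Lemma grad_quot_mul b z : grad b phi z * grad b quot z <=
  2 * grad b chi z ^+ 2 - 2^-1 * log_grad b z ^+ 2.
Proof.
rewrite /log_grad !gradE; exact: log_pointwise (k_gt0 z) (D_quot b z).
Qed.

Lemma N2_grad_quot b (K : R) : N2 mu (grad b phi) <= K ->
  N2 mu (grad b quot) <= 0 + (2 / e * N2 mu (grad b chi) + e ^- 2 * K).
Proof.
move=> HK; have Lc := grad_L2 alpha1_gt0 alpha2_gt0 b tc; have Lp := grad_L2 alpha1_gt0 alpha2_gt0 b tp.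
have e1 : 0 <= 2 / e by rewrite divr_ge0// ltW.
have e2 : 0 <= e ^- 2 by rewrite invr_ge0 exprn_ge0// ltW.
apply: (N2_le_sum3 (grad_L2 alpha1_gt0 alpha2_gt0 b test_quot) (L2Z (2 / e) Lc) (L2Z (e ^- 2) Lp)).
- by [].
- move=> z; rewrite !gradE.
  apply: (quot_bound _ e0 _ (c0 z) (c1 z) (D_quot b z)).
  by rewrite lerDl.
- by rewrite (N2Z _ Lc) (ger0_norm e1).
- by rewrite (N2Z _ Lp) (ger0_norm e2); exact: ler_wpM2l.
Qed.

End quotient.

Section supersolution.
Variables (V w : R * R -> R).
Hypotheses (mV : mf V) (iV : intble mu V) (V_ge0 : forall z, 0 <= V z).
Hypotheses (Hw : H10 w) (w0 : forall z, 0 <= w z).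
Hypothesis iw : intble mu (fun z => V z * w z ^+ 2).
Hypothesis super : forall v, test_function v -> (forall z, 0 <= v z) ->
  0 <= aform w v + \int[mu]_z (V z * w z * v z).

Lemma nonneg_approx_seq : exists phi : nat -> R * R -> R, forall n,
  [/\ forall z, 0 <= phi n z, test_function (phi n),
      N2 mu (fun z => phi n z - w z) <= 2^-1 ^+ n &
      forall b, N2 mu (fun z => grad b (phi n) z - grd w b z) <= 2^-1 ^+ n].
Proof.
have H n : exists phi, [/\ forall z, 0 <= phi z, test_function phi,
    N2 mu (fun z => phi z - w z) <= 2^-1 ^+ n &
    forall b, N2 mu (fun z => grad b phi z - grd w b z) <= 2^-1 ^+ n].
  have p0 : 0 < (2^-1 : R) ^+ n by rewrite exprn_gt0.
  have [phi [h1 h2 h3 h4]] := nonneg_approx alpha1_gt0 alpha2_gt0 Hw w0 p0.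
  by exists phi; split; [exact: h1|exact: h2|exact: h3|exact: h4].
by have [phi Hphi] := choice H; exists phi.
Qed.

Lemma ip_test v b : test_function v ->
  ip w v b = \int[mu]_z (grd w b z * grad b v z).
Proof.
move=> tv; have [mw _] := H10_grd_L2 b Hw.
have [mv _] := H10_grd_L2 b (H10_test alpha1_gt0 alpha2_gt0 tv).
have [mg _] := grad_L2 alpha1_gt0 alpha2_gt0 b tv.
rewrite ipE; apply: int_ae; [exact: measurable_funM|exact: measurable_funM|].
apply: (ae_imply (grd_test alpha1_gt0 alpha2_gt0 b tv)) => z h zT.
by rewrite (h zT).
Qed.

Lemma ip_quot_le (e s : R) phi chi b : 0 < e ->
  test_function phi -> (forall z, 0 <= phi z) ->
  test_function chi -> (forall z, 0 <= chi z) -> (forall z, chi z <= 1) ->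
  N2 mu (fun z => grad b phi z - grd w b z) * N2 mu (grad b (quot e phi chi)) <= s ->
  ip w (quot e phi chi) b <= 2 * N2 mu (grad b chi) ^+ 2 -
    2^-1 * \int[mu]_z (log_grad e phi chi b z ^+ 2) + s.
Proof.
move=> e0 tp p0 tc c0 c1 Hs; have tq := test_quot e0 tp p0 tc.
have Lp := grad_L2 alpha1_gt0 alpha2_gt0 b tp.
have Lc := grad_L2 alpha1_gt0 alpha2_gt0 b tc.
have Lq := grad_L2 alpha1_gt0 alpha2_gt0 b tq.
have Lw := H10_grd_L2 b Hw.
have [_ ic] := Lc; have [_ il] := log_grad_L2 e0 tp p0 tc c0 c1 b.
have ipq := L2M Lp Lq; have Ld := L2B Lp Lw; have idq := L2M Ld Lq.
have E : ip w (quot e phi chi) b = \int[mu]_z (grad b phi z * grad b (quot e phi chi) z) -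
    \int[mu]_z ((grad b phi z - grd w b z) * grad b (quot e phi chi) z).
  rewrite (ip_test b tq) -(intB ipq idq); congr Rintegral; apply/funext => z.
  by rewrite mulrBl opprB addrC subrK.
have I1 : \int[mu]_z (grad b phi z * grad b (quot e phi chi) z) <=
    2 * N2 mu (grad b chi) ^+ 2 - 2^-1 * \int[mu]_z (log_grad e phi chi b z ^+ 2).
  rewrite N2_sqr -(intZ 2 ic) -(intZ 2^-1 il) -(intB (intbleZ 2 ic) (intbleZ 2^-1 il)).
  apply: int_le; [exact: ipq|exact: (intbleB (intbleZ 2 ic) (intbleZ 2^-1 il))|move=> z].
  exact: grad_quot_mul.
rewrite E; apply: lerD; first exact: I1.
apply: le_trans Hs; apply: le_trans (cauchy_schwarz Ld Lq).
by rewrite -normrN; exact: ler_norm.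
Qed.

(** In the limit phi n is replaced by w, and w / (e + w) <= 1. *)
Lemma V_quot_limit (e : R) chi (phi : nat -> R * R -> R) : 0 < e ->
  (forall n, test_function (phi n)) -> (forall n z, 0 <= phi n z) ->
  (forall n, N2 mu (fun z => phi n z - w z) <= 2^-1 ^+ n) ->
  test_function chi -> (forall z, 0 <= chi z) -> (forall z, chi z <= 1) ->
  exists N, forall n, (N <= n)%N ->
    \int[mu]_z (V z * w z * quot e (phi n) chi z) <= \int[mu]_z (V z * chi z ^+ 2) + 1.
Proof.
move=> e0 tp p0 pw tc c0 c1; have [mw i2] := H10_L2 Hw; have [mc _] := test_L2 tc.
have mVw : mf (fun z => V z * w z) by exact: measurable_funM.
have iVw : intble mu (fun z => V z * w z).
  apply: (@intble_le _ _ _ _ _ (fun z : T => V z + V z * w z ^+ 2)); first exact: mVw.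
    move=> z; rewrite ger0_norm ?mulr_ge0// -[X in _ <= X + _]mulr1 -mulrDr ler_wpM2l//.
    by move: (w z) => x; nra.
  exact: intbleD.
have iVc : intble mu (fun z => V z * chi z ^+ 2).
  apply: (@intble_le _ _ _ _ _ (fun z : T => V z)); [|move=> z|exact: iV].
    by apply: measurable_funM => //; exact: measurable_funX.
  by rewrite ger0_norm ?mulr_ge0 ?sqr_ge0// ler_piMr// exprn_ile1.
have mlim : mf (fun z => V z * w z * quot e w chi z).
  apply: measurable_funM; first exact: mVw.
  rewrite (_ : quot e w chi = fun z => chi z ^+ 2 * (e + w z) `^ (-1)).
    apply: measurable_funM; first exact: measurable_funX.
    by apply: (measurableT_comp (measurable_powR (-1))); exact: measurable_funD.
  by apply/funext => z; rewrite powR_inv1// addr_ge0// ltW.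
have ae := N2_fast_ae (fun n => test_L2 (tp n)) (H10_L2 Hw) pw.
have [il cv] : intble mu (fun z => V z * w z * quot e w chi z) /\
   (fun n => \int[mu]_z (V z * w z * quot e (phi n) chi z)) @ \oo -->
   \int[mu]_z (V z * w z * quot e w chi z).
  apply: (@dominated_le _ _ _ mu (fun n z => V z * w z * quot e (phi n) chi z) _
    (fun z : T => e^-1 * (V z * w z))).
  - move=> n; apply: measurable_funM; first exact: mVw.
    exact: smooth_measurable (test_smooth (test_quot e0 (tp n) (p0 n) tc)).
  - exact: mlim.
  - exact: intbleZ.
  - move=> n z; have q0 := quot_ge0 chi e0 (p0 n) z.
    have Vw0 : 0 <= V z * w z := mulr_ge0 (V_ge0 z) (w0 z).
    rewrite (ger0_norm (mulr_ge0 Vw0 q0)) mulrC; apply: ler_wpM2r; first exact: Vw0.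
    exact: quot_le.
  - apply: (ae_imply ae) => z cz; apply: cvgM; first exact: cvg_cst.
    apply: cvgM; first exact: cvg_cst.
    apply: cvgV; first by rewrite gt_eqF// ltr_pwDl.
    by apply: cvgD => //; exact: cvg_cst.
have lim_le : \int[mu]_z (V z * w z * quot e w chi z) <= \int[mu]_z (V z * chi z ^+ 2).
  apply: int_le; [exact: il|exact: iVc|move=> z].
  rewrite -mulrA ler_wpM2l// mulrCA ler_piMr ?sqr_ge0//.
  exact: frac_le1.
have cle : \int[mu]_z (V z * w z * quot e w chi z) < \int[mu]_z (V z * chi z ^+ 2) + 1.
  by rewrite ltr_pwDr.
have /cvgr_lt /(_ _ cle) [N _ HN] := cv; exists N => n Nn.
exact: ltW (HN n Nn).
Qed.

(** The supersolution inequality tested against chi^2 / (e + phi), where phi is a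
    test function close to w. The bound does not depend on e, by V_quot_limit;
    the error made in replacing w by phi does, which only determines how close
    phi has to be. *)
Lemma log_estimate (e s : R) chi : 0 < e -> 0 < s ->
  test_function chi -> (forall z, 0 <= chi z) -> (forall z, chi z <= 1) ->
  exists phi, [/\ test_function phi, forall z, 0 <= phi z,
    N2 mu (fun z => phi z - w z) <= s &
    forall b, \int[mu]_z (log_grad e phi chi b z ^+ 2) <=
      4 * Et chi + 2 * \int[mu]_z (V z * chi z ^+ 2) + 4].
Proof.
move=> e0 s0 tc c0 c1; have [phi Hphi] := nonneg_approx_seq.
have p0 n z : 0 <= phi n z by have [h _ _ _] := Hphi n; exact: h.
have tp n : test_function (phi n) by have [_ h _ _] := Hphi n.
have pw n : N2 mu (fun z => phi n z - w z) <= 2^-1 ^+ n by have [_ _ h _] := Hphi n.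
have pg n b : N2 mu (fun z => grad b (phi n) z - grd w b z) <= 2^-1 ^+ n.
  by have [_ _ _ h] := Hphi n.
pose B b : R := 2 / e * N2 mu (grad b chi) + e ^- 2 * (N2 mu (grd w b) + 1).
have B0 b : 0 <= B b.
  rewrite addr_ge0 ?mulr_ge0 ?addr_ge0 ?N2_ge0 ?invr_ge0 ?exprn_ge0 ?(ltW e0)//.
have nq n b : N2 mu (grad b (quot e (phi n) chi)) <= B b.
  have := N2_grad_quot e0 (tp n) (p0 n) tc c0 c1 (b := b) (K := N2 mu (grd w b) + 1).
  rewrite add0r; apply.
  apply: le_trans (N2_dist (grad_L2 alpha1_gt0 alpha2_gt0 b (tp n)) (H10_grd_L2 b Hw)) _.
  apply: lerD (lexx _) (le_trans (pg n b) _).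
  by rewrite exprn_ile1//; exact: half_le1.
have BB0 : 0 < B true + B false + 1 by rewrite ltr_wpDl// addr_ge0.
have t0 : 0 < 2^-1 / (B true + B false + 1) by rewrite divr_gt0.
have [N1 HN1] := half_small t0; have [N2' HN2] := half_small s0.
have [N3 HN3] := V_quot_limit e0 tp p0 pw tc c0 c1.
pose n := maxn N1 (maxn N2' N3).
have n1 : (N1 <= n)%N by rewrite leq_maxl.
have n2 : (N2' <= n)%N by rewrite /n maxnCA leq_maxl.
have n3 : (N3 <= n)%N by rewrite /n maxnA leq_maxr.
have tq := test_quot e0 (tp n) (p0 n) tc.
have cs b : N2 mu (fun z => grad b (phi n) z - grd w b z) *
    N2 mu (grad b (quot e (phi n) chi)) <= 2^-1.
  apply: (@le_trans _ _ (2^-1 / (B true + B false + 1) * (B true + B false + 1))).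
    apply: ler_pM; [exact: N2_ge0|exact: N2_ge0| |].
      exact: le_trans (pg n b) (HN1 n n1).
    apply: le_trans (nq n b) _.
    by have [h1 h2] := le_sum_succ (B0 true) (B0 false); case: b.
  by rewrite divfK// gt_eqF.
have q b := ip_quot_le e0 (tp n) (p0 n) tc c0 c1 (cs b).
have X0 b : 0 <= \int[mu]_z (log_grad e (phi n) chi b z ^+ 2).
  by apply: int_ge0 => z; exact: sqr_ge0.
have sup := super tq (quot_ge0 chi e0 (p0 n)).
rewrite (aformE Hw (H10_test alpha1_gt0 alpha2_gt0 tq)) in sup.
exists (phi n); split; [exact: tp|exact: p0|exact: le_trans (pw n) (HN2 n n2)|].
have [Xt Xf] := log_combine (q true) (q false) sup (HN3 n n3) (lexx _) (X0 true) (X0 false)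
  (erefl (4 * Et chi + 2 * \int[mu]_z (V z * chi z ^+ 2) + 4)).
case; [exact: Xt|exact: Xf].
Qed.

End supersolution.
End LogEstimate.

(** * Comparing the means of a function over two sets *)

Section MeanDifference.
Context d (T : measurableType d) (R : realType) (mu : {measure set T -> \bar R}).
Hypothesis mu1 : mu setT = 1%E.
Implicit Types (f p r : T -> R) (A B : set T).

Lemma intble_indicM A f : measurable A -> intble mu f -> intble mu (fun z => \1_A z * f z).
Proof.
move=> mA fi; have mf := intble_measurable fi.
apply: (@intble_le _ _ _ _ _ (fun z => `|f z|)); last exact: intble_norm.
- by apply: measurable_funM => //; exact: measurable_indic.
- by move=> z; rewrite normrM indicE; case: (_ \in _); rewrite ?normr1 ?mul1r// normr0 mul0r.
Qed.

Lemma intble_indic A : measurable A -> intble mu (\1_A : T -> R).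
Proof.
move=> mA; have i1 : intble mu (cst 1) by apply: (@finite_cst _ _ _ mu); rewrite mu1 ltry.
by apply: intble_ext (intble_indicM mA i1) => z; rewrite mulr1.
Qed.

Lemma int_indic_le1 A : measurable A -> \int[mu]_z (\1_A z : R) <= 1.
Proof.
move=> mA; have i1 : intble mu (cst 1) by apply: (@finite_cst _ _ _ mu); rewrite mu1 ltry.
have <- : \int[mu]_z (cst 1 z : R) = 1 by rewrite Rintegral_cst// mu1 mulr1.
apply: int_le; [exact: intble_indic|exact: i1|move=> z].
by rewrite indicE; case: (_ \in _).
Qed.

(** Multiply the pointwise inequality by both indicators, and integrate in z and
    then in z'. *)
Lemma mean_difference A B f p r : measurable A -> measurable B ->
  intble mu f -> intble mu p -> intble mu r ->
  (forall z, 0 <= p z) -> (forall z, 0 <= r z) ->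
  (forall z z', A z -> B z' -> f z <= f z' + p z + r z') ->
  \int[mu]_z (\1_B z : R) * \int[mu]_z (\1_A z * f z) <=
  \int[mu]_z (\1_A z : R) * \int[mu]_z (\1_B z * f z) +
  (\int[mu]_z p z + \int[mu]_z r z).
Proof.
move=> mA mB fi pi ri p0 r0 H.
set a := \int[mu]_z (\1_A z : R); set b := \int[mu]_z (\1_B z : R).
have iA := intble_indic mA; have iB := intble_indic mB.
have iAf := intble_indicM mA fi; have iBf := intble_indicM mB fi.
have a0 : 0 <= a by apply: int_ge0 => z; rewrite indicE.
have a1 : a <= 1 := int_indic_le1 mA.
have b0 : 0 <= b by apply: int_ge0 => z; rewrite indicE.
have b1 : b <= 1 := int_indic_le1 mB.
set P := \int[mu]_z p z; set Q := \int[mu]_z r z.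
have P0 : 0 <= P by exact: int_ge0.
have Q0 : 0 <= Q by exact: int_ge0.
have step z' : B z' -> \int[mu]_z (\1_A z * f z) <= (f z' + r z') * a + P.
  move=> Bz'; rewrite -(intZ _ iA) -(intD (intbleZ _ iA) pi).
  apply: int_le; [exact: iAf|exact: (intbleD (intbleZ _ iA) pi)|move=> z].
  rewrite indicE; case: (boolP (z \in A)) => [/set_mem Az|_]; last first.
    by rewrite mul0r mulr0 add0r.
  by rewrite mul1r mulr1 addrAC; exact: H.
have : \int[mu]_z (\int[mu]_z (\1_A z * f z) * \1_B z) <=
    \int[mu]_z (a * (\1_B z * f z) + (a * r z + P * \1_B z)).
  have i2 := intbleD (intbleZ a ri) (intbleZ P iB).
  apply: int_le; [exact: intbleZ|exact: (intbleD (intbleZ a iBf) i2)|move=> z].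
  rewrite indicE; case: (boolP (z \in B)) => [/set_mem Bz|_]; last first.
    by rewrite !mulr0 mul0r mulr0 addr0 add0r mulr_ge0.
  by rewrite !mulr1 mul1r; apply: le_trans (step _ Bz) _; rewrite mulrDl addrA ![_ * a]mulrC.
rewrite (intZ _ iB) (intD (intbleZ a iBf) (intbleD (intbleZ a ri) (intbleZ P iB))).
rewrite (intD (intbleZ a ri) (intbleZ P iB)) (intZ _ iBf) (intZ _ ri) (intZ _ iB).
rewrite -/a -/b -/P -/Q mulrC => h; apply: le_trans h _.
rewrite lerD2l addrC; apply: lerD; first by rewrite ler_piMr.
by rewrite ler_piMl.
Qed.

End MeanDifference.

Section SliceAverage.
Context (R : realType).
Local Notation T := (measurableTypeR R * measurableTypeR R)%type.
Local Notation mf f := (measurable_fun [set: T] f).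
Local Notation mu := (muO R).
Local Notation mu01 := (@mu01 R).
Implicit Types (g : R * R -> R) (C : R).

Lemma int01_cst (c : \bar R) : (\int[mu01]_s c = c)%E.
Proof.
have := integral_cst mu01 measurableT c => /= ->.
by rewrite -[RHS]mule1; congr (_ * _)%E; exact: mu01T.
Qed.

(** The mass of g on each horizontal line, as a function of the height. *)
Lemma slice1_average g C : mf g -> (forall z, 0 <= g z) -> (forall z, g z <= C) ->
  exists p : R -> R, [/\ forall y, 0 <= p y,
    forall y, (p y)%:E = (\int[mu01]_s (g (s, y))%:E)%E,
    intble mu (fun z : R * R => p z.2) & \int[mu]_z p z.2 = \int[mu]_z g z].
Proof.
move=> mg g0 gC; have C0 : 0 <= C := le_trans (g0 (0, 0)) (gC (0, 0)).
have mgE : measurable_fun [set: T] (EFin \o g) by exact/measurable_EFinP.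
pose P (y : measurableTypeR R) := (\int[mu01]_s (g (s, y))%:E)%E.
have P0 y : (0 <= P y)%E by apply: integral_ge0 => s _; rewrite lee_fin.
have PC y : (P y <= C%:E)%E.
  apply: (@le_trans _ _ (\int[mu01]_s (cst C%:E s))%E).
    apply: ge0_le_integral => //.
    - by move=> s _; rewrite lee_fin.
    - exact: (measurable_comp measurableT _ mgE (measurable_pair2 y)).
    - by move=> s _; rewrite lee_fin.
  by rewrite int01_cst.
have mP : measurable_fun setT P.
  by apply: (@measurable_fun_fubini_tonelli_G _ _ _ _ R mu01 (EFin \o g)) => // z; rewrite lee_fin.
have Pfin y : P y \is a fin_num.
  by rewrite ge0_fin_numE//; exact: le_lt_trans (PC y) (ltry _).
have mp : measurable_fun setT (fine \o P) by exact: measurableT_comp.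
pose p y := fine (P y).
have pE y : (p y)%:E = P y by rewrite fineK.
have p0 y : 0 <= p y by exact: fine_ge0.
have pC y : p y <= C by rewrite -lee_fin pE.
have mp2 : mf (fun z : T => p z.2) by exact: measurableT_comp mp measurable_snd.
have ip : intble mu (fun z : R * R => p z.2).
  by apply: (@bounded_intble _ _ C) => // z; rewrite ger0_norm.
have ig : intble mu g by apply: (@bounded_intble _ _ C) => // z; rewrite ger0_norm.
exists p; split=> //; apply: EFin_inj; rewrite (int_EFin ip) (int_EFin ig) !integral_muO.
have mp2E : measurable_fun [set: T] (fun z : T => (p z.2)%:E) by exact/measurable_EFinP.
have p2E (z : T) : (0 <= (p z.2)%:E)%E by rewrite lee_fin.
have g0E (z : T) : (0 <= (g z)%:E)%E by rewrite lee_fin.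
rewrite (@fubini_tonelli1 _ _ _ _ R mu01 mu01 (fun z : T => (p z.2)%:E) mp2E p2E).
rewrite (@fubini_tonelli2 _ _ _ _ R mu01 mu01 (fun z : T => (g z)%:E) mgE g0E).
rewrite /fubini_F /fubini_G /= int01_cst.
by apply: eq_integral => y _; exact: pE.
Qed.

Lemma slice2_average g C : mf g -> (forall z, 0 <= g z) -> (forall z, g z <= C) ->
  exists p : R -> R, [/\ forall y, 0 <= p y,
    forall x, (p x)%:E = (\int[mu01]_s (g (x, s))%:E)%E,
    intble mu (fun z : R * R => p z.1) & \int[mu]_z p z.1 = \int[mu]_z g z].
Proof.
move=> mg g0 gC; have C0 : 0 <= C := le_trans (g0 (0, 0)) (gC (0, 0)).
have mgE : measurable_fun [set: T] (EFin \o g) by exact/measurable_EFinP.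
pose P (y : measurableTypeR R) := (\int[mu01]_s (g (y, s))%:E)%E.
have P0 y : (0 <= P y)%E by apply: integral_ge0 => s _; rewrite lee_fin.
have PC y : (P y <= C%:E)%E.
  apply: (@le_trans _ _ (\int[mu01]_s (cst C%:E s))%E).
    apply: ge0_le_integral => //.
    - by move=> s _; rewrite lee_fin.
    - exact: (measurable_comp measurableT _ mgE (measurable_pair1 y)).
    - by move=> s _; rewrite lee_fin.
  by rewrite int01_cst.
have mP : measurable_fun setT P.
  by apply: (@measurable_fun_fubini_tonelli_F _ _ _ _ R mu01 (EFin \o g)) => // z; rewrite lee_fin.
have Pfin y : P y \is a fin_num.
  by rewrite ge0_fin_numE//; exact: le_lt_trans (PC y) (ltry _).
have mp : measurable_fun setT (fine \o P) by exact: measurableT_comp.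
pose p y := fine (P y).
have pE y : (p y)%:E = P y by rewrite fineK.
have p0 y : 0 <= p y by exact: fine_ge0.
have pC y : p y <= C by rewrite -lee_fin pE.
have mp2 : mf (fun z : T => p z.1) by exact: measurableT_comp mp measurable_fst.
have ip : intble mu (fun z : R * R => p z.1).
  by apply: (@bounded_intble _ _ C) => // z; rewrite ger0_norm.
have ig : intble mu g by apply: (@bounded_intble _ _ C) => // z; rewrite ger0_norm.
exists p; split=> //; apply: EFin_inj; rewrite (int_EFin ip) (int_EFin ig) !integral_muO.
have mp2E : measurable_fun [set: T] (fun z : T => (p z.1)%:E) by exact/measurable_EFinP.
have p2E (z : T) : (0 <= (p z.1)%:E)%E by rewrite lee_fin.
have g0E (z : T) : (0 <= (g z)%:E)%E by rewrite lee_fin.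
rewrite (@fubini_tonelli2 _ _ _ _ R mu01 mu01 (fun z : T => (p z.1)%:E) mp2E p2E).
rewrite (@fubini_tonelli1 _ _ _ _ R mu01 mu01 (fun z : T => (g z)%:E) mgE g0E).
rewrite /fubini_F /fubini_G /= int01_cst.
by apply: eq_integral => y _; exact: pE.
Qed.

End SliceAverage.

(** * Oscillation of the logarithm *)

Section Oscillation.
Context (R : realType).
Local Notation T := (measurableTypeR R * measurableTypeR R)%type.
Local Notation mf f := (measurable_fun [set: T] f).
Local Notation mu := (muO R).
Local Notation mu01 := (@mu01 R).
Implicit Types (d e s x y : R) (f g phi w : R * R -> R).

Lemma increment_le (F F' : R -> R) d x y : continuous F' ->
  (forall s, is_derive s 1 F (F' s)) -> 0 <= d -> d < x < 1 - d -> d < y < 1 - d ->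
  ((F x - F y)%:E <= \int[mu01]_s (\1_(`]d, 1 - d[%classic) s * `|F' s|)%:E)%E.
Proof.
move=> cF dF d0; have mF' : measurable_fun setT F' by exact: continuous_measurable_fun.
pose h (s : measurableTypeR R) : \bar R := (\1_(`]d, 1 - d[%classic) s * `|F' s|)%:E.
have h0 s : (0 <= h s)%E by rewrite lee_fin mulr_ge0// indicE.
have mh : measurable_fun setT h.
  apply/measurable_EFinP; apply: measurable_funM; last exact: measurableT_comp.
  by apply: measurable_indic; exact: measurable_itv.
have key a b : a < b -> d < a -> b < 1 - d ->
    (`|(F b - F a)%:E| <= \int[mu01]_s h s)%E.
  move=> ab da bd; rewrite -(FTC_segment ab cF dF).
  apply: (@le_trans _ _ (\int[@lebesgue_measure R]_(s in `[a, b]) `|(F' s)%:E|)%E).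
    apply: le_abse_integral; first exact: measurable_itv.
    by apply/measurable_EFinP; exact: measurable_funTS.
  rewrite (integral_mu01 mh).
  apply: (@le_trans _ _ (\int[@lebesgue_measure R]_(s in `[a, b]) h s)%E); last first.
    apply: ge0_subset_integral.
    - exact: measurable_itv.
    - exact: measurable_itv.
    - exact: measurable_funTS.
    - by move=> s _; exact: h0.
    move=> s /=; rewrite !in_itv/= => /andP[as' sb]; apply/andP; split.
      exact: lt_le_trans (le_lt_trans d0 da) as'.
    by apply: le_lt_trans sb (lt_le_trans bd _); rewrite gerBl.
  rewrite le_eqVlt; apply/orP; left; apply/eqP; apply: eq_integral => s.
  rewrite inE/= in_itv/= => /andP[as' sb]; rewrite /h indicE mem_set ?mul1r//=.
  by rewrite in_itv/= (lt_le_trans da as') (le_lt_trans sb bd).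
move=> /andP[dx xd] /andP[dy yd]; have [xy|yx|->] := ltgtP x y.
- apply: le_trans (key _ _ xy dx yd); rewrite -opprB EFinN -abseN.
  by rewrite -EFinN; exact: lee_abs.
- by apply: le_trans (key _ _ yx dy xd); exact: lee_abs.
- by rewrite subrr; apply: integral_ge0 => s _; exact: h0.
Qed.

Lemma is_derive_lnD (F : R -> R) (e dF s : R) : 0 < e + F s ->
  is_derive s 1 F dF -> is_derive s 1 (fun t => ln (e + F t)) (dF / (e + F s)).
Proof.
move=> k0 HF; have H : is_derive s 1 (fun t => e + F t) dF.
  by have := is_deriveD (is_derive_cst e s (1 : R)) HF; rewrite add0r.
have := @is_derive1_comp _ (@ln R) (fun t => e + F t) s _ _ (is_derive1_ln k0) H.
by rewrite mulrC.
Qed.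

Definition square d : set (R * R) := rect d (1 - d) d (1 - d).

Section log.
Variables (phi : R * R -> R) (d e : R).
Hypotheses (tp : test_function phi) (p0 : forall z, 0 <= phi z) (e0 : 0 < e) (d0 : 0 <= d).

Let k_gt0 z : 0 < e + phi z. Proof. by rewrite ltr_pwDl. Qed.

Definition logf z : R := ln (e + phi z).
Definition slope b z : R := \1_(square d) z * `|'D_(dir R b) phi z / (e + phi z)|.

Lemma slope_ge0 b z : 0 <= slope b z.
Proof. by rewrite mulr_ge0// indicE. Qed.

Lemma measurable_slope b : mf (slope b).
Proof.
apply: measurable_funM; first by apply: measurable_indic; exact: measurable_rect.
apply: measurableT_comp => //; apply: measurable_funM.
  exact: smooth_measurable (test_smooth (testD_dir b tp)).
apply: smooth_measurable; apply: smooth_inv => //.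
by apply: smoothD; [exact: smooth_cst|exact: test_smooth].
Qed.

Lemma slope_bounded b : exists C, forall z, slope b z <= C.
Proof.
have [C C0 HC] := test_bounded (testD_dir b tp); exists (C / e) => z.
apply: (@le_trans _ _ `|'D_(dir R b) phi z / (e + phi z)|).
  by rewrite ler_piMl// indicE; case: (_ \in _).
rewrite normrM normfV (gtr0_norm (k_gt0 z)) ler_pM ?invr_ge0 ?(ltW (k_gt0 z))//.
by rewrite lef_pV2 ?posrE// lerDl.
Qed.

Lemma intble_slope b : intble mu (slope b).
Proof.
have [C HC] := slope_bounded b; apply: (@bounded_intble _ _ C).
  exact: measurable_slope.
by move=> z; rewrite ger0_norm ?slope_ge0.
Qed.

Lemma continuous_slope b : continuous (fun z : R * R => 'D_(dir R b) phi z / (e + phi z)).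
Proof.
apply: smooth_continuous; apply: smoothM; first exact: test_smooth (testD_dir b tp).
apply: smooth_inv => //.
by apply: smoothD; [exact: smooth_cst|exact: test_smooth].
Qed.

Lemma logf_increment1 x x' y : d < x < 1 - d -> d < x' < 1 - d -> d < y < 1 - d ->
  ((logf (x, y) - logf (x', y))%:E <= \int[mu01]_s (slope true (s, y))%:E)%E.
Proof.
move=> hx hx' hy.
have := @increment_le (fun s => logf (s, y)) (fun s => 'D_(ex R) phi (s, y) / (e + phi (s, y)))
  d x x' (slice1_continuous (y := y) (continuous_slope (b := true))) _ d0 hx hx'.
move=> h; apply: le_trans (h _) _.
  move=> s; apply: is_derive_lnD; first exact: k_gt0.
  exact: slice1_derive (test_smooth tp).
rewrite le_eqVlt; apply/orP; left; apply/eqP; apply: eq_integral => s _.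
rewrite /slope !indicE; congr (_%:R * _)%:E; congr (nat_of_bool _).
apply/idP/idP; rewrite !inE /square /rect/= !in_itv/=; first by move=> ->.
by case.
Qed.

Lemma logf_increment2 x y y' : d < x < 1 - d -> d < y < 1 - d -> d < y' < 1 - d ->
  ((logf (x, y) - logf (x, y'))%:E <= \int[mu01]_s (slope false (x, s))%:E)%E.
Proof.
move=> hx hy hy'.
have := @increment_le (fun s => logf (x, s)) (fun s => 'D_(ey R) phi (x, s) / (e + phi (x, s)))
  d y y' (slice2_continuous (x := x) (continuous_slope (b := false))) _ d0 hy hy'.
move=> h; apply: le_trans (h _) _.
  move=> s; apply: is_derive_lnD; first exact: k_gt0.
  exact: slice2_derive (test_smooth tp).
rewrite le_eqVlt; apply/orP; left; apply/eqP; apply: eq_integral => s _.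
rewrite /slope !indicE; congr (_%:R * _)%:E; congr (nat_of_bool _).
apply/idP/idP; rewrite !inE /square /rect/= !in_itv/=; first by move=> ->.
by case.
Qed.

Lemma ln_tangent x y : 0 < x -> 0 < y -> ln x <= ln y + (x - y) / y.
Proof.
move=> x0 y0; rewrite -lerBlDl -ln_div ?posrE//.
have -> : x / y = 1 + (x - y) / y by rewrite mulrBl mulfV ?gt_eqF// addrC subrK.
by apply: le_ln1Dx; rewrite mulrBl mulfV ?gt_eqF// ltrBDr addrC subrr divr_gt0.
Qed.

Lemma intble_logf : intble mu logf.
Proof.
have [C C0 HC] := test_bounded tp; apply: (@bounded_intble _ _ (`|ln e| + C / e)).
  apply: measurableT_comp; first exact: measurable_ln.
  apply: measurable_funD => //; exact: smooth_measurable (test_smooth tp).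
move=> z; have h1 : ln e <= logf z by rewrite ler_ln ?posrE// lerDl.
have h2 : logf z <= ln e + C / e.
  apply: le_trans (ln_tangent (k_gt0 z) e0) _; rewrite lerD2l addrAC subrr add0r.
  by rewrite ler_wpM2r ?invr_ge0 ?(ltW e0)// (le_trans (ler_norm _)).
have C1 : 0 <= C / e by rewrite divr_ge0// ltW.
rewrite ler_norml; apply/andP; split.
  have h3 : - `|ln e| <= ln e by rewrite lerNl -normrN ler_norm.
  by rewrite opprD; apply: le_trans h1; apply: le_trans h3; rewrite gerDl oppr_le0.
by apply: le_trans h2 _; rewrite lerD2r ler_norm.
Qed.

(** A path through (x', y) joins (x, y) to (x', y') within the square: the variation
    of ln (e + phi) is bounded by an integral over the line of height y plus one
    over the line of abscissa x'. *)
Lemma logf_mean (A B : set (R * R)) : measurable (A : set T) -> measurable (B : set T) ->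
  A `<=` square d -> B `<=` square d ->
  \int[mu]_z (\1_B z : R) * \int[mu]_z (\1_A z * logf z) <=
  \int[mu]_z (\1_A z : R) * \int[mu]_z (\1_B z * logf z) +
  (\int[mu]_z slope true z + \int[mu]_z slope false z).
Proof.
move=> mA mB AS BS; have [C1 HC1] := slope_bounded true; have [C2 HC2] := slope_bounded false.
have [p [pp pE ip <-]] := slice1_average (measurable_slope true) (slope_ge0 true) HC1.
have [r [rr rE ir <-]] := slice2_average (measurable_slope false) (slope_ge0 false) HC2.
apply: (mean_difference (muOT R) mA mB intble_logf ip ir) => // -[x y] [x' y'] Az Bz.
have /rectP[/= x1 x2 y1 y2] := AS _ Az; have /rectP[/= x1' x2' y1' y2'] := BS _ Bz.
have hx : d < x < 1 - d by rewrite x1 x2.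
have hy : d < y < 1 - d by rewrite y1 y2.
have hx' : d < x' < 1 - d by rewrite x1' x2'.
have hy' : d < y' < 1 - d by rewrite y1' y2'.
have := logf_increment1 hx hx' hy; rewrite -pE lee_fin => h1.
have := logf_increment2 hx' hy hy'; rewrite -rE lee_fin => h2.
by rewrite -addrA -lerBlDl; apply: le_trans (lerD h1 h2); rewrite addrA subrK.
Qed.

End log.
End Oscillation.

(** * The strong maximum principle *)

Section StrongMaximum.
Context (R : realType).
Local Notation T := (measurableTypeR R * measurableTypeR R)%type.
Local Notation mf f := (measurable_fun [set: T] f).
Local Notation mu := (muO R).
Implicit Types (a b d e x y L : R).

Lemma log_cancel a b x y L L' P : 0 <= a -> a <= 1 -> 0 <= b -> b <= 1 ->
  b * x <= a * y + P -> a * L' - 1 <= x -> y <= b * L + 1 ->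
  a * b * (L' - L) <= P + 2.
Proof.
move=> a0 a1 b0 b1 h1 /(ler_wpM2l b0) h2 /(ler_wpM2l a0) h3.
rewrite mulrBr mulr1 in h2; rewrite mulrDr mulr1 in h3.
by move: h2 h3; rewrite mulrBr !mulrA [b * a]mulrC; lra.
Qed.

Lemma log_unbounded x C d : 0 <= x -> 0 < d ->
  (forall e, 0 < e -> x * (ln (e + d) - ln e) <= C) -> x = 0.
Proof.
move=> x0 d0 H; apply/eqP; rewrite eq_le x0 andbT leNgt; apply/negP => x1.
(* t is the growth of the logarithm which exceeds the bound C *)
pose t := `|C| / x + 1.
have e0 : 0 < d * expR (- t) by rewrite mulr_gt0// expR_gt0.
have h := H _ e0.
have : x * t <= C.
  apply: le_trans h; rewrite ler_wpM2l// lnM ?posrE ?expR_gt0// expRK.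
  have : ln d <= ln (d * expR (- t) + d) by rewrite ler_ln ?posrE ?addr_gt0// lerDr ltW.
  by lra.
rewrite /t mulrDr mulr1 mulrCA mulfV ?gt_eqF// mulr1 => h2.
by have := lt_le_trans (ltr_pwDr x1 (ler_norm C)) h2; rewrite ltxx.
Qed.

Lemma squareP d (z : R * R) : square d z <-> [/\ d < z.1, z.1 < 1 - d, d < z.2 & z.2 < 1 - d].
Proof. exact: rectP. Qed.

Lemma square_exhaust (z : R * R) : Omega R z ->
  exists N, forall n, (N <= n)%N -> square (2^-1 ^+ n) z.
Proof.
have H x : 0 < x -> exists N, forall n, (N <= n)%N -> 2^-1 ^+ n < x.
  move=> x0; have x2 : 0 < x / 2 by rewrite divr_gt0.
  have [N HN] := half_small x2; exists N => n /HN h; apply: le_lt_trans h _.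
  by rewrite ltr_pdivrMr// ltr_pMr// ltr1n.
move=> [x0 x1 y0 y1].
have [N1 H1] := H _ x0; have [N2 H2] := H _ y0.
have [|N3 H3] := H (1 - z.1); first by rewrite subr_gt0.
have [|N4 H4] := H (1 - z.2); first by rewrite subr_gt0.
exists (maxn (maxn N1 N2) (maxn N3 N4)) => n.
rewrite !geq_max => /andP[/andP[/H1 h1 /H2 h2] /andP[/H3 h3 /H4 h4]].
by apply/squareP; split=> //; rewrite ltrBrDl addrC -ltrBrDl.
Qed.

Lemma square_sub d d' : d' <= d -> square d `<=` square d'.
Proof.
move=> dd z /squareP[h1 h2 h3 h4]; apply/squareP; split.
- exact: le_lt_trans h1.
- by apply: lt_le_trans h2 _; rewrite lerD2l lerN2.
- exact: le_lt_trans h3.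
- by apply: lt_le_trans h4 _; rewrite lerD2l lerN2.
Qed.

Context (alpha1 alpha2 : R).
Hypotheses (alpha1_gt0 : 0 < alpha1) (alpha2_gt0 : 0 < alpha2).
Local Notation H10 := (H10 alpha1 alpha2).
Local Notation aform := (aform alpha1 alpha2).
Local Notation grad := (grad alpha1 alpha2).
Local Notation wt := (wt alpha1 alpha2).
Local Notation Et := (Et alpha1 alpha2).

(** On the square, chi and the weights are bounded below. *)
Lemma cutoff d : 0 < d -> exists chi K, [/\ test_function chi,
  forall z, 0 <= chi z, forall z, chi z <= 1, 0 <= K &
  forall (b : bool) z, square d z -> 1 <= K * (chi z * wt b z)].
Proof.
move=> d0; have d2 : 0 < d / 2 by rewrite divr_gt0.
pose m := flat 0 (d / 2) : R.
have m0 : 0 < m by exact: flat0_gt0.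
have m2 : 0 < m * m * (m * m) * (d `^ alpha1 * d `^ alpha2).
  by do ?apply: mulr_gt0 => //; exact: powR_gt0.
exists (bump 1 (d / 2) (1 - d / 2) (d / 2) (1 - d / 2)),
  (m * m * (m * m) * (d `^ alpha1 * d `^ alpha2))^-1; split.
- by apply: test_bump => //; rewrite gtrBl.
- by move=> z; exact: bump_ge0.
- by move=> z; exact: bump_le1.
- by rewrite invr_ge0 ltW.
move=> b z /squareP[x1 x2 y1 y2]; rewrite ler_pdivlMl// mulr1.
have d1 : d <= 1 by rewrite leNgt; apply/negP => d1; move: x1 x2 d0; lra.
have half x : d < x -> m <= flat 0 (1 * x - 1 * (d / 2)).
  by move=> dx; apply: flat0_nondecreasing; rewrite !mul1r; move: dx d0; lra.
have half' x : x < 1 - d -> m <= flat 0 (1 * (1 - d / 2) - 1 * x).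
  by move=> dx; apply: flat0_nondecreasing; rewrite !mul1r; move: dx d0; lra.
have pw a : 0 < a -> d `^ a <= 1.
  have E : (1 : R) `^ a = 1 by rewrite powR1.
  by move=> a0; rewrite -[leRHS]E ge0_ler_powR ?nnegrE ?(ltW a0) ?(ltW d0).
have pz a x : 0 < a -> d < x -> d `^ a <= x `^ a.
  by move=> a0 dx; rewrite ge0_ler_powR ?nnegrE ?(ltW a0) ?(ltW d0) ?(ltW dx) ?(ltW (lt_trans d0 dx)).
have mm0 : 0 <= m * m by rewrite mulr_ge0// ltW.
have p1 := powR_ge0 d alpha1; have p2 := powR_ge0 d alpha2.
apply: ler_pM; [exact: mulr_ge0|exact: mulr_ge0| |].
  rewrite /bump; apply: ler_pM; [exact: mm0|exact: mm0| |].
    by apply: ler_pM; [exact: ltW|exact: ltW|exact: half|exact: half'].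
  by apply: ler_pM; [exact: ltW|exact: ltW|exact: half|exact: half'].
case: b.
  by apply: le_trans (pz alpha1 z.2 alpha1_gt0 y1) => /=; rewrite ler_piMr// pw.
by apply: le_trans (pz alpha2 z.1 alpha2_gt0 x1) => /=; rewrite ler_piMl// pw.
Qed.

Variables (V w : R * R -> R).
Hypotheses (mV : mf V) (iV : intble mu V) (V_ge0 : forall z, 0 <= V z).
Hypotheses (Hw : H10 w) (w0 : forall z, 0 <= w z).
Hypothesis iw : intble mu (fun z => V z * w z ^+ 2).
Hypothesis super : forall v, test_function v -> (forall z, 0 <= v z) ->
  0 <= aform w v + \int[mu]_z (V z * w z * v z).

Let Lw : L2 mu w. Proof. exact: H10_L2 Hw. Qed.
Let mw : mf w. Proof. by case: Lw. Qed.

Definition above (d h : R) : set (R * R) := square d `&` [set z | h <= w z].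
Definition vanishing (d : R) : set (R * R) := square d `&` [set z | w z = 0].

Lemma measurable_above d h : measurable (above d h : set T).
Proof.
apply: measurableI; first exact: measurable_rect.
have -> : [set z | h <= w z] = [set: T] `&` w @^-1` `[h, +oo[%classic.
  by rewrite setTI; apply/seteqP; split=> z /=; rewrite in_itv/= andbT.
by apply: mw => //; exact: measurable_itv.
Qed.

Lemma measurable_vanishing d : measurable (vanishing d : set T).
Proof.
apply: measurableI; first exact: measurable_rect.
have -> : [set z | w z = 0] = [set: T] `&` w @^-1` [set 0].
  by rewrite setTI; apply/seteqP; split.
by apply: mw => //; exact: measurable_set1.
Qed.

Lemma slope_le chi K d e phi : test_function phi -> (forall z, 0 <= phi z) -> 0 < e ->
  test_function chi -> (forall z, 0 <= chi z) -> (forall z, chi z <= 1) -> 0 <= K ->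
  (forall (b : bool) z, square d z -> 1 <= K * (chi z * wt b z)) -> forall b : bool,
  \int[mu]_z slope phi d e b z <=
    K * (1 + \int[mu]_z (log_grad alpha1 alpha2 e phi chi b z ^+ 2)).
Proof.
move=> tp p0 e0 tc c0 c1 K0 HK b.
have [_ il] := log_grad_L2 alpha1_gt0 alpha2_gt0 e0 tp p0 tc c0 c1 b.
have i1 : intble mu (cst 1) by exact: (finite_cst (muO_fin R)).
have i2 := intbleD i1 il.
have <- : \int[mu]_z (K * (cst 1 z + log_grad alpha1 alpha2 e phi chi b z ^+ 2)) =
    K * (1 + \int[mu]_z (log_grad alpha1 alpha2 e phi chi b z ^+ 2)).
  by rewrite (intZ K i2) (intD i1 il) Rintegral_cst// muOT mulr1.
apply: int_le; [exact: intble_slope|exact: (intbleZ K i2)|move=> z].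
have k0 : 0 < e + phi z by rewrite ltr_pwDl.
have sq (x : R) : `|x| <= 1 + x ^+ 2.
  by rewrite -(real_normK (num_real x)); move: `|x| (normr_ge0 x) => y; nra.
rewrite /slope indicE; case: (boolP (z \in square d)) => [/set_mem Sz|_]; last first.
  by rewrite mul0r mulr_ge0// addr_ge0// sqr_ge0.
rewrite mul1r; apply: le_trans (ler_wpM2l K0 (sq _)).
have h := HK b z Sz.
have E : K * `|log_grad alpha1 alpha2 e phi chi b z| =
    `|K * (chi z * wt b z)| * `|'D_(dir R b) phi z / (e + phi z)|.
  by rewrite /log_grad gradE -{1}(ger0_norm K0) -!normrM; congr (`| _ |); ring.
by rewrite E ler_peMl// (le_trans h)// ler_norm.
Qed.

(** Let phi be given by log_estimate, at distance e from w. The integral of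
    ln (e + phi) over vanishing d exceeds that of ln e by at most 1, and over
    above d h it falls short of that of ln (e + h) by at most 1; logf_mean and
    log_estimate compare the two integrals, uniformly in e. *)
Lemma above_vanishing_bound d h : 0 < d -> 0 < h -> exists C, forall e, 0 < e ->
  \int[mu]_z (\1_(above d h) z : R) * \int[mu]_z (\1_(vanishing d) z : R) *
  (ln (e + h) - ln e) <= C.
Proof.
move=> d0 h0; have [chi [K [tc c0 c1 K0 HK]]] := cutoff d0.
pose E := 4 * Et chi + 2 * \int[mu]_z (V z * chi z ^+ 2) + 4.
exists (K * (1 + E) + K * (1 + E) + 2) => e e0.
have [phi [tp p0 pw pE]] := log_estimate alpha1_gt0 alpha2_gt0 mV iV V_ge0 Hw w0 iw super
  e0 e0 tc c0 c1.
have mA := measurable_above d h; have mB := measurable_vanishing d.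
have m1 := muOT R.
have iA := intble_indic m1 mA; have iB := intble_indic m1 mB.
have ifl := intble_logf tp p0 e0.
have iAf := intble_indicM mA ifl; have iBf := intble_indicM mB ifl.
have S (b : bool) : \int[mu]_z slope phi d e b z <= K * (1 + E).
  apply: le_trans (slope_le tp p0 e0 tc c0 c1 K0 HK b) _.
  by apply: ler_wpM2l => //; rewrite lerD2l; exact: pE.
have Ld := L2B (test_L2 tp) Lw.
have id : intble mu (fun z => `|phi z - w z|) by exact: intble_norm (L2_intble (muO_fin R) Ld).
have Id : \int[mu]_z (e^-1 * `|phi z - w z|) <= 1.
  rewrite (intZ _ id) ler_pdivrMl// mulr1; apply: le_trans pw.
  by have := int_norm_le (muO_fin R) Ld; rewrite N2_cst1 mulr1.
have k_gt0 z : 0 < e + phi z by rewrite ltr_pwDl.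
apply: (@log_cancel _ _ (\int[mu]_z (\1_(above d h) z * logf phi e z))
  (\int[mu]_z (\1_(vanishing d) z * logf phi e z))).
- by apply: int_ge0 => z; rewrite indicE.
- exact: int_indic_le1.
- by apply: int_ge0 => z; rewrite indicE.
- exact: int_indic_le1.
- apply: le_trans (logf_mean tp p0 e0 (ltW d0) mA mB _ _) _.
  + by move=> z [].
  + by move=> z [].
  by rewrite lerD2l; apply: lerD; exact: S.
- have iL := intbleZ (ln (e + h)) iA; have iD := intbleZ e^-1 id.
  apply: (@le_trans _ _ (\int[mu]_z (ln (e + h) * \1_(above d h) z - e^-1 * `|phi z - w z|))).
    by rewrite (intB iL iD) (intZ _ iA) mulrC lerD2l lerN2.
  apply: int_le; [exact: (intbleB iL iD)|exact: iAf|move=> z].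
  have q0 : 0 <= e^-1 * `|phi z - w z| by rewrite mulr_ge0// invr_ge0 ltW.
  rewrite indicE; case: (boolP (z \in above d h)) => [/set_mem [_ /= hw]|_]; last first.
    by rewrite mulr0 mul0r sub0r oppr_le0.
  rewrite mulr1 mul1r lerBlDr; have eh : 0 < e + h by rewrite addr_gt0.
  apply: le_trans (ln_tangent eh (k_gt0 z)) _; rewrite lerD2l.
  have n1 : h - phi z <= `|phi z - w z|.
    by apply: le_trans (_ : w z - phi z <= _); rewrite ?lerD2r// -normrN opprB ler_norm.
  rewrite opprD addrACA subrr add0r ler_pdivrMr//.
  apply: le_trans n1 _; rewrite mulrAC ler_peMl// ler_pdivlMl// mulr1 lerDl.
  exact: p0.
- have iL := intbleZ (ln e) iB; have iD := intbleZ e^-1 id.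
  apply: (@le_trans _ _ (\int[mu]_z (ln e * \1_(vanishing d) z + e^-1 * `|phi z - w z|))); last first.
    by rewrite (intD iL iD) (intZ _ iB) mulrC lerD2l.
  apply: int_le; [exact: iBf|exact: (intbleD iL iD)|move=> z].
  have q0 : 0 <= e^-1 * `|phi z - w z| by rewrite mulr_ge0// invr_ge0 ltW.
  rewrite indicE; case: (boolP (z \in vanishing d)) => [/set_mem [_ /= hw]|_]; last first.
    by rewrite mulr0 mul0r add0r.
  rewrite mulr1 mul1r hw subr0 (ger0_norm (p0 z)).
  apply: le_trans (ln_tangent (k_gt0 z) e0) _; rewrite lerD2l addrAC subrr add0r.
  by rewrite mulrC.
Qed.

(** Otherwise the left side of above_vanishing_bound is unbounded as e tends to 0. *)
Lemma above_or_vanishing d h : 0 < d -> 0 < h ->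
  \int[mu]_z (\1_(above d h) z : R) = 0 \/ \int[mu]_z (\1_(vanishing d) z : R) = 0.
Proof.
move=> d0 h0; have [C HC] := above_vanishing_bound d0 h0.
have a0 : 0 <= \int[mu]_z (\1_(above d h) z : R) by apply: int_ge0 => z; rewrite indicE.
have b0 : 0 <= \int[mu]_z (\1_(vanishing d) z : R) by apply: int_ge0 => z; rewrite indicE.
have /eqP := log_unbounded (mulr_ge0 a0 b0) h0 HC.
by rewrite mulf_eq0 => /orP[] /eqP; [left|right].
Qed.

Lemma int_indic_null (A : set (R * R)) : measurable (A : set T) ->
  \int[mu]_z (\1_A z : R) = 0 -> {ae mu, forall z, ~ A z}.
Proof.
move=> mA I0; have iA := intble_indic (muOT R) mA.
have E : (\1_A : R * R -> R) = cst 0 %[ae mu].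
  apply: int_eq0_ae iA _ _; last by rewrite I0.
  by apply: aeW => z; rewrite indicE.
apply: (ae_imply E) => z Ez Az; have := Ez I.
by rewrite indicE mem_set//= => /eqP; rewrite oner_eq0.
Qed.

(** If w vanishes on a non-null part of some square, above_or_vanishing applies on
    all larger squares and at all heights; the squares exhaust the domain. *)
Lemma strong_maximum : w = cst 0 %[ae mu] \/ {ae mu, forall z, 0 < w z}.
Proof.
have p0 n : 0 < (2^-1 : R) ^+ n by rewrite exprn_gt0.
have OmegaT := muO_ae_Omega R.
have [[n0 Bn0]|H] := pselect (exists n0, \int[mu]_z (\1_(vanishing (2^-1 ^+ n0)) z : R) <> 0).
  left; have A0 n : {ae mu, forall z, ~ above (2^-1 ^+ (n0 + n)) (2^-1 ^+ n) z}.
    apply: int_indic_null; first exact: measurable_above.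
    have [//|B0] := above_or_vanishing (p0 (n0 + n)%N) (p0 n).
    exfalso; apply: Bn0; apply/eqP; rewrite eq_le; apply/andP; split; last first.
      by apply: int_ge0 => z; rewrite indicE.
    rewrite -B0; have m1 := muOT R.
    apply: int_le; [exact: (intble_indic m1 (measurable_vanishing _))|
      exact: (intble_indic m1 (measurable_vanishing _))|move=> z].
    rewrite !indicE ler_nat; case: (boolP (z \in vanishing (2^-1 ^+ n0))) => // /set_mem[Sz wz].
    rewrite mem_set//; split; last exact: wz.
    apply: square_sub Sz; rewrite exprD ler_piMr ?(ltW (p0 n0))//.
    by rewrite exprn_ile1//; exact: half_le1.
  have A0' := ae_foralln A0.
  apply: (ae_imply2 A0' OmegaT) => z HA Oz _; apply/eqP; rewrite eq_le w0 andbT leNgt.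
  apply/negP => wz; have [N1 H1] := square_exhaust Oz; have [N2 H2] := half_small wz.
  apply: (HA (maxn N1 N2)); split; last by apply: H2; rewrite leq_maxr.
  by apply: H1; rewrite (leq_trans (leq_maxl N1 N2))// leq_addl.
right; have B0 n : {ae mu, forall z, ~ vanishing (2^-1 ^+ n) z}.
  apply: int_indic_null; first exact: measurable_vanishing.
  by apply: contrapT => Bn; apply: H; exists n.
have B0' := ae_foralln B0.
apply: (ae_imply2 B0' OmegaT) => z HB Oz; rewrite lt_neqAle w0 andbT.
apply/eqP => wz; have [N H1] := square_exhaust Oz.
by apply: (HB N); split; [exact: H1|].
Qed.

End StrongMaximum.

(** * Simplicity of the first eigenvalue *)

Section Simplicity.
Context (R : realType) (alpha1 alpha2 : R).
Hypotheses (alpha1_gt0 : 0 < alpha1) (alpha2_gt0 : 0 < alpha2).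
Local Notation T := (measurableTypeR R * measurableTypeR R)%type.
Local Notation mf f := (measurable_fun [set: T] f).
Local Notation mu := (muO R).
Local Notation H10 := (H10 alpha1 alpha2).
Local Notation H0 := (H0 alpha1 alpha2).
Local Notation aform := (aform alpha1 alpha2).
Implicit Types (u v w : R * R -> R).

Variables (V : R * R -> R) (m : R).
Hypotheses (mV : mf V) (iV : intble mu V) (V_ge0 : forall z, 0 <= V z) (m_ge0 : 0 <= m).
Local Notation form := (form alpha1 alpha2 V m).
Local Notation null := (null alpha1 alpha2 V m).
Hypothesis form_ge0 : forall v, H0 V v -> 0 <= form v v.

Let aeV : {ae mu, forall z, 0 <= V z}. Proof. by apply: aeW => z; exact: V_ge0. Qed.

Lemma H0_test v : test_function v -> H0 V v.
Proof.
move=> tv; apply/(H0P _ _ mV aeV); split; first exact: H10_test.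
have [C C0 HC] := test_bounded tv; have [mv _] := test_L2 tv.
apply: (@intble_le _ _ _ _ _ (fun z : T => C ^+ 2 * V z)); last exact: intbleZ.
  by apply: measurable_funM => //; exact: measurable_funX.
move=> z; rewrite normrM (ger0_norm (V_ge0 z)) mulrC; apply: ler_wpM2r => //.
by rewrite normrX lerXn2r ?nnegrE.
Qed.

Lemma null_supersolution w : null w -> (forall z, 0 <= w z) ->
  forall v, test_function v -> (forall z, 0 <= v z) ->
  0 <= aform w v + \int[mu]_z (V z * w z * v z).
Proof.
move=> [Hw Qw] w0 v tv v0.
have := form_null alpha1_gt0 alpha2_gt0 mV aeV form_ge0 Hw Qw (H0_test tv).
move=> /eqP; rewrite subr_eq0 => /eqP ->.
by rewrite mulr_ge0// int_ge0// => z; rewrite mulr_ge0.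
Qed.

(** |u| + u is a nonnegative null vector, subject to strong_maximum. *)
Lemma null_sign u : null u ->
  {ae mu, forall z, u z <= 0} \/ {ae mu, forall z, 0 < u z}.
Proof.
move=> Nu; have Na := null_abs alpha1_gt0 alpha2_gt0 mV aeV form_ge0 Nu.
have := null_lin alpha1_gt0 alpha2_gt0 mV aeV form_ge0 1 1 Na Nu.
set w := fun z => 1 * `|u z| + 1 * u z => Nw.
have w0 z : 0 <= w z.
  by rewrite /w !mul1r -lerBlDr sub0r -normrN ler_norm.
have [Hw0 _] := Nw; have [Hw iw] := (H0P _ _ mV aeV _).1 Hw0.
have [E|E] := strong_maximum alpha1_gt0 alpha2_gt0 mV iV V_ge0 Hw w0 iw
  (null_supersolution Nw w0).
  left; apply: (ae_imply E) => z /(_ I); rewrite /w !mul1r => /eqP.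
  by rewrite addr_eq0 => /eqP h; rewrite -oppr_ge0 -h.
right; apply: (ae_imply E) => z; rewrite /w !mul1r.
by have [//|uz] := ltP 0 (u z); rewrite ler0_norm// addNr ltxx.
Qed.

Lemma null_int0 u : null u -> \int[mu]_z u z = 0 -> u = cst 0 %[ae mu].
Proof.
move=> Nu I0; have [Hu0 _] := Nu; have [Hu _] := (H0P _ _ mV aeV _).1 Hu0.
have iu := L2_intble (muO_fin R) (H10_L2 Hu).
have [h|h] := null_sign Nu; last first.
  apply: int_eq0_ae iu _ _; last by rewrite I0.
  by apply: (ae_imply h) => z /ltW.
have E : (fun z => -1 * u z) = cst 0 %[ae mu].
  apply: int_eq0_ae (intbleZ (-1) iu) _ _; last by rewrite (intZ _ iu) I0 mulr0.
  by apply: (ae_imply h) => z; rewrite mulN1r oppr_ge0.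
apply: (ae_imply E) => z /(_ I) /= h' _.
by apply/eqP; rewrite -oppr_eq0 -mulN1r h'.
Qed.

(** The combination of u and u0 of integral 0 is a null vector of constant sign. *)
Lemma null_simple u0 u : null u0 -> nonzero u0 -> null u ->
  exists c : R, u = (fun z => c * u0 z) %[ae mu].
Proof.
move=> N0 nz Nu; have [H0' _] := N0; have [Hu0 _] := (H0P _ _ mV aeV _).1 H0'.
have [Hu' _] := Nu; have [Hu _] := (H0P _ _ mV aeV _).1 Hu'.
have i0 := L2_intble (muO_fin R) (H10_L2 Hu0).
have iu := L2_intble (muO_fin R) (H10_L2 Hu).
have I0 : \int[mu]_z u0 z != 0 by apply/eqP => /(null_int0 N0).
pose c := \int[mu]_z u z / \int[mu]_z u0 z.
have Nv := null_lin alpha1_gt0 alpha2_gt0 mV aeV form_ge0 1 (- c) Nu N0.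
exists c; have := null_int0 Nv.
rewrite (intD (intbleZ 1 iu) (intbleZ (- c) i0)) (intZ _ iu) (intZ _ i0) mul1r mulNr.
rewrite /c divfK// subrr => /(_ erefl) E.
apply: (ae_imply E) => z /(_ I) h _.
by apply/eqP; rewrite -subr_eq0; move: h; rewrite mul1r mulNr => ->.
Qed.

End Simplicity.

(** * Extremality of the potential *)

Section Extremal.
Context (R : realType) (alpha1 alpha2 p q M : R).
Hypotheses (alpha1_gt0 : 0 < alpha1) (alpha2_gt0 : 0 < alpha2).
Hypotheses (p_gt1 : 1 < p) (q_gt1 : 1 < q) (pq : p^-1 + q^-1 = 1) (M_gt0 : 0 < M).
Local Notation mf f := (measurable_fun [set: (measurableTypeR R * measurableTypeR R)%type] f).
Local Notation mu := (muO R).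
Local Notation H0 := (H0 alpha1 alpha2).
Local Notation aform := (aform alpha1 alpha2).
Local Notation lambda1 := (lambda1 alpha1 alpha2).
Local Notation ground := (ground alpha1 alpha2 q M).
Implicit Types (u v V : R * R -> R).

Lemma U_sub_H0 V : Sp p M V -> U alpha1 alpha2 q `<=` H0 V.
Proof.
move=> SV u /(UP _ _ q_gt1) [Hu fu]; have [mV _ _ V_ge0] := SpP p_gt1 M_gt0 SV.
have [mu' _] := H10_L2 Hu.
apply/(H0P _ _ mV V_ge0); split; first exact: Hu.
exact: (Sp_int p_gt1 q_gt1 pq M_gt0 SV mu' fu).
Qed.

Variable u0 : R * R -> R.
Hypothesis min0 : J_minimizer alpha1 alpha2 q M u0.

Local Notation V0 := (V0 q M u0).
Let G := ground_minimizer alpha1_gt0 alpha2_gt0 q_gt1 M_gt0 min0.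
Let Hu0 : H10 alpha1 alpha2 u0. Proof. by case: G. Qed.
Let fu0 : fin_q q u0. Proof. by case: G. Qed.
Let n0 : 0 < N2 mu u0. Proof. by case: G. Qed.
Let E0 : energy alpha1 alpha2 q M u0 = ground * N2 mu u0 ^+ 2. Proof. by case: G. Qed.
Let nz0 : nonzero u0. Proof. by apply/(nonzeroP (H10_L2 Hu0)). Qed.
Let U0 : U alpha1 alpha2 q u0. Proof. by case: min0. Qed.

Let SV0 : Sp p M V0. Proof. exact: (Sp_V0 p_gt1 q_gt1 pq M_gt0 Hu0 fu0 n0). Qed.
Let mV0 : mf V0. Proof. exact: (measurable_V0 q M Hu0). Qed.
Let V0_ge z : 0 <= V0 z. Proof. exact: (V0_ge0 M_gt0 Hu0 fu0 n0 z). Qed.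
Let aeV0 : {ae mu, forall z, 0 <= V0 z}. Proof. by apply: aeW => z; exact: V0_ge. Qed.
Let H00 : H0 V0 u0. Proof. exact: (U_sub_H0 SV0 U0). Qed.

Let iV0 : intble mu V0.
Proof.
have m1 : mf (cst 1 : R * R -> R) by exact: measurable_cst.
have f1 : fin_q q (cst 1 : R * R -> R).
  by apply: (@fin_q_bounded _ q q_gt1 _ 1) => // z; rewrite normr1.
have := V0_int M q_gt1 Hu0 fu0 m1 f1.
by apply: intble_ext => z; rewrite expr1n mulr1.
Qed.

Lemma lambda1_test V : Sp p M V ->
  lambda1 V * N2 mu u0 ^+ 2 <= aform u0 u0 + \int[mu]_z (V z * u0 z ^+ 2).
Proof.
move=> SV; have [mV _ _ V_ge0] := SpP p_gt1 M_gt0 SV.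
exact: (lambda1_le mV V_ge0 (U_sub_H0 SV U0) nz0).
Qed.

(** Test with u0: by Sp_le the integral of V u0^2 is at most M * Nq u0. *)
Lemma lambda1_le_ground V : Sp p M V -> lambda1 V <= ground.
Proof.
move=> SV; have h := le_trans (lambda1_test SV)
  (lerD (lexx _) (Sp_le p_gt1 q_gt1 pq M_gt0 Hu0 fu0 n0 SV)).
rewrite -[X in _ <= X]/(energy alpha1 alpha2 q M u0) E0 in h.
by rewrite ler_pM2r ?exprn_gt0// in h.
Qed.

(** ground_V0 says that no quotient of V0 lies below ground. *)
Lemma lambda1_V0 : lambda1 V0 = ground.
Proof.
apply/eqP; rewrite eq_le lambda1_le_ground//=.
apply: (lambda1_ge mV0 aeV0 H00 nz0) => v /(H0P _ _ mV0 aeV0) [Hv iv].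
exact: (ground_V0 alpha1_gt0 alpha2_gt0 q_gt1 M_gt0 Hu0 fu0 n0 E0 Hv iv).
Qed.

(** The chain of inequalities behind lambda1_le_ground consists of equalities. *)
Lemma maximizer_unique V : Sp p M V -> ground <= lambda1 V -> V = V0 %[ae mu].
Proof.
move=> SV gV; apply: (Sp_eq p_gt1 q_gt1 pq M_gt0 Hu0 fu0 n0 SV).
have := le_trans (ler_wpM2r (sqr_ge0 _) gV) (lambda1_test SV).
by rewrite -E0 /energy lerD2l.
Qed.

Let ground_ge0 : 0 <= ground.
Proof.
have := energy_ge0 q M_gt0 Hu0.
by rewrite E0 pmulr_lge0 ?exprn_gt0.
Qed.

Let form_ge0 v : H0 V0 v -> 0 <= form alpha1 alpha2 V0 ground v v.
Proof.
move=> /(H0P _ _ mV0 aeV0) [Hv iv]; rewrite form_sqr subr_ge0.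
exact: (ground_V0 alpha1_gt0 alpha2_gt0 q_gt1 M_gt0 Hu0 fu0 n0 E0 Hv iv).
Qed.

Let null_u0 : null alpha1 alpha2 V0 ground u0.
Proof.
split; first exact: H00.
apply/eqP; rewrite form_sqr subr_eq0 -E0 /energy.
by rewrite (V0_u0 M q_gt1 Hu0 fu0 n0).
Qed.

Lemma minimizer_first_eigenfunction : first_eigenfunction alpha1 alpha2 V0 u0.
Proof.
split; [exact: H00|exact: nz0|move=> v Hv].
have [_ Q0] := null_u0.
have := form_null alpha1_gt0 alpha2_gt0 mV0 aeV0 form_ge0 H00 Q0 Hv.
by rewrite lambda1_V0 => /eqP; rewrite subr_eq0 => /eqP.
Qed.

Lemma first_eigenfunction_simple u : first_eigenfunction alpha1 alpha2 V0 u ->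
  exists c : R, u = (fun z => c * u0 z) %[ae mu].
Proof.
move=> [Hu nz eq_u].
apply: (null_simple alpha1_gt0 alpha2_gt0 mV0 iV0 V0_ge ground_ge0 form_ge0 null_u0 nz0).
split; first exact: Hu.
by apply/eqP; rewrite /form (eq_u u Hu) lambda1_V0 subrr.
Qed.

End Extremal.


Theorem theorem4p7 (R : realType) (alpha1 alpha2 M p q : R)
    (alpha1_gt0 : 0 < alpha1) (alpha1_lt : alpha1 < 2^-1)
    (alpha2_gt0 : 0 < alpha2) (alpha2_lt : alpha2 < 2^-1)
    (M_gt0 : 0 < M) (p_gt1 : 1 < p) (pq : p^-1 + q^-1 = 1) :
  [/\ forall V, Sp p M V -> U alpha1 alpha2 q `<=` H0 alpha1 alpha2 V,
      exists u0, J_minimizer alpha1 alpha2 q M u0 &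
      forall u0, J_minimizer alpha1 alpha2 q M u0 ->
        let V0 := V_of q M u0 in
        [/\ Sp p M V0
            /\ (forall V, Sp p M V ->
                  lambda1 alpha1 alpha2 V <= lambda1 alpha1 alpha2 V0),
            first_eigenfunction alpha1 alpha2 V0 u0
            /\ (forall u, first_eigenfunction alpha1 alpha2 V0 u ->
                  exists c : R, u = (fun z => c * u0 z) %[ae muO R]),
            lambda1 alpha1 alpha2 V0 = J alpha1 alpha2 q M u0,
            J alpha1 alpha2 q M u0
            = sup [set lambda1 alpha1 alpha2 V | V in Sp p M] &
            forall V, Sp p M V ->
              (forall W, Sp p M W ->
                 lambda1 alpha1 alpha2 W <= lambda1 alpha1 alpha2 V) ->
              V = V0 %[ae muO R]]].
Proof.
have p0 : 0 < p by exact: lt_trans p_gt1.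
have qE : q^-1 = 1 - p^-1 by rewrite -pq addrAC subrr add0r.
have q0 : 0 < q by rewrite -invr_gt0 qE subr_gt0 invf_lt1.
have q_gt1 : 1 < q by rewrite -(invf_lt1 q0) qE gtrBl invr_gt0.
split.
- by move=> V; exact: U_sub_H0.
- exact: exists_minimizer.
move=> u0 min0 /=; have [_ fu0 _ _] := ground_minimizer alpha1_gt0 alpha2_gt0 q_gt1 M_gt0 min0.
rewrite (V_of_V0 M fu0).
have L0 := lambda1_V0 alpha1_gt0 alpha2_gt0 p_gt1 q_gt1 pq M_gt0 min0.
have J0 := J_ground alpha1_gt0 alpha2_gt0 q_gt1 M_gt0 min0.
have le0 V (SV : Sp p M V) := lambda1_le_ground alpha1_gt0 alpha2_gt0 p_gt1 q_gt1 pq M_gt0 min0 SV.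
have S0 : Sp p M (V0 q M u0).
  have [Hu0 _ n0 _] := ground_minimizer alpha1_gt0 alpha2_gt0 q_gt1 M_gt0 min0.
  exact: (Sp_V0 p_gt1 q_gt1 pq M_gt0 Hu0 fu0 n0).
split.
- by split=> // V SV; rewrite L0; exact: le0.
- split; first exact: (minimizer_first_eigenfunction alpha1_gt0 alpha2_gt0 p_gt1 q_gt1 pq M_gt0 min0).
  move=> u Fu.
  exact: (first_eigenfunction_simple alpha1_gt0 alpha2_gt0 p_gt1 q_gt1 pq M_gt0 min0 Fu).
- by rewrite L0 J0.
- rewrite J0; apply/eqP; rewrite eq_le; apply/andP; split.
    apply: ub_le_sup; first by exists (ground alpha1 alpha2 q M) => _ [V SV <-]; exact: le0.
    by exists (V0 q M u0).
  apply: ge_sup; first by exists (lambda1 alpha1 alpha2 (V0 q M u0)), (V0 q M u0).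
  by move=> _ [V SV <-]; exact: le0.
- move=> V SV maxV; apply: (maximizer_unique alpha1_gt0 alpha2_gt0 p_gt1 q_gt1 pq M_gt0 min0 SV).
  by rewrite -L0; exact: maxV.
Qed.
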